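(* Let $\mathcal{K}_1=(K_1,\mathbf{k}_1,\Gamma_1;\pi_1,v_1,c_1,\mathrm{ac}_1)$ and $\mathcal{K}_2=(K_2,\mathbf{k}_2,\Gamma_2;\pi_2,v_2,c_2,\mathrm{ac}_2)$ be models of $\mathrm{Mo}(c,\mathrm{ac})$ such that the valued differential fields $K_1$ and $K_2$ are differential-henselian. Let $\mathbf{E}_1$ and $\mathbf{E}_2$ be good substructures of $\mathcal{K}_1$ and $\mathcal{K}_2$ respectively. Then every good map $\mathbf{f}=(f,f_r,f_v):\mathbf{E}_1\to\mathbf{E}_2$ is a partial elementary map between the $L_3(\mathrm{ac})$-structures $\mathcal{K}_1$ and $\mathcal{K}_2$; that is, for every $L_3(\mathrm{ac})$-formula $\phi(x,y,z)$ (with $x$ f-variables, $y$ r-variables, $z$ v-variables) and all tuples $a$ from $E_1$, $d$ from $\mathbf{k}_{\mathbf{E}_1}$, $\gamma$ from $\Gamma_{\mathbf{E}_1}$, we have $\mathcal{K}_1\models\phi(a,d,\gamma)$ iff $\mathcal{K}_2\models\phi(f(a),f_r(d),f_v(\gamma))$.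
   Context: All differential fields have characteristic $0$ with a single derivation; $f^\dagger:=f'/f$ for $f\ne0$. A valued differential field $K$ with valuation $v$, valuation ring $\mathcal{O}$ is monotone if $v(f')\ge v(f)$ for all $f\in K^\times$. It is differential-henselian if every differential polynomial $P\in\mathcal{O}\{Y\}=\mathcal{O}[Y,Y',Y'',\dots]$ whose reduction $\overline{P}$ (coefficientwise, to the residue field) has total degree $1$ has a zero in $\mathcal{O}$. A model of $\mathrm{Mo}(c)$ is $(K,\mathbf{k},\Gamma;\pi,v,c)$ with $K,\mathbf{k}$ differential fields, $\Gamma$ an ordered abelian group, $v:K^\times\to\Gamma$ a surjective valuation making $K$ a monotone valued differential field with valuation ring $\mathcal{O}$, $\pi:\mathcal{O}\to\mathbf{k}$ a surjective differential ring morphism, $c:\Gamma\to\mathbf{k}$ additive such that for each $\gamma$ some $x\in K^\times$ has $v(x)=\gamma$, $\pi(x^\dagger)=c(\gamma)$. With $C$ the constant field of $K$, an angular component map is $\mathrm{ac}:K^\times\to\mathbf{k}^\times$ with (1) $\mathrm{ac}$ a multiplicative morphism, $\mathrm{ac}(a)=\pi(a)$ when $v(a)=0$; (2) $\mathrm{ac}(a^\dagger)=\mathrm{ac}(a)^\dagger+c(v(a))$ when $v(a')=v(a)$; (3) $\mathrm{ac}(d)^\dagger=-c(v(d))$ for $d\in C^\times$; extended by $\mathrm{ac}(0)=0$. Models of $\mathrm{Mo}(c,\mathrm{ac})$ are $(K,\mathbf{k},\Gamma;\pi,v,c,\mathrm{ac})$ with $(K,\mathbf{k},\Gamma;\pi,v,c)\models\mathrm{Mo}(c)$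 and $\mathrm{ac}$ an angular component map on it. The language $L_3(\mathrm{ac})$: sorts f, r, v; differential ring language $\{0,1,-,+,\cdot,\partial\}$ on f and on r; $\{\le,0,-,+\}$ on v; unary function symbols $\pi$ (f to r), $v$ (f to v), $c$ (v to r), $\mathrm{ac}$ (f to r); a default value $\infty$ is added to the r- and v-sorts with $\pi(x)=\infty$ iff $x\notin\mathcal{O}$, $v(0)=\infty$. A subfield $E$ of $K$ carries valuation ring $\mathcal{O}_E=E\cap\mathcal{O}$. A good substructure of $\mathcal{K}$ is a triple $\mathbf{E}=(E,\mathbf{k}_{\mathbf{E}},\Gamma_{\mathbf{E}})$ with $E$ a differential subfield of $K$; $\mathbf{k}_{\mathbf{E}}$ a differential subfield of $\mathbf{k}$ with $\mathrm{ac}(E)\subseteq\mathbf{k}_{\mathbf{E}}$; $\Gamma_{\mathbf{E}}$ an ordered subgroup of $\Gamma$ with $v(E^\times)\subseteq\Gamma_{\mathbf{E}}$ and $c(\Gamma_{\mathbf{E}})\subseteq\mathbf{k}_{\mathbf{E}}$. For good substructures $\mathbf{E}_i=(E_i,\mathbf{k}_{\mathbf{E}_i},\Gamma_{\mathbf{E}_i})$ of $\mathcal{K}_i$ ($i=1,2$), a good map $\mathbf{f}=(f,f_r,f_v):\mathbf{E}_1\to\mathbf{E}_2$ consists of a differential field isomorphism $f:E_1\to E_2$, a differential field isomorphism $f_r:\mathbf{k}_{\mathbf{E}_1}\to\mathbf{k}_{\mathbf{E}_2}$ and an ordered group isomorphism $f_v:\Gamma_{\mathbf{E}_1}\to\Gamma_{\mathbf{E}_2}$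 such that $f_r(\mathrm{ac}_1(a))=\mathrm{ac}_2(f(a))$ for $a\in E_1$, $f_v(v_1(a))=v_2(f(a))$ for $a\in E_1^\times$, and $(f_r,f_v)$ is a partial elementary map between the two-sorted structures $(\mathbf{k}_1,\Gamma_1;c_1)$ and $(\mathbf{k}_2,\Gamma_2;c_2)$ in the language $L_{\mathrm{rv}}$ (the r- and v-parts of $L_3$ together with $c$). *)

(* Defs.v *)
From HB Require Import structures.
From mathcomp Require Import all_boot all_order all_algebra.
From mathcomp Require Import ring_quotient mpoly.

Set Implicit Arguments.
Unset Strict Implicit.
Unset Printing Implicit Defensive.

Import Order.TTheory GRing.Theory.
Local Open Scope ring_scope.

(* [fdom f i] is the sort of the [i]-th argument of [f]. *)
Record signature := Signature {
  sort : Type;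
  func : Type;
  farity : func -> nat;
  fdom : forall f : func, 'I_(farity f) -> sort;
  fcod : func -> sort;
  rel : Type;
  rarity : rel -> nat;
  rdom : forall r : rel, 'I_(rarity r) -> sort
}.

Record structure (L : signature) := Structure {
  carrier :> sort L -> Type;
  finterp : forall f : func L,
    (forall i, carrier (@fdom L f i)) -> carrier (fcod f);
  rinterp : forall r : rel L, (forall i, carrier (@rdom L r i)) -> Prop
}.

(* A variable is a pair (sort, index). *)
Inductive term (L : signature) : sort L -> Type :=
| Var (s : sort L) (n : nat) : term s
| App (f : func L) (ts : forall i, term (@fdom L f i)) : term (fcod f).

Inductive formula (L : signature) : Type :=
| FFalse
| FEq (s : sort L) (t u : term s)
| FRel (r : rel L) (ts : forall i, term (@rdom L r i))
| FImp (p q : formula L)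
| FAll (s : sort L) (n : nat) (p : formula L).

Section Semantics.
Variables (L : signature) (M : structure L).

Definition assignment := forall s : sort L, nat -> M s.

Fixpoint eval (e : assignment) (s : sort L) (t : term s) : M s :=
  match t with
  | Var s n => e s n
  | App f ts => finterp (fun i => eval e (ts i))
  end.

(* The quantifier ranges over all assignments that agree with [e] except
   possibly at the variable [(s, n)]. *)
Fixpoint sat (p : formula L) (e : assignment) : Prop :=
  match p with
  | FFalse => False
  | FEq s t u => eval e t = eval e u
  | FRel r ts => rinterp (fun i => eval e (ts i))
  | FImp p q => sat p e -> sat q e
  | FAll s n p => forall e' : assignment,
      (forall s' m, (s', m) <> (s, n) -> e' s' m = e s' m) -> sat p e'
  end.

End Semantics.

(* The map [h], with domain the sets [A s], preserves and reflects all
   formulas. Assignments are total, so this is the usual notion when each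
   [A s] is nonempty, as is the case for good substructures below. *)
Definition partial_elementary (L : signature) (M N : structure L)
    (A : forall s, M s -> Prop) (h : forall s, M s -> N s) : Prop :=
  forall (p : formula L) (e : assignment M),
    (forall s n, A s (e s n)) ->
    (sat p e <-> sat p ((fun s n => h s (e s n)) : assignment N)).

HB.mixin Record Field_isDifferential K of GRing.Field K := {
  der : K -> K;
  derD : forall x y : K, der (x + y) = der x + der y;
  derM : forall x y : K, der (x * y) = der x * y + x * der y;
  diff_pchar0 : [pchar K] =i pred0
}.

#[short(type="diffFieldType")]
HB.structure Definition DiffField :=
  { K of GRing.Field K & Field_isDifferential K }.

Definition logder (K : diffFieldType) (x : K) : K := der x / x.

(* Totality is an axiom of this mixin, and the [Order.Total] instance is derived
   from it: a structure joining [GRing.Zmodule] and [Order.Total] would conflict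
   with the existing hierarchy below [realDomainType]. *)
HB.mixin Record POrderedZmodule_isOrderedAbGroup G of Num.POrderedZmodule G := {
  oag_leD2l : forall z x y : G, x <= y -> z + x <= z + y;
  oag_total : forall x y : G, (x <= y) || (y <= x)
}.

#[short(type="oagType")]
HB.structure Definition OrderedAbGroup :=
  { G of Num.POrderedZmodule G & POrderedZmodule_isOrderedAbGroup G }.

HB.instance Definition _ (G : oagType) :=
  Order.POrder_isTotal.Build ring_display (OrderedAbGroup.sort G) (@oag_total G).

(* [option G] stands for [G] with a largest element [None] added. *)
Definition leoo (G : oagType) (x y : option G) : bool :=
  match x, y with
  | _, None => true
  | None, Some _ => false
  | Some g, Some h => g <= h
  end.

(* The value of [vdf_v] at 0 is irrelevant. *)
Record valuedDiffField := ValuedDiffField {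
  vdf_sort :> diffFieldType;
  vdf_group : oagType;
  vdf_v : vdf_sort -> vdf_group;
  vdf_vM : forall x y : vdf_sort, x != 0 -> y != 0 ->
    vdf_v (x * y) = vdf_v x + vdf_v y;
  vdf_vD : forall x y : vdf_sort, x != 0 -> y != 0 -> x + y != 0 ->
    Order.min (vdf_v x) (vdf_v y) <= vdf_v (x + y);
  vdf_v_surj : forall g : vdf_group, exists2 x : vdf_sort, x != 0 & vdf_v x = g
}.

Definition valoo (K : valuedDiffField) (x : K) : option (vdf_group K) :=
  if x == 0 then None else Some (vdf_v x).

Definition valring_pred (K : valuedDiffField) : {pred K} :=
  [pred x | leoo (Some 0) (valoo x)].
Arguments valring_pred : clear implicits.

Section ValuationRing.
Variable K : valuedDiffField.
Implicit Types (x y : K) (G : oagType).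

Lemma oag_le_add G (a b c d : G) : a <= b -> c <= d -> a + c <= b + d.
Proof.
move=> ab cd; apply: (le_trans (oag_leD2l a _ _ cd)).
by rewrite addrC [b + d]addrC; apply: oag_leD2l.
Qed.

Lemma oag_lt_add G (a b c d : G) : a <= b -> c < d -> a + c < b + d.
Proof.
move=> ab cd; have ad : a + c < a + d.
  by rewrite lt_neqAle (inj_eq (addrI a)) (lt_eqF cd) oag_leD2l ?ltW.
by apply: (lt_le_trans ad); rewrite addrC [b + d]addrC; apply: oag_leD2l.
Qed.

Lemma oag_double0 G (a : G) : a + a = 0 -> a = 0.
Proof.
move=> E; case: (ltgtP a 0) => // a0.
  by have := oag_lt_add (ltW a0) a0; rewrite E addr0 ltxx.
by have := oag_lt_add (ltW a0) a0; rewrite E addr0 ltxx.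
Qed.

Lemma vdf_v1 : vdf_v (1 : K) = 0.
Proof.
have /eqP := vdf_vM (oner_neq0 K) (oner_neq0 K).
by rewrite mul1r -[X in X == _]addr0 eq_sym => /eqP /addrI.
Qed.

Lemma vdf_vN1 : vdf_v (- 1 : K) = 0.
Proof.
have N : (- 1 : K) != 0 by rewrite oppr_eq0 oner_neq0.
by apply: oag_double0; rewrite -vdf_vM // mulrNN mulr1 vdf_v1.
Qed.

Lemma valring_predE x :
  (x \in valring_pred K) = (x == 0) || (0 <= vdf_v x).
Proof. by rewrite inE /valoo; case: eqP. Qed.

Lemma valring_predM : {in valring_pred K &, forall x y, x * y \in valring_pred K}.
Proof.
move=> x y; rewrite !valring_predE mulf_eq0.
case: (eqVneq x 0) => //= x0; case: (eqVneq y 0) => //= y0 vx vy.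
by rewrite vdf_vM // -[0]addr0 oag_le_add.
Qed.

Lemma valring_predD : {in valring_pred K &, forall x y, x + y \in valring_pred K}.
Proof.
move=> x y; rewrite !valring_predE.
case: (eqVneq x 0) => /= [->|x0]; first by rewrite add0r.
case: (eqVneq y 0) => /= [-> vx _|y0 vx vy].
  by rewrite addr0 vx orbT.
case: (eqVneq (x + y) 0) => //= xy0.
by apply: le_trans (vdf_vD x0 y0 xy0); rewrite le_min vx.
Qed.

Lemma valring_subring : subring_closed (valring_pred K).
Proof.
have V1 : 1 \in valring_pred K by rewrite valring_predE vdf_v1 lexx orbT.
split=> // [x y Vx Vy|]; last exact: valring_predM.
apply: valring_predD => //; rewrite -mulN1r; apply: valring_predM => //.
by rewrite valring_predE vdf_vN1 lexx orbT.
Qed.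

HB.instance Definition _ :=
  GRing.isSubringClosed.Build K (valring_pred K) valring_subring.

Record valring := ValRing {
  valring_val :> K;
  valring_valP : valring_val \in valring_pred K
}.

HB.instance Definition _ := [isSub for valring_val].
HB.instance Definition _ := [Choice of valring by <:].
HB.instance Definition _ := [SubChoice_isSubComNzRing of valring by <:].

Definition maxideal : {pred valring} :=
  [pred u : valring | (valring_val u == 0) || (0 < vdf_v (valring_val u))].

Lemma maxidealP : idealr_closed maxideal.
Proof.
split; first by rewrite inE eqxx.
  by rewrite inE /= oner_eq0 vdf_v1 ltxx.
have M (a u : valring) : u \in maxideal -> a * u \in maxideal.
  rewrite !inE /=; have := valring_valP a; rewrite valring_predE mulf_eq0.
  case: (eqVneq (valring_val a) 0) => //= a0.
  case: (eqVneq (valring_val u) 0) => //= u0 va vu.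
  by rewrite vdf_vM // -[0]addr0 oag_lt_add.
move=> a u w /(M a); rewrite !inE /=; move: (valring_val a * _) => z.
move: (valring_val w) => y.
case: (eqVneq z 0) => /= [->|z0]; first by rewrite add0r.
case: (eqVneq y 0) => /= [-> vz _|y0 vz vy]; first by rewrite addr0 vz orbT.
case: (eqVneq (z + y) 0) => //= zy0.
by apply: lt_le_trans (vdf_vD z0 y0 zy0); rewrite lt_min vz.
Qed.

HB.instance Definition _ := isIdealr.Build valring maxideal maxidealP.

Definition resfield := {ideal_quot maxideal}.
HB.instance Definition _ := GRing.ComNzRing.on resfield.

Definition residue (u : valring) : resfield := (\pi_resfield u)%qT.

End ValuationRing.

Definition monotone (K : valuedDiffField) : Prop :=
  forall x : K, x != 0 -> leoo (valoo x) (valoo (der x)).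

(* A differential polynomial of order at most [n] is a polynomial in the [n.+1]
   variables Y, Y', ..., Y^(n); [msize] is the total degree plus 1. *)
Definition diff_henselian (K : valuedDiffField) : Prop :=
  forall (n : nat) (P : {mpoly (valring K)[n.+1]}),
    msize (map_mpoly (@residue K) P) = 2%N ->
    exists y : valring K,
      (map_mpoly (@valring_val K) P).@[fun i : 'I_n.+1 =>
         iter i der (valring_val y)] = 0.

(* [f] extended by the default value [None] outside the valuation ring *)
Definition ext_valring (K : valuedDiffField) (T : Type)
    (f : valring K -> T) (x : K) : option T := omap f (insub x).

Record MoModel := MkMoModel {
  mo_K :> valuedDiffField;
  mo_k : diffFieldType;
  mo_pi : {rmorphism valring mo_K -> mo_k};
  mo_c : {additive vdf_group mo_K -> mo_k};
  mo_monotone : monotone mo_K;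
  mo_pi_surj : forall a : mo_k, exists u, mo_pi u = a;
  mo_pi_der : forall u : valring mo_K,
    ext_valring mo_pi (der (valring_val u)) = Some (der (mo_pi u));
  mo_cP : forall g : vdf_group mo_K, exists x : mo_K,
    [/\ x != 0, vdf_v x = g & ext_valring mo_pi (logder x) = Some (mo_c g)]
}.

Record angular_component (M : MoModel) (ac : M -> mo_k M) : Prop := {
  ac_0 : ac 0 = 0;
  ac_neq0 : forall a, a != 0 -> ac a != 0;
  ac_mul : forall a b, a != 0 -> b != 0 -> ac (a * b) = ac a * ac b;
  ac_unit : forall u : valring M,
    valoo (valring_val u) = Some 0 -> ac (valring_val u) = mo_pi M u;
  ac_logder : forall a, a != 0 -> valoo (der a) = valoo a ->
    ac (logder a) = logder (ac a) + mo_c M (vdf_v a);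
  ac_const : forall d, d != 0 -> der d = 0 ->
    logder (ac d) = - mo_c M (vdf_v d)
}.

Record MoacModel := MkMoacModel {
  moac_Mo :> MoModel;
  moac_ac : moac_Mo -> mo_k moac_Mo;
  moac_acP : angular_component moac_ac
}.

Inductive dring_sym := D0 | D1 | Dopp | Dadd | Dmul | Dder.
Inductive group_sym := G0 | Gopp | Gadd.

Definition dring_arity (o : dring_sym) : nat :=
  match o with D0 | D1 => 0%N | Dopp | Dder => 1%N | Dadd | Dmul => 2%N end.

Definition group_arity (o : group_sym) : nat :=
  match o with G0 => 0%N | Gopp => 1%N | Gadd => 2%N end.

Definition arg1 (T : Type) (a : 'I_1 -> T) : T := a ord0.
Definition arg2_1 (T : Type) (a : 'I_2 -> T) : T := a ord0.
Definition arg2_2 (T : Type) (a : 'I_2 -> T) : T := a ord_max.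

Definition dring_interp (T : Type) (zero one : T) (opp : T -> T)
    (add mul : T -> T -> T) (d : T -> T) (o : dring_sym) :
    ('I_(dring_arity o) -> T) -> T :=
  match o return ('I_(dring_arity o) -> T) -> T with
  | D0 => fun _ => zero
  | D1 => fun _ => one
  | Dopp => fun a => opp (arg1 a)
  | Dadd => fun a => add (arg2_1 a) (arg2_2 a)
  | Dmul => fun a => mul (arg2_1 a) (arg2_2 a)
  | Dder => fun a => d (arg1 a)
  end.

Definition group_interp (T : Type) (zero : T) (opp : T -> T)
    (add : T -> T -> T) (o : group_sym) : ('I_(group_arity o) -> T) -> T :=
  match o return ('I_(group_arity o) -> T) -> T with
  | G0 => fun _ => zero
  | Gopp => fun a => opp (arg1 a)
  | Gadd => fun a => add (arg2_1 a) (arg2_2 a)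
  end.

(* Convention for the default value of the residue and value sorts:
   operations take the value [None] as soon as one argument is [None]. *)
Definition omap2 (T U W : Type) (f : T -> U -> W)
    (x : option T) (y : option U) : option W :=
  if x is Some a then omap (f a) y else None.

Definition field_interp (K : diffFieldType) :=
  @dring_interp K 0 1 -%R +%R *%R der.

Definition fieldoo_interp (k : diffFieldType) :=
  @dring_interp (option k) (Some 0) (Some 1)
    (omap -%R) (omap2 +%R) (omap2 *%R) (omap der).

Definition oag_interp (G : oagType) := @group_interp G 0 -%R +%R.

Definition oagoo_interp (G : oagType) :=
  @group_interp (option G) (Some 0) (omap -%R) (omap2 +%R).

Inductive le_sym := Le.

Inductive Lrv_sort := rv_r | rv_v.

Inductive Lrv_func :=
| rv_ring (o : dring_sym)
| rv_group (o : group_sym)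
| rv_c.

Definition Lrv_arity (f : Lrv_func) : nat :=
  match f with
  | rv_ring o => dring_arity o
  | rv_group o => group_arity o
  | rv_c => 1%N
  end.

Definition Lrv_dom (f : Lrv_func) : 'I_(Lrv_arity f) -> Lrv_sort :=
  fun _ => match f with rv_ring _ => rv_r | rv_group _ | rv_c => rv_v end.

Definition Lrv_cod (f : Lrv_func) : Lrv_sort :=
  match f with rv_ring _ | rv_c => rv_r | rv_group _ => rv_v end.

Definition Lrv : signature :=
  @Signature Lrv_sort Lrv_func Lrv_arity Lrv_dom Lrv_cod
    le_sym (fun _ => 2%N) (fun _ _ => rv_v).

(* Every symbol of this language is total on [k] and [G], so no default value
   is added to the sorts. *)
Section LrvStructure.
Variables (k : diffFieldType) (G : oagType) (c : G -> k).

Definition Lrv_carrier (s : Lrv_sort) : Type :=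
  match s with rv_r => k | rv_v => G end.

Definition Lrv_finterp (f : Lrv_func) :
    (forall i, Lrv_carrier (@Lrv_dom f i)) -> Lrv_carrier (Lrv_cod f) :=
  match f return
    (forall i, Lrv_carrier (@Lrv_dom f i)) -> Lrv_carrier (Lrv_cod f) with
  | rv_ring o => @field_interp k o
  | rv_group o => @oag_interp G o
  | rv_c => fun a => c (arg1 a)
  end.

Definition Lrv_structure : structure Lrv :=
  @Structure Lrv Lrv_carrier Lrv_finterp
    (fun _ (a : 'I_2 -> G) => arg2_1 a <= arg2_2 a).

End LrvStructure.

Inductive L3ac_sort := s_f | s_r | s_v.

Inductive L3ac_func :=
| f_ring (o : dring_sym)
| r_ring (o : dring_sym)
| v_group (o : group_sym)
| sym_pi
| sym_v
| sym_c
| sym_ac.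

Definition L3ac_arity (f : L3ac_func) : nat :=
  match f with
  | f_ring o | r_ring o => dring_arity o
  | v_group o => group_arity o
  | sym_pi | sym_v | sym_c | sym_ac => 1%N
  end.

Definition L3ac_dom (f : L3ac_func) : 'I_(L3ac_arity f) -> L3ac_sort :=
  fun _ => match f with
  | f_ring _ | sym_pi | sym_v | sym_ac => s_f
  | r_ring _ => s_r
  | v_group _ | sym_c => s_v
  end.

Definition L3ac_cod (f : L3ac_func) : L3ac_sort :=
  match f with
  | f_ring _ => s_f
  | r_ring _ | sym_pi | sym_c | sym_ac => s_r
  | v_group _ | sym_v => s_v
  end.

Definition L3ac : signature :=
  @Signature L3ac_sort L3ac_func L3ac_arity L3ac_dom L3ac_cod
    le_sym (fun _ => 2%N) (fun _ _ => s_v).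

Section L3acStructure.
Variable M : MoacModel.

Definition L3ac_carrier (s : L3ac_sort) : Type :=
  match s with
  | s_f => M
  | s_r => option (mo_k M)
  | s_v => option (vdf_group M)
  end.

Definition L3ac_finterp (f : L3ac_func) :
    (forall i, L3ac_carrier (@L3ac_dom f i)) -> L3ac_carrier (L3ac_cod f) :=
  match f return
    (forall i, L3ac_carrier (@L3ac_dom f i)) -> L3ac_carrier (L3ac_cod f) with
  | f_ring o => @field_interp M o
  | r_ring o => @fieldoo_interp (mo_k M) o
  | v_group o => @oagoo_interp (vdf_group M) o
  | sym_pi => fun a => ext_valring (mo_pi M) (arg1 a)
  | sym_v => fun a => valoo (arg1 a)
  | sym_c => fun a => omap (mo_c M) (arg1 a)
  | sym_ac => fun a => Some (moac_ac (arg1 a))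
  end.

Definition L3ac_structure : structure L3ac :=
  @Structure L3ac L3ac_carrier L3ac_finterp
    (fun _ (a : 'I_2 -> option (vdf_group M)) => leoo (arg2_1 a) (arg2_2 a)).

End L3acStructure.

Definition diff_subfield (K : diffFieldType) (E : {pred K}) : Prop :=
  divring_closed E /\ {in E, forall x, der x \in E}.

Record good_substructure (M : MoacModel) := GoodSubstructure {
  gs_E : {pred M};
  gs_k : {pred mo_k M};
  gs_G : {pred vdf_group M};
  gs_E_subfield : diff_subfield gs_E;
  gs_k_subfield : diff_subfield gs_k;
  gs_G_subgroup : zmod_closed gs_G;
  gs_ac : forall x, x \in gs_E -> moac_ac x \in gs_k;
  gs_v : forall x, x \in gs_E -> x != 0 -> vdf_v x \in gs_G;
  gs_c : forall g, g \in gs_G -> mo_c M g \in gs_k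
}.

(* Maps between subsets are given by total functions, of which only the
   restriction to the source subset matters. *)
Record maps_onto (T1 T2 : Type) (A1 : {pred T1}) (A2 : {pred T2})
    (f : T1 -> T2) : Prop := {
  onto_in : forall x, x \in A1 -> f x \in A2;
  onto_surj : forall y, y \in A2 -> exists2 x, x \in A1 & f x = y
}.

Record diff_field_iso (K1 K2 : diffFieldType) (E1 : {pred K1}) (E2 : {pred K2})
    (f : K1 -> K2) : Prop := {
  dfi_onto : maps_onto E1 E2 f;
  dfi_inj : {in E1 &, injective f};
  dfi_1 : f 1 = 1;
  dfi_D : {in E1 &, {morph f : x y / x + y}};
  dfi_M : {in E1 &, {morph f : x y / x * y}};
  dfi_der : {in E1, {morph f : x / der x}}
}.

Record ordered_group_iso (G1 G2 : oagType) (A1 : {pred G1}) (A2 : {pred G2})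
    (f : G1 -> G2) : Prop := {
  ogi_onto : maps_onto A1 A2 f;
  ogi_D : {in A1 &, {morph f : x y / x + y}};
  ogi_le : {in A1 &, {mono f : x y / x <= y}}
}.

Section GoodMap.
Variables (M1 M2 : MoacModel).
Variables (E1 : good_substructure M1) (E2 : good_substructure M2).
Variables (f : M1 -> M2) (fr : mo_k M1 -> mo_k M2).
Variable fv : vdf_group M1 -> vdf_group M2.

Definition Lrv_dom_of (s : Lrv_sort) :
    Lrv_carrier (mo_k M1) (vdf_group M1) s -> Prop :=
  match s with
  | rv_r => fun a => a \in gs_k E1
  | rv_v => fun g => g \in gs_G E1
  end.

Definition Lrv_map (s : Lrv_sort) :
    Lrv_carrier (mo_k M1) (vdf_group M1) s ->
    Lrv_carrier (mo_k M2) (vdf_group M2) s :=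
  match s with rv_r => fr | rv_v => fv end.

Record good_map : Prop := {
  gm_f : diff_field_iso (gs_E E1) (gs_E E2) f;
  gm_fr : diff_field_iso (gs_k E1) (gs_k E2) fr;
  gm_fv : ordered_group_iso (gs_G E1) (gs_G E2) fv;
  gm_ac : forall a, a \in gs_E E1 -> fr (moac_ac a) = moac_ac (f a);
  gm_v : forall a, a \in gs_E E1 -> a != 0 -> fv (vdf_v a) = vdf_v (f a);
  gm_elementary :
    @partial_elementary Lrv
      (Lrv_structure (mo_c M1)) (Lrv_structure (mo_c M2)) Lrv_dom_of Lrv_map
}.

Definition L3ac_dom_of (s : L3ac_sort) : L3ac_carrier M1 s -> Prop :=
  match s with
  | s_f => fun a => a \in gs_E E1
  | s_r => fun a => if a is Some a' then a' \in gs_k E1 else false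
  | s_v => fun g => if g is Some g' then g' \in gs_G E1 else false
  end.

Definition L3ac_map (s : L3ac_sort) : L3ac_carrier M1 s -> L3ac_carrier M2 s :=
  match s with s_f => f | s_r => omap fr | s_v => omap fv end.

End GoodMap.

(* Main.v *)
(* Both models are replaced by ultrapowers over a free ultrafilter on the natural
   numbers, in which countable chains of discs have a point in common and
   countable types of the two-sorted structure (k, Gamma; c) are realized; a
   back-and-forth between the ultrapowers then gives elementarity. A partial
   isomorphism is handled as a differential subfield [Rf] of the product ring
   K1 x K2, all of whose elements have matching leading terms (angular component
   and valuation).

   To adjoin an element [a], first enlarge the maps on k and Gamma by saturation,
   and let [w0] be a pair over [a] whose differences with given pairs of [Rf] have
   matching leading terms: the only centre is 0 if [a] has a new leading term, and
   all pairs of [Rf] are centres in the immediate case. If every differential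
   polynomial over [Rf] takes at [w0] the value predicted by its Gauss norm around
   some centre, leading terms match everywhere and [w0] can be adjoined. Otherwise
   take a counterexample [G] minimal in order, degree and size. Its partial
   derivatives are generic, so differential-henselianity in Newton form gives
   zeros of [G] close to both components of [w0]; pseudo-division by [G] reduces
   all values at the pair of zeros to the generic case. *)

Require Import Defs.
From HB Require Import structures.
From mathcomp Require Import all_boot all_order all_algebra.
From mathcomp Require Import generic_quotient ring_quotient mpoly.
From mathcomp Require Import ring.
From mathcomp Require Import boolp classical_sets filter.

Set Implicit Arguments.
Unset Strict Implicit.
Unset Printing Implicit Defensive.

Import Order.TTheory GRing.Theory.
Local Open Scope ring_scope.

(** Ultrapowers over the natural numbers are used with countable saturation only, so each extension
    step takes place inside countable sets: before an element [a] is adjoined, it is enclosed in a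
    countable [hull], closed under all operations and under solving equations of Newton type, and
    the maps on k and Gamma are extended to all data of the hull at once. The extension by a pair
    close to [w0] need not contain [a] itself. It suffices that the partial isomorphism grows
    strictly: the new pair has a leading term that was missing, or lies closer to [a] than every
    earlier element, so it is new. A maximal partial isomorphism with first components in the hull
    then has the whole hull as its domain ([exhaust]). Zero divisors of the product ring are
    harmless, since the components of a pair with matching leading terms vanish together. The
    argument runs over [acField]s, whose axioms pass to ultrapowers; differential-henselianity
    enters through its Newton form, which speaks only of polynomials, valuations and zeros and
    passes to ultrapowers as well. *)

Section Closure.
Variables (T : Type) (I : countType) (op : I -> seq T -> T) (seed : nat -> T).

Fixpoint tree_eval (t : GenTree.tree nat) : T :=
  match t with
  | GenTree.Leaf n => seed n
  | GenTree.Node i ts =>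
      if unpickle i is Some j then op j (map tree_eval ts) else seed 0%N
  end.

(** The values of all finite trees with seeds at the leaves and operations at the nodes form the
    closure, and such trees are countable through [pickle]. The same construction enumerates terms
    and formulas and builds the countable hulls. *)
Lemma countable_closure_in (P : T -> Prop) :
  (forall n, P (seed n)) ->
  (forall i s, foldr (fun x Q => P x /\ Q) True s -> P (op i s)) ->
  exists e : nat -> T, [/\ forall n, P (e n), forall n, exists m, e m = seed n &
    forall i (s : seq nat), exists m, e m = op i (map e s)].
Proof.
move=> Pseed Pop.
pose tr (n : nat) : GenTree.tree nat := odflt (GenTree.Leaf 0%N) (unpickle n).
exists (fun n => tree_eval (tr n)); split=> [n|n|i s].
- move: (tr n).
  fix IH 1; intros [m|i ts]; first exact: Pseed.
  simpl; case: (unpickle i) => [j|]; last exact: Pseed.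
  apply: Pop; by elim: ts => //=.
- by exists (pickle (GenTree.Leaf n)); rewrite /tr pickleK.
exists (pickle (GenTree.Node (pickle i) (map tr s))).
by rewrite /tr pickleK /= pickleK -map_comp.
Qed.

Lemma countable_closure : exists e : nat -> T,
  (forall n, exists m, e m = seed n) /\
  (forall i (s : seq nat), exists m, e m = op i (map e s)).
Proof.
have [||e [_ eseed eop]] := @countable_closure_in (fun _ => True); try by [].
by exists e.
Qed.

End Closure.

(** * Formulas and ultraproducts *)

Local Notation sort := Defs.sort.
Local Notation rel := Defs.rel.

Section Syntax.
Variable L : signature.

Definition FNot (p : formula L) := FImp p (@FFalse L).
Definition FAnd p q := FNot (FImp p (FNot q)).
Definition FEx (s : sort L) n p := FNot (FAll s n (FNot p)).

Definition mix (M : structure L) (A : sort L -> nat -> Prop) (e e' : assignment M) :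
    assignment M :=
  fun s n => if pselect (A s n) then e s n else e' s n.

Lemma mixT (M : structure L) (A : sort L -> nat -> Prop) (e e' : assignment M) s n :
  A s n -> mix A e e' s n = e s n.
Proof. by rewrite /mix; case: pselect. Qed.

Lemma mixF (M : structure L) (A : sort L -> nat -> Prop) (e e' : assignment M) s n :
  ~ A s n -> mix A e e' s n = e' s n.
Proof. by rewrite /mix; case: pselect. Qed.

Lemma sat_and (M : structure L) p q (e : assignment M) :
  sat (FAnd p q) e <-> sat p e /\ sat q e.
Proof.
split=> /= [H|[pe qe] H]; last exact: H.
by split; apply/not_notP => K; apply: H => pe qe; apply: K.
Qed.

Definition variant (M : structure L) s n (e e' : assignment M) :=
  forall s' m, (s', m) <> (s, n) -> e' s' m = e s' m.

Lemma sat_ex (M : structure L) s n p (e : assignment M) :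
  sat (FEx s n p) e <-> exists e', variant s n e e' /\ sat p e'.
Proof.
split=> /= [H|[e' [ve' pe']] H]; last exact: H _ ve' pe'.
by apply/not_notP => nex; apply: H => e' ve' pe'; apply: nex; exists e'.
Qed.

Lemma sat_agree (M : structure L) p (e e' : assignment M) :
  (forall s n, e s n = e' s n) -> sat p e <-> sat p e'.
Proof.
by move=> E; have -> : e = e' by apply: functional_extensionality_dep => s';
  apply: funext => n.
Qed.

Lemma term_support s (t : term s) : exists vs : seq (sort L * nat),
  forall (M : structure L) (e e' : assignment M),
    (forall s n, List.In (s, n) vs -> e s n = e' s n) -> eval e t = eval e' t.
Proof.
elim: t => [s' n|f ts IH].
  by exists [:: (s', n)] => M e e' /(_ s' n) H /=; apply: H; left.
have /choice [vs Hvs] := IH.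
exists (flatten (map vs (enum 'I_(farity f)))) => M e e' H /=; congr finterp.
apply: functional_extensionality_dep => i; apply: Hvs => s' n Hin; apply: H.
have : i \in enum 'I_(farity f) by rewrite mem_enum.
elim: (enum _) => //= j r IHr; rewrite inE => /orP[/eqP <-|/IHr Hr];
  apply/List.in_or_app; [by left|by right].
Qed.

Lemma formula_support p : exists vs : seq (sort L * nat),
  forall (M : structure L) (e e' : assignment M),
    (forall s n, List.In (s, n) vs -> e s n = e' s n) -> sat p e <-> sat p e'.
Proof.
elim: p => [|s t u|r ts|p [vp Hp] q [vq Hq]|s n p [vs Hp]].
- by exists [::].
- have [vt Ht] := term_support t; have [vu Hu] := term_support u.
  exists (vt ++ vu) => M e e' H /=; rewrite (Ht M e e') ?(Hu M e e') // => s' n Hin;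
    apply: H; apply/List.in_or_app; [by right|by left].
- have /choice [vs Hvs] := fun i => term_support (ts i).
  exists (flatten (map vs (enum 'I_(rarity r)))) => M e e' H /=.
  suff -> : (fun i => eval e (ts i)) = (fun i => eval e' (ts i)) by [].
  apply: functional_extensionality_dep => i; apply: Hvs => s' n Hin; apply: H.
  have : i \in enum 'I_(rarity r) by rewrite mem_enum.
  elim: (enum _) => //= j r' IHr; rewrite inE => /orP[/eqP <-|/IHr Hr];
    apply/List.in_or_app; [by left|by right].
- exists (vp ++ vq) => M e e' H /=.
  have [H1 H2] : (sat p e <-> sat p e') /\ (sat q e <-> sat q e').
    split; [apply: Hp|apply: Hq] => s' n Hin;
      apply: H; apply/List.in_or_app; [by left|by right].
  by tauto.
exists vs => M.
suff main (e e' : assignment M) : (forall s n, List.In (s, n) vs -> e s n = e' s n) ->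
    sat (FAll s n p) e -> sat (FAll s n p) e'.
  by move=> e e' H; split; apply: main => // s' m /H.
move=> H /= He e1' ve1'.
(* [e1] is a variant of [e], hence covered by the hypothesis, and agrees with [e1'] on all of [vs].
   The bound variable stays in the support; a superset is harmless. *)
pose e1 := mix (fun s' m => (s', m) = (s, n)) e1' e.
suff E : sat p e1 <-> sat p e1'.
  by apply/E; apply: He => s' m nE; rewrite /e1 mixF.
apply: Hp => s' m Hin; rewrite /e1.
case: (pselect ((s', m) = (s, n))) => E; first by rewrite mixT.
by rewrite mixF // ve1' // H.
Qed.

Fixpoint term_rename (r : sort L -> nat -> nat) s (t : term s) : term s :=
  match t with
  | Var s n => Var s (r s n)
  | App f ts => App (fun i => term_rename r (ts i))
  end.

Lemma eval_rename r s (t : term s) (M : structure L) (e : assignment M) :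
  eval e (term_rename r t) = eval (fun s n => e s (r s n)) t.
Proof.
elim: t => //= f ts IH; congr finterp.
by apply: functional_extensionality_dep => i.
Qed.

(** The renaming [r] may be non-injective and could capture a bound variable. Under a quantifier the
    bound variable is therefore sent to an index [N] above the images of the finitely many variables
    that matter. *)
Lemma formula_rename p : forall r : sort L -> nat -> nat, exists q : formula L,
  forall (M : structure L) (e : assignment M),
    sat q e <-> sat p (fun s n => e s (r s n)).
Proof.
elim: p => [|s t u|R ts|p IHp q IHq|s n p IHp] r.
- by exists (@FFalse L).
- by exists (FEq (term_rename r t) (term_rename r u)) => M e /=; rewrite !eval_rename.
- exists (FRel (fun i => term_rename r (ts i))) => M e /=.
  suff -> : (fun i => eval e (term_rename r (ts i))) =
    (fun i => eval (fun s n => e s (r s n)) (ts i)) by [].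
  by apply: functional_extensionality_dep => i; rewrite eval_rename.
- have [p' Hp] := IHp r; have [q' Hq] := IHq r; exists (FImp p' q') => M e /=.
  by have := Hp M e; have := Hq M e; tauto.
have [vs Hvs] := formula_support p.
pose N := (\max_(v <- map (fun v => r v.1 v.2) vs) v).+1.
have ltN s' m : List.In (s', m) vs -> (r s' m < N)%N.
  move=> Hin; rewrite ltnS; elim: {Hvs N} vs Hin => //= v vs' IH [->|/IH H];
    rewrite big_cons leq_max ?leqnn // H orbT //.
pose r' s' m := if pselect ((s', m) = (s, n)) then N else r s' m.
have [q Hq] := IHp r'; exists (FAll s N q) => M e /=; split=> H e1 ve1.
- pose e2 : assignment M := fun s' m =>
    if pselect ((s', m) = (s, N)) then e1 s' n else e s' m.
  have /H : forall s' m, (s', m) <> (s, N) -> e2 s' m = e s' m.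
    by move=> s' m nE; rewrite /e2; case: pselect.
  move=> /Hq K; refine (iffLR _ K); apply: Hvs => s' m Hin; rewrite /r'.
  case: (pselect ((s', m) = (s, n))) => E /=.
    by case: E => -> ->; rewrite /e2; case: pselect.
  rewrite ve1 // /e2; case: pselect => // /(congr1 snd) /= E'.
  by have := ltN _ _ Hin; rewrite E' ltnn.
- apply/Hq; pose e2 : assignment M := fun s' m =>
    if pselect ((s', m) = (s, n)) then e1 s' N else e s' (r s' m).
  have /H K : forall s' m, (s', m) <> (s, n) -> e2 s' m = e s' (r s' m).
    by move=> s' m nE; rewrite /e2; case: pselect.
  refine (iffLR _ K); apply: Hvs => s' m Hin; rewrite /e2 /r'.
  case: pselect => //= nE; rewrite ve1 // => /(congr1 snd) /= E2.
  by have := ltN _ _ Hin; rewrite E2 ltnn.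
Qed.

Lemma formula_ex_closure vs p : exists q : formula L,
  forall (M : structure L) (e : assignment M), sat q e <->
    exists e', (forall s n, ~ List.In (s, n) vs -> e' s n = e s n) /\ sat p e'.
Proof.
elim: vs p => [|[s n] vs IH] p.
  exists p => M e; split=> [pe|[e' [E pe']]]; first by exists e.
  by refine (iffLR _ pe'); apply: sat_agree => s n; apply: E.
have [q Hq] := IH p; exists (FEx s n q) => M e; split.
  move/sat_ex => [e' [ve' /Hq [e2 [E2 pe2]]]]; exists e2; split => // s' m nin.
  rewrite E2; last by move=> H; apply: nin; right.
  by apply: ve' => E; apply: nin; left.
move=> [e2 [E2 pe2]]; apply/sat_ex.
exists (mix (fun s' m => (s', m) = (s, n)) e2 e); split.
  by move=> s' m nE; rewrite mixF.
apply/Hq; exists e2; split => // s' m nin.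
case: (pselect ((s', m) = (s, n))) => E; first by rewrite mixT.
by rewrite mixF // E2 //= => -[/esym|].
Qed.

Definition FConj (ps : seq (formula L)) := foldr FAnd (FNot (@FFalse L)) ps.

Lemma sat_conj (M : structure L) ps (e : assignment M) :
  sat (FConj ps) e <-> forall p, List.In p ps -> sat p e.
Proof.
elim: ps => [|p ps IH]; first by split=> // _ /=.
rewrite [FConj _]/=; split.
  by move/sat_and => [pe /IH H] q /= [<-|/H].
by move=> H; apply/sat_and; split; [apply: H; left|apply/IH => q Hq; apply: H; right].
Qed.

End Syntax.

Lemma dep_choice (I : Type) (T : I -> Type) (P : forall i, T i -> Prop) :
  (forall i, exists y, P i y) -> exists f : forall i, T i, forall i, P i (f i).
Proof.
by move=> H; exists (fun i => projT1 (cid (H i))) => i; apply: projT2 (cid (H i)).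
Qed.

Section CountableFormulas.
Variables (L : signature) (codeS : nat -> sort L) (codeF : nat -> func L).
Variable (codeR : nat -> rel L).
Hypothesis codeS_surj : forall s, exists n, codeS n = s.
Hypothesis codeF_surj : forall f, exists n, codeF n = f.
Hypothesis codeR_surj : forall r, exists n, codeR n = r.

Local Notation any_term := {s : sort L & term s}.

Definition as_term (s : sort L) (x : any_term) : term s :=
  match pselect (projT1 x = s) with
  | left E => eq_rect _ (@term L) (projT2 x) _ E
  | right _ => Var s 0
  end.

Lemma as_termK s (t : term s) : as_term s (existT _ s t) = t.
Proof.
rewrite /as_term; case: pselect => //= E.
by have -> : E = erefl by apply: Prop_irrelevance.
Qed.

Lemma countable_terms : exists e : nat -> any_term, forall s (t : term s),
  exists n, e n = existT _ s t.
Proof.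
pose dflt : any_term := existT _ (codeS 0) (Var (codeS 0) 0).
pose op (i : nat) (xs : seq any_term) : any_term :=
  existT _ (fcod (codeF i)) (App (fun j => as_term _ (nth dflt xs j))).
pose seed (n : nat) : any_term := let p := odflt (0, 0)%N (unpickle n) in
  existT _ (codeS p.1) (Var (codeS p.1) p.2).
have [e [eseed eop]] := countable_closure op seed.
exists e => s t; elim: t => [{}s n|f ts IH].
  have [i <-] := codeS_surj s; have [m Em] := eseed (pickle (i, n)).
  by exists m; rewrite Em /seed pickleK.
have [i Ei] := codeF_surj f; case: _ / Ei ts IH => ts IH.
have /choice [c Hc] := IH.
have [m Hm] := eop i (map c (enum 'I_(farity (codeF i)))); exists m; rewrite Hm /op.
congr (existT _ _ (App _)); apply: functional_extensionality_dep => j.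
rewrite -map_comp (nth_map j) ?size_enum_ord // nth_ord_enum /= Hc.
exact: as_termK.
Qed.

Lemma countable_formulas : exists e : nat -> formula L, forall p, exists n, e n = p.
Proof.
have [te tesurj] := countable_terms.
pose seed (n : nat) : formula L :=
  match odflt (inl (0, 0))%N (unpickle n) with
  | inl (i, j) => FEq (as_term (projT1 (te i)) (te i)) (as_term (projT1 (te i)) (te j))
  | inr (i, js) => FRel (r := codeR i) (fun j => as_term _ (te (nth 0%N js j)))
  end.
pose op (i : option (nat * nat)) (xs : seq (formula L)) : formula L :=
  match i, xs with
  | Some (s, n), p :: _ => FAll (codeS s) n p
  | None, p :: q :: _ => FImp p q
  | _, _ => @FFalse L
  end.
have [e [eseed eop]] := countable_closure op seed.
exists e; elim=> [|s t u|r ts|p [n Hn] q [m Hm]|s n p [m Hm]].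
- by have [m Em] := eop None [::]; exists m; rewrite Em.
- have [i Hi] := tesurj s t; have [j Hj] := tesurj s u.
  have [m Em] := eseed (pickle (inl (i, j) : nat * nat + nat * seq nat)).
  by exists m; rewrite Em /seed pickleK /= Hi Hj /= !as_termK.
- have [i Ei] := codeR_surj r; case: _ / Ei ts => ts.
  have /choice [c Hc] := fun j => tesurj _ (ts j).
  have [m Em] := eseed (pickle (inr (i, map c (enum 'I_(rarity (codeR i))))
     : nat * nat + nat * seq nat)).
  exists m; rewrite Em /seed pickleK /=; congr FRel.
  apply: functional_extensionality_dep => j.
  by rewrite (nth_map j) ?size_enum_ord // nth_ord_enum Hc as_termK.
- by have [l El] := eop None [:: n; m]; exists l; rewrite El /= Hn Hm.
- have [i <-] := codeS_surj s.
  by have [l El] := eop (Some (i, n)) [:: m]; exists l; rewrite El /= Hm.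
Qed.

End CountableFormulas.

(** * Ultraproducts: Los's theorem and countable saturation *)

Section Ultraproduct.
Variable U : set_system nat.
Hypothesis ultraU : UltraFilter U.

Lemma U_sub (A B : set nat) : (forall n, A n -> B n) -> U A -> U B.
Proof. by move=> AB; apply: filterS. Qed.

Lemma U_and (A B : set nat) : U A -> U B -> U (fun n => A n /\ B n).
Proof. exact: filterI. Qed.

Lemma U_true (A : set nat) : (forall n, A n) -> U A.
Proof. by move=> H; apply: filterE. Qed.

Lemma U_false : ~ U (fun _ => False).
Proof. exact: filter_not_empty. Qed.

Lemma U_not (A : set nat) : ~ U A <-> U (fun n => ~ A n).
Proof.
split=> [nA|UnA UA].
  by have [//|] := in_ultra_setVsetC A ultraU.
by apply: U_false; apply: U_sub (U_and UA UnA) => n [].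
Qed.

Lemma U_imp (A B : set nat) : (U A -> U B) <-> U (fun n => A n -> B n).
Proof.
split=> [AB|UAB UA]; last by apply: U_sub (U_and UAB UA) => n [H /H].
case: (pselect (U A)) => [/AB|/U_not]; first by apply: U_sub.
by apply: U_sub => n nA /nA.
Qed.

Lemma U_seq (T : Type) (s : seq T) (A : T -> set nat) :
  (forall x, List.In x s -> U (A x)) -> U (fun n => forall x, List.In x s -> A x n).
Proof.
elim: s => [|x s IH] H; first exact: U_true.
apply: U_sub (U_and (H x (or_introl erefl)) (IH _)) => [n [Ax As] y [<- //|/As //]|y ys].
by apply: H; right.
Qed.

Lemma U_fin (I : finType) (A : I -> set nat) :
  (forall i, U (A i)) -> U (fun n => forall i, A i n).
Proof.
move=> H; apply: U_sub (@U_seq _ (enum I) A _) => [n Hn i|i _]; last exact: H.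
apply: Hn; have : i \in enum I by rewrite mem_enum.
by elim: (enum I) => //= j s IHs; rewrite inE => /orP[/eqP ->|/IHs]; [left|right].
Qed.

Section Los.
Variables (L : signature) (M N : structure L).
Variable rep : forall s, (nat -> M s) -> N s -> Prop.
Hypothesis rep_ex : forall s (y : N s), exists x, rep x y.
Hypothesis rep_tot : forall s (x : nat -> M s), exists y, rep x y.
Hypothesis rep_eq : forall s (x x' : nat -> M s) y y', rep x y -> rep x' y' ->
  (y = y' <-> U (fun n => x n = x' n)).
Hypothesis rep_fun : forall f (xs : nat -> forall i, M (@fdom L f i)) ys,
  (forall i, rep (fun n => xs n i) (ys i)) ->
  rep (fun n => finterp (xs n)) (finterp ys).
Hypothesis rep_rel : forall r (xs : nat -> forall i, M (@rdom L r i)) ys,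
  (forall i, rep (fun n => xs n i) (ys i)) ->
  (rinterp ys <-> U (fun n => rinterp (xs n))).

(** [rep x y] says that the sequence [x] represents [y]. A relation instead of a quotient map lets
    one argument cover carriers with an added default value, where options of classes stand for
    classes of options. *)
Definition rep_assignment (es : nat -> assignment M) (e : assignment N) :=
  forall s n, rep (fun i => es i s n) (e s n).

Lemma rep_eval es e s (t : term s) : rep_assignment es e ->
  rep (fun i => eval (es i) t) (eval e t).
Proof. by move=> Re; elim: t => //= f ts IH; apply: rep_fun. Qed.

Lemma los p es e : rep_assignment es e -> (sat p e <-> U (fun i => sat p (es i))).
Proof.
elim: p es e => [|s t u|r ts|p IHp q IHq|s n p IHp] es e Re /=.
- by split=> // /U_false.
- by apply: rep_eq; apply: rep_eval.
- by apply: rep_rel => i; apply: rep_eval.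
- have := IHp es e Re; have := IHq es e Re.
  have := U_imp (fun i => sat p (es i)) (fun i => sat q (es i)); tauto.
split=> [H|H e' ve'].
  apply/not_notP => /U_not nU.
  (* At each index a falsifying variant is chosen whenever there is one; the values of these
     variants at [(s, n)] represent one element of the ultraproduct at which [p] would fail. *)
  have /choice [es' Hes'] i : exists e' : assignment M,
      (forall s' m, (s', m) <> (s, n) -> e' s' m = es i s' m) /\
      (~ (forall e', (forall s' m, (s', m) <> (s, n) -> e' s' m = es i s' m) -> sat p e') ->
       ~ sat p e').
    case: (pselect (exists e' : assignment M,
      (forall s' m, (s', m) <> (s, n) -> e' s' m = es i s' m) /\ ~ sat p e')).
      by move=> [e' [v ns]]; exists e'; split.
    move=> nex; exists (es i); split => // K; case: K => e' ve'.
    by apply/not_notP => ns; apply: nex; exists e'.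
  have /dep_choice [y Hy] := fun s' => rep_tot (fun i => es' i s' n).
  pose e' : assignment N := fun s' m => if pselect ((s', m) = (s, n)) then y s' else e s' m.
  have /H : forall s' m, (s', m) <> (s, n) -> e' s' m = e s' m.
    by move=> s' m nE; rewrite /e'; case: pselect.
  rewrite (IHp es') => [sp|s' m].
    by apply: U_false; apply: U_sub (U_and nU sp) => i [/(proj2 (Hes' i))].
  rewrite /e'; case: pselect => E /=.
    have -> : m = n by case: E.
    exact: Hy.
  have -> : (fun i => es' i s' m) = (fun i => es i s' m).
    by apply: funext => i; apply: (proj1 (Hes' i)).
  exact: Re.
have /dep_choice [x Hx] := fun s' => rep_ex (e' s' n).
pose es' i : assignment M := fun s' m =>
  if pselect ((s', m) = (s, n)) then x s' i else es i s' m.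
rewrite (IHp es'); last first.
  move=> s' m; rewrite /es'; case: (pselect ((s', m) = (s, n))) => E /=.
    have -> : m = n by case: E.
    exact: Hx.
  by rewrite ve' //; apply: Re.
apply: U_sub H => i; apply => s' m nE.
by rewrite /es'; case: pselect.
Qed.

End Los.

Hypothesis U_free : forall n, U (fun i => (n <= i)%N).

(* Countable saturation of ultraproducts over the natural numbers: at index [i],
   pick a witness for as many of the first [i] conditions as possible. *)
Lemma diagonal (X : Type) (x0 : X) (C : nat -> nat -> X -> Prop) :
  (forall n, U (fun i => exists x, forall j, (j <= n)%N -> C j i x)) ->
  exists x : nat -> X, forall n, U (fun i => C n i (x i)).
Proof.
move=> H; have /choice [x Hx] i : exists x : X, forall n, (n <= i)%N ->
    (exists y, forall j, (j <= n)%N -> C j i y) -> forall j, (j <= n)%N -> C j i x.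
  have best k : exists x : X, forall n, (n <= k)%N ->
      (exists y, forall j, (j <= n)%N -> C j i y) -> forall j, (j <= n)%N -> C j i x.
    elim: k => [|k [x Hx]].
      case: (pselect (exists y, forall j, (j <= 0)%N -> C j i y)) => [[y Hy]|nex].
        by exists y => n; rewrite leqn0 => /eqP ->.
      by exists x0 => n; rewrite leqn0 => /eqP -> /nex.
    case: (pselect (exists y, forall j, (j <= k.+1)%N -> C j i y)) => [[y Hy]|nex].
      by exists y => n nk _ j jn; apply: Hy; apply: leq_trans nk.
    exists x => n; rewrite leq_eqVlt => /orP[/eqP -> /nex //|nk].
    exact: Hx.
  exact: best.
by exists x => n; apply: U_sub (U_and (H n) (U_free n)) => i [ex ni]; apply: Hx ex _ _.
Qed.

Section Saturation.
Variables (L : signature) (M N : structure L).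
Variable rep : forall s, (nat -> M s) -> N s -> Prop.
Hypothesis rep_ex : forall s (y : N s), exists x, rep x y.
Hypothesis rep_tot : forall s (x : nat -> M s), exists y, rep x y.
Hypothesis rep_eq : forall s (x x' : nat -> M s) y y', rep x y -> rep x' y' ->
  (y = y' <-> U (fun n => x n = x' n)).
Hypothesis losN : forall p es e, rep_assignment rep es e ->
  (sat p e <-> U (fun i => sat p (es i))).
Variable pe : nat -> formula L.
Hypothesis pe_surj : forall p, exists n, pe n = p.

Definition merge (M' : structure L) (e e' : assignment M') : assignment M' :=
  fun s n => if odd n then e' s n./2 else e s n./2.

(* The variables of even index are parameters, fixed by [e2]. *)
Lemma realize_type (T : formula L -> Prop) (e2 : assignment N) :
  (forall ps, (forall p, List.In p ps -> T p) -> exists e' : assignment N,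
     (forall s n, e' s n.*2 = e2 s n) /\ (forall p, List.In p ps -> sat p e')) ->
  exists e' : assignment N, (forall s n, e' s n.*2 = e2 s n) /\
    (forall p, T p -> sat p e').
Proof.
move=> fsat; have /dep_choice [r0 Hr0] : forall p : {s : sort L & nat}, exists x,
    rep x (e2 (projT1 p) (projT2 p)) by move=> p; apply: rep_ex.
pose r s n := r0 (existT _ s n).
have Hr s n : rep (r s n) (e2 s n) := Hr0 (existT _ s n).
pose C n i (e : assignment M) :=
  (T (pe n) -> sat (pe n) e) /\ forall s m, e s m.*2 = r s m i.
have [|x Hx] := @diagonal (assignment M) (fun s n => r s 0%N 0%N) C.
  move=> n; pose ps := [seq pe j | j <- iota 0 n.+1 & `[< T (pe j) >]].
  have psT p : List.In p ps -> T p.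
    move=> /List.in_map_iff [j [<-]]; rewrite /ps.
    by elim: (iota 0 n.+1) => //= a s IH; case: asboolP => //= Ta [<-|].
  have [e' [E' S']] := fsat ps psT.
  have /dep_choice [q0 Hq0] : forall p : {s : sort L & nat}, exists x,
    rep x (e' (projT1 p) (projT2 p)) by move=> p; apply: rep_ex.
  (* The even variables get the fixed representatives [r], so the parameter clause of [C] holds at
     every index and only the formulas need the ultrafilter. *)
  pose q i : assignment M := fun s n => if odd n then q0 (existT _ s n) i else r s n./2 i.
  have Rq : rep_assignment rep q e'.
    move=> s m; rewrite /q; case: (boolP (odd m)) => om; first exact: (Hq0 (existT _ s m)).
    have -> : e' s m = e2 s m./2 by rewrite -E' -[in LHS](odd_double_half m) (negPf om) add0n.
    exact: Hr.
  have Uq : U (fun i => forall p, List.In p ps -> sat p (q i)).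
    by apply: U_seq => p /S' /(losN _ Rq).
  apply: U_sub Uq => i Hi; exists (q i) => j jn; split.
    move=> Tj; apply: Hi; rewrite /ps.
    have : j \in iota 0 n.+1 by rewrite mem_iota.
    elim: (iota 0 n.+1) => //= a s IH; rewrite inE => /orP[/eqP <-|/IH].
      by case: asboolP => //= _; left.
    by case: ifP => //= _; right.
  by move=> s m; rewrite /q odd_double doubleK.
have /dep_choice [y0 Hy0] : forall p : {s : sort L & nat}, exists y,
  rep (fun i => x i (projT1 p) (projT2 p)) y by move=> p; apply: rep_tot.
pose e' : assignment N := fun s n => y0 (existT _ s n).
have Re' : rep_assignment rep x e' by move=> s n; apply: (Hy0 (existT _ s n)).
exists e'; split=> [s n|p Tp].
  apply/(rep_eq (Re' s n.*2) (Hr s n)).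
  by apply: U_sub (Hx 0%N) => i [_]; apply.
have [n En] := pe_surj p; apply/(losN _ Re').
by apply: U_sub (Hx n) => i [H _]; rewrite -En; apply: H; rewrite En.
Qed.

(** A finite part of the type of [e1'] over [e1] becomes one formula in the parameters: its odd
    variables are quantified existentially and the even indices halved. This formula transfers from
    [e1] to [e2], so the type is finitely satisfiable there. Since the type contains each formula or
    its negation, realizing it gives an equivalence. *)
Lemma extend_elementary (N1 : structure L) (e1 e1' : assignment N1) (e2 : assignment N) :
  (forall p, sat p e1 <-> sat p e2) -> exists e2' : assignment N,
    (forall s n, e2' s n.*2 = e2 s n) /\
    (forall p, sat p (merge e1 e1') <-> sat p e2').
Proof.
move=> EE; pose T p := sat p (merge e1 e1').
have [|e' [E' S']] := @realize_type T e2; last first.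
  exists e'; split => // p; split; first exact: S'.
  move=> Sp; apply/not_notP => nS.
  by have /S' : T (FNot p) by []; apply.
move=> ps Tps; have [vs Hvs] := formula_support (FConj ps).
pose ws := [seq v <- vs | odd v.2].
have [q Hq] := formula_ex_closure ws (FConj ps).
have [q' Hq'] := formula_rename q (fun _ n => n./2).
have wsP s n : List.In (s, n) ws <-> List.In (s, n) vs /\ odd n.
  rewrite /ws; elim: (vs) => [|v vs' IH] /=; first by tauto.
  case: ifP => ov /=; split.
  - by move=> [E|/IH [H1 H2]]; [rewrite E in ov; split; [left|]|split; [right|]].
  - by move=> [[E|H1] H2]; [left|right; apply/IH].
  - by move=> /IH [H1 H2]; split; [right|].
  - by move=> [[E|H1] H2]; [rewrite E H2 in ov|apply/IH].
have : sat q' e1.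
  apply/Hq'/Hq; exists (mix (fun s n => List.In (s, n) ws) (merge e1 e1') (fun s n => e1 s n./2)).
  split=> [s n nin|]; first by rewrite mixF.
  have : sat (FConj ps) (merge e1 e1') by apply/sat_conj => p /Tps.
  apply: iffLR; apply: Hvs => s n Hin.
  case: (pselect (List.In (s, n) ws)) => Hw; first by rewrite mixT.
  rewrite mixF // /merge; case: ifP => // on.
  by case: Hw; apply/wsP.
move=> /EE /Hq' /Hq [e' [E' /sat_conj S']]; exists e'; split => // s n.
rewrite E'; first by rewrite doubleK.
by move=> /wsP []; rewrite odd_double.
Qed.

End Saturation.
End Ultraproduct.

(** * Valued fields with coefficient maps *)

Section OrderedGroup.
Variable G : oagType.
Implicit Types x y z : G.

Lemma oag_leD2r z x y : (x + z <= y + z) = (x <= y).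
Proof.
apply/idP/idP => [H|H]; last by rewrite ![_ + z]addrC oag_leD2l.
by have := oag_leD2l (- z) _ _ H; rewrite ![- z + _]addrC !addrK.
Qed.

Lemma oag_ltD2r z x y : (x + z < y + z) = (x < y).
Proof. by rewrite !ltNge oag_leD2r. Qed.

Lemma oag_leBlD x y z : (x - y <= z) = (x <= z + y).
Proof. by rewrite -(oag_leD2r y (x - y)) subrK. Qed.

Lemma oag_leBrD x y z : (x <= y - z) = (x + z <= y).
Proof. by rewrite -(oag_leD2r z x) subrK. Qed.

Lemma oag_ltBrD x y z : (x < y - z) = (x + z < y).
Proof. by rewrite -(oag_ltD2r z x) subrK. Qed.

Lemma oag_leN2 x y : (- x <= - y) = (y <= x).
Proof. by rewrite -(oag_leD2r (x + y) (- x)) addKr [- y + _]addrC addrK. Qed.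

Lemma oag_leMn2 x y n : x <= y -> x *+ n <= y *+ n.
Proof.
by move=> xy; elim: n => [|n IHn]; rewrite ?mulr0n // !mulrS oag_le_add.
Qed.

Lemma oag_ltMn2 x y n : x < y -> x *+ n.+1 < y *+ n.+1.
Proof.
move=> xy; elim: n => [|n IHn]; first by rewrite !mulr1n.
by rewrite mulrS [ltRHS]mulrS oag_lt_add ?ltW.
Qed.

End OrderedGroup.

Section Truncation.
Variables (K k : diffFieldType) (G : oagType) (v : K -> G) (ac : K -> k).

(** The flag [s] selects the strict inequality, so that closed and open discs share their lemmas;
    zero counts as having infinite valuation. *)
Definition val_cmp (s : bool) (g : G) (x : K) : bool :=
  (x == 0) || (if s then g < v x else g <= v x).

Definition coef_at (g : G) (x : K) : k :=
  if (x != 0) && (v x == g) then ac x else 0.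

End Truncation.

(* [coef_at v ac g] is the coefficient of t^g in the generalized power series
   picture: it is additive on the elements of valuation at least [g], and there
   the derivation of the field induces the derivation [u' + c(g) u]. *)
Record acField := AcField {
  af_K :> diffFieldType;
  af_k : diffFieldType;
  af_G : oagType;
  af_v : af_K -> af_G;
  af_ac : af_K -> af_k;
  af_c : af_G -> af_k;
  af_ac_eq0 : forall x, (af_ac x == 0) = (x == 0);
  af_vM : forall x y, x != 0 -> y != 0 -> af_v (x * y) = af_v x + af_v y;
  af_acM : forall x y, x != 0 -> y != 0 -> af_ac (x * y) = af_ac x * af_ac y;
  af_geD : forall g x y, val_cmp af_v false g x -> val_cmp af_v false g y ->
    val_cmp af_v false g (x + y);
  af_coefD : forall g x y, val_cmp af_v false g x -> val_cmp af_v false g y ->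
    coef_at af_v af_ac g (x + y) = coef_at af_v af_ac g x + coef_at af_v af_ac g y;
  af_ge_der : forall g x, val_cmp af_v false g x -> val_cmp af_v false g (der x);
  af_coef_der : forall g x, val_cmp af_v false g x ->
    coef_at af_v af_ac g (der x) =
    der (coef_at af_v af_ac g x) + af_c g * coef_at af_v af_ac g x;
  af_surj : forall g d, d != 0 -> exists x, [/\ x != 0, af_v x = g & af_ac x = d]
}.

Arguments af_v {_} _.
Arguments af_ac {_} _.
Arguments af_c {_} _.

Notation vge := (val_cmp af_v false).
Notation vgt := (val_cmp af_v true).
Notation vcmp := (val_cmp af_v).
Notation coef := (coef_at af_v af_ac).

Section DiffField.
Variable K : diffFieldType.
Implicit Types x y : K.

Lemma der0 : der (0 : K) = 0.
Proof. by apply: (addrI (der 0)); rewrite -derD !addr0. Qed.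

Lemma der1 : der (1 : K) = 0.
Proof.
have := derM (1 : K) 1; rewrite !mulr1 mul1r => H.
by apply: (addrI (der 1)); rewrite -H addr0.
Qed.

Lemma iter_derD i x y : iter i der (x + y) = iter i der x + iter i der y.
Proof. by elim: i => //= i ->; rewrite derD. Qed.

Lemma natr_neq0 n : (n.+1%:R : K) != 0.
Proof.
by have /pcharf0P -> := @diff_pchar0 K.
Qed.

End DiffField.

Section Valuation.
Variable K : acField.
Implicit Types (x y z : K) (g h d : af_G K) (s : bool).

Lemma vcmp0 s g : vcmp s g (0 : K).
Proof. by rewrite /val_cmp eqxx. Qed.

Lemma af_ac0 : af_ac (0 : K) = 0.
Proof. by apply/eqP; rewrite af_ac_eq0. Qed.

Lemma vgtW g x : vgt g x -> vge g x.
Proof. by case/orP => [/eqP ->|/ltW H]; rewrite /val_cmp ?eqxx // H orbT. Qed.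

Lemma vcmp_ge s g x : vcmp s g x -> vge g x.
Proof. by case: s => //; apply: vgtW. Qed.

(** Reduces strict inequalities to non-strict ones and the algebra of coefficients. *)
Lemma vgtE g x : vgt g x = vge g x && (coef g x == 0).
Proof.
rewrite /val_cmp /coef_at; case: (eqVneq x 0) => [_|x0] /=; first by rewrite eqxx.
rewrite lt_neqAle eq_sym; case: (eqVneq (af_v x) g) => /= [|_]; last first.
  by rewrite eqxx andbT.
by rewrite af_ac_eq0 (negPf x0) andbF.
Qed.

Lemma vgeE g x : x != 0 -> vge g x = (g <= af_v x).
Proof. by move=> x0; rewrite /val_cmp (negPf x0). Qed.

Lemma vgtE0 g x : x != 0 -> vgt g x = (g < af_v x).
Proof. by move=> x0; rewrite /val_cmp (negPf x0). Qed.

Lemma vge_val x : vge (af_v x) x.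
Proof. by rewrite /val_cmp lexx orbT. Qed.

Lemma coef_val x : x != 0 -> coef (af_v x) x = af_ac x.
Proof. by move=> x0; rewrite /coef_at x0 eqxx. Qed.

Lemma coef_neq0 g x : coef g x != 0 -> x != 0 /\ af_v x = g.
Proof. by rewrite /coef_at; case: andP => [[? /eqP]//|]; rewrite eqxx. Qed.

Lemma coef_lt g x : vgt g x -> coef g x = 0.
Proof. by rewrite vgtE => /andP[_ /eqP]. Qed.

Lemma vgt_coef g x : vge g x -> coef g x = 0 -> vgt g x.
Proof. by rewrite vgtE => -> ->; rewrite eqxx. Qed.

Lemma vgt_notge x : x != 0 -> ~~ vgt (af_v x) x.
Proof. by move=> x0; rewrite vgtE0 // ltxx. Qed.

Lemma vgtP g x : ~~ vgt g x -> vge g x -> x != 0 /\ af_v x = g.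
Proof.
rewrite vgtE => + gx; rewrite gx /= => /coef_neq0 //.
Qed.

Lemma vcmpD s g x y : vcmp s g x -> vcmp s g y -> vcmp s g (x + y).
Proof.
case: s; last exact: af_geD.
rewrite !vgtE => /andP[gx /eqP cx] /andP[gy /eqP cy].
by rewrite af_geD // af_coefD // cx cy addr0 eqxx.
Qed.

Lemma vgeM g h x y : vge g x -> vge h y -> vge (g + h) (x * y).
Proof.
rewrite /val_cmp mulf_eq0; case: eqVneq => //= x0; case: eqVneq => //= y0 gx hy.
by rewrite af_vM // oag_le_add.
Qed.

Lemma coefM g h x y : vge g x -> vge h y ->
  coef (g + h) (x * y) = coef g x * coef h y.
Proof.
rewrite /coef_at mulf_eq0 negb_or => gx hy.
case: (eqVneq x 0) gx => /= [_ _|x0]; first by rewrite mul0r.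
case: (eqVneq y 0) hy => /= [_ _ _|y0]; first by rewrite mulr0.
rewrite !vgeE // => hy gx; rewrite af_vM // af_acM //.
case: (eqVneq (af_v x) g) => [->|xg].
  case: (eqVneq (af_v y) h) => [->|yh]; first by rewrite eqxx.
  by rewrite mulr0 (inj_eq (addrI g)) (negPf yh).
rewrite mul0r; case: eqP => // E; suff: g + h < af_v x + af_v y by rewrite E ltxx.
by rewrite addrC [ltRHS]addrC oag_lt_add // lt_neqAle eq_sym xg.
Qed.

Lemma vcmpM s g h x y : vcmp s g x -> vge h y -> vcmp s (g + h) (x * y).
Proof.
case: s; last exact: vgeM.
rewrite !vgtE => /andP[gx /eqP cx] hy.
by rewrite vgeM // coefM // cx mul0r eqxx.
Qed.

Lemma vcmp_le s g h x : h <= g -> vcmp s g x -> vcmp s h x.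
Proof.
move=> hg; rewrite /val_cmp; case: eqP => //= _.
by case: s => ?; [apply: le_lt_trans hg _ | apply: le_trans hg _].
Qed.

Lemma vge_lt g h x : h < g -> vge g x -> vgt h x.
Proof. by move=> hg /orP[/eqP->|H]; rewrite /val_cmp ?eqxx // (lt_le_trans hg H) orbT. Qed.

Lemma af_v1 : af_v (1 : K) = 0.
Proof.
have := af_vM (oner_neq0 K) (oner_neq0 K).
by rewrite mulr1 -[X in X = _]addr0 => /addrI.
Qed.

Lemma af_ac1 : af_ac (1 : K) = 1.
Proof.
have := af_acM (oner_neq0 K) (oner_neq0 K); rewrite mulr1 => E.
by apply: (@mulfI _ (af_ac (1 : K))); rewrite ?af_ac_eq0 ?oner_neq0 // mulr1.
Qed.

Lemma vge1 : vge 0 (1 : K).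
Proof. by rewrite -af_v1 vge_val. Qed.

Lemma af_vN1 : af_v (-1 : K) = 0.
Proof.
have N : (-1 : K) != 0 by rewrite oppr_eq0 oner_neq0.
by apply: oag_double0; rewrite -af_vM // mulrNN mulr1 af_v1.
Qed.

Lemma af_acN1 : af_ac (-1 : K) = -1.
Proof.
have N : (-1 : K) != 0 by rewrite oppr_eq0 oner_neq0.
have G : vge 0 (-1 : K) by rewrite -af_vN1 vge_val.
have := af_coefD vge1 G; rewrite subrr /coef_at eqxx N oner_neq0 /= af_v1 af_vN1.
by rewrite eqxx af_ac1 => E; apply/eqP; rewrite -addr_eq0 addrC -E.
Qed.

Lemma af_vN x : af_v (- x) = af_v x.
Proof.
case: (eqVneq x 0) => [->|x0]; first by rewrite oppr0.
by rewrite -mulN1r af_vM ?oppr_eq0 ?oner_neq0 // af_vN1 add0r.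
Qed.

Lemma af_acN x : af_ac (- x) = - af_ac x.
Proof.
case: (eqVneq x 0) => [->|x0].
  by rewrite oppr0 af_ac0 oppr0.
by rewrite -mulN1r af_acM ?oppr_eq0 ?oner_neq0 // af_acN1 mulN1r.
Qed.

Lemma vcmpN s g x : vcmp s g (- x) = vcmp s g x.
Proof. by rewrite /val_cmp oppr_eq0 af_vN. Qed.

Lemma vcmpB s g x y : vcmp s g x -> vcmp s g y -> vcmp s g (x - y).
Proof. by move=> gx gy; apply: vcmpD => //; rewrite vcmpN. Qed.

Lemma coefN g x : coef g (- x) = - coef g x.
Proof.
by rewrite /coef_at oppr_eq0 af_vN af_acN; case: ifP; rewrite ?oppr0.
Qed.

Lemma vcmp_sum s g (I : Type) (r : seq I) (P : pred I) (F : I -> K) :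
  (forall i, P i -> vcmp s g (F i)) -> vcmp s g (\sum_(i <- r | P i) F i).
Proof.
move=> H; apply: (big_ind (fun x => vcmp s g x)) => //; first exact: vcmp0.
exact: vcmpD.
Qed.

Lemma vgeX g x n : vge g x -> vge (g *+ n) (x ^+ n).
Proof.
move=> gx; elim: n => [|n IHn]; first by rewrite mulr0n expr0 vge1.
by rewrite mulrS exprS vgeM.
Qed.

Lemma vcmp_der s g x : vcmp s g x -> vcmp s g (der x).
Proof.
case: s; last exact: af_ge_der.
rewrite !vgtE => /andP[gx /eqP cx].
by rewrite af_ge_der // af_coef_der // cx mulr0 addr0 der0 eqxx.
Qed.

Lemma vcmp_iter s g x i : vcmp s g x -> vcmp s g (iter i der x).
Proof. by move=> gx; elim: i => //= i; apply: vcmp_der. Qed.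

Lemma natr_ac n : vge 0 (n%:R : K) /\ coef 0 (n%:R : K) = n%:R.
Proof.
elim: n => [|n [IH1 IH2]]; first by rewrite vcmp0 /coef_at eqxx.
rewrite -natr1 -[in RHS]natr1 vcmpD ?vge1 // af_coefD ?vge1 // IH2.
by rewrite /coef_at oner_neq0 af_v1 eqxx /= af_ac1.
Qed.

(** The leading coefficient of an integer is that integer, nonzero because k also has characteristic
    0. Hence the exponents that appear as factors in partial derivatives do not change
    valuations. *)
Lemma af_vMn x n : x != 0 -> x *+ n.+1 != 0 /\ af_v (x *+ n.+1) = af_v x.
Proof.
move=> x0; have [_] := natr_ac n.+1 => E.
have : coef 0 (n.+1%:R : K) != 0 by rewrite E natr_neq0.
case/coef_neq0 => n0 v0; rewrite -mulr_natr mulf_neq0 //; split => //.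
by rewrite af_vM // v0 addr0.
Qed.

Lemma af_vV x : x != 0 -> af_v x^-1 = - af_v x.
Proof.
move=> x0; apply/eqP; rewrite -addr_eq0 -af_vM ?invr_eq0 //.
by rewrite mulVf // af_v1.
Qed.

Lemma af_acV x : af_ac x^-1 = (af_ac x)^-1.
Proof.
case: (eqVneq x 0) => [->|x0].
  by rewrite invr0 af_ac0 invr0.
apply: (@mulfI _ (af_ac x)); first by rewrite af_ac_eq0.
by rewrite -af_acM ?invr_eq0 // divff // divff ?af_ac_eq0 // af_ac1.
Qed.

Lemma lead_eq x y : x != 0 -> vgt (af_v x) (y - x) ->
  [/\ y != 0, af_v y = af_v x & af_ac y = af_ac x].
Proof.
move=> x0 gt; have E : coef (af_v x) y = af_ac x.
  rewrite -(subrK x y) af_coefD ?vge_val //; last exact: vgtW.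
  by rewrite coef_lt // add0r coef_val.
have /coef_neq0 [y0 yv] : coef (af_v x) y != 0 by rewrite E af_ac_eq0.
by split => //; rewrite -E -yv coef_val.
Qed.

End Valuation.

(** * Gauss valuations and Newton approximation *)

Section Shift.
Variables (n : nat) (R : comNzRingType).
Implicit Types (P Q : {mpoly R[n]}) (e h : 'I_n -> R).

Lemma mpoly_alg_ind (T : {mpoly R[n]} -> Prop) :
  (forall c, T c%:MP) -> (forall i, T 'X_i) ->
  (forall P Q, T P -> T Q -> T (P + Q)) ->
  (forall P Q, T P -> T Q -> T (P * Q)) -> forall P, T P.
Proof.
move=> TC TX TD TM P; rewrite (mpolyE P); elim: (msupp P) => [|m s IHs].
  by rewrite big_nil -mpolyC0.
rewrite big_cons; apply: TD => //; rewrite -mul_mpolyC; apply: (TM) => //.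
have T1 : T 1 by rewrite -mpolyC1.
rewrite mpolyXE_id; apply: (big_ind T) => [//|P1 P2|i _]; first exact: TM.
by elim: (m i) => [|k IHk]; rewrite ?expr0 // exprS; apply: TM.
Qed.

Lemma mderivXU i j : ('X_j : {mpoly R[n]})^`M(i) = (j == i)%:R%:MP.
Proof.
apply/mpolyP => m; rewrite mcoeff_deriv mcoeffX mcoeffC.
case: (eqVneq j i) => [->|ij].
  rewrite -[X in X == _]add0m eqm_add2r eq_sym mul1r.
  by case: eqP => [->|_]; rewrite ?mul0rn // mnm0E.
case: eqP => [/(congr1 (fun m : 'X_{1..n} => m i))|]; last by rewrite mul0rn mul0r.
by rewrite mnmDE !mnm1E (negPf ij) eqxx addn1.
Qed.

(** Taylor expansion at [e], computed as a substitution. *)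
Definition shift e P : {mpoly R[n]} :=
  mmap (@mpolyC n R) (fun i => 'X_i + (e i)%:MP) P.

Lemma shiftC e c : shift e c%:MP = c%:MP.
Proof. exact: mmapC. Qed.

Lemma shiftX e i : shift e 'X_i = 'X_i + (e i)%:MP.
Proof. by rewrite /shift mmapX mmap1U. Qed.

Lemma shiftD e P Q : shift e (P + Q) = shift e P + shift e Q.
Proof. exact: mmapD. Qed.

Lemma shiftM e P Q : shift e (P * Q) = shift e P * shift e Q.
Proof. exact: rmorphM. Qed.

Lemma shift_eval e h P : (shift e P).@[h] = P.@[fun i => h i + e i].
Proof.
elim/mpoly_alg_ind: P => [c|i|P Q IP IQ|P Q IP IQ].
- by rewrite shiftC !mevalC.
- by rewrite shiftX mevalD !mevalXU mevalC.
- by rewrite shiftD !mevalD IP IQ.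
- by rewrite shiftM !mevalM IP IQ.
Qed.

Lemma shift_shift e h P : shift e (shift h P) = shift (fun i => e i + h i) P.
Proof.
elim/mpoly_alg_ind: P => [c|i|P Q IP IQ|P Q IP IQ].
- by rewrite !shiftC.
- by rewrite !shiftX shiftD shiftX shiftC mpolyCD addrA.
- by rewrite !shiftD IP IQ.
- by rewrite !shiftM IP IQ.
Qed.

Lemma shift_deriv e i P : shift e P^`M(i) = (shift e P)^`M(i).
Proof.
elim/mpoly_alg_ind: P => [c|j|P Q IP IQ|P Q IP IQ].
- by rewrite shiftC mderivC -mpolyC0 shiftC.
- by rewrite shiftX mderivD mderivC addr0 mderivXU shiftC.
- by rewrite shiftD mderivD shiftD IP IQ mderivD.
- by rewrite shiftM !mderivM shiftD !shiftM IP IQ.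
Qed.

Lemma eq_shift e h P : e =1 h -> shift e P = shift h P.
Proof.
move=> E; elim/mpoly_alg_ind: P => [c|i|P Q IP IQ|P Q IP IQ].
- by rewrite !shiftC.
- by rewrite !shiftX E.
- by rewrite !shiftD IP IQ.
- by rewrite !shiftM IP IQ.
Qed.

Lemma shift0 P : shift (fun=> 0) P = P.
Proof.
elim/mpoly_alg_ind: P => [c|i|P Q IP IQ|P Q IP IQ].
- by rewrite shiftC.
- by rewrite shiftX mpolyC0 addr0.
- by rewrite shiftD IP IQ.
- by rewrite shiftM IP IQ.
Qed.

Lemma meval_at0 P : P.@[fun=> 0] = P@_0.
Proof.
elim/mpoly_alg_ind: P => [c|i|P Q IP IQ|P Q IP IQ].
- by rewrite mevalC mcoeffC eqxx mulr1.
- by rewrite mevalXU mcoeffX mnm1_eq0.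
- by rewrite mevalD mcoeffD IP IQ.
- by rewrite mevalM IP IQ rmorphM.
Qed.

Lemma shift_coef0 e P : (shift e P)@_0 = P.@[e].
Proof.
rewrite -meval_at0 shift_eval; apply: meval_eq => i; exact: add0r.
Qed.

End Shift.

Lemma map_shift n (R S : comNzRingType) (f : {rmorphism R -> S}) e
  (P : {mpoly R[n]}) : map_mpoly f (shift e P) = shift (f \o e) (map_mpoly f P).
Proof.
elim/mpoly_alg_ind: P => [c|i|P Q IP IQ|P Q IP IQ].
- by rewrite shiftC !map_mpolyC shiftC.
- by rewrite shiftX rmorphD /= map_mpolyC !map_mpolyX shiftX.
- by rewrite shiftD !rmorphD /= shiftD IP IQ.
- by rewrite shiftM !rmorphM /= shiftM IP IQ.
Qed.

Lemma map_deriv n (R S : comNzRingType) (f : {rmorphism R -> S}) i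
  (P : {mpoly R[n]}) : map_mpoly f P^`M(i) = (map_mpoly f P)^`M(i).
Proof.
by apply/mpolyP => m; rewrite mcoeff_map_mpoly !mcoeff_deriv mcoeff_map_mpoly raddfMn.
Qed.

Section Level.
Variables (K : acField) (n : nat).
Implicit Types (P Q : {mpoly K[n]}) (g d : af_G K) (s : bool).

(* The Gauss valuation of [Q] on the disc of radius [g] is at least [d]. *)
Definition level s g d Q := forall m, vcmp s (d - g *+ mdeg m) Q@_m.

Lemma levelD s g d P Q : level s g d P -> level s g d Q -> level s g d (P + Q).
Proof. by move=> lP lQ m; rewrite mcoeffD vcmpD. Qed.

Lemma level0 s g d : level s g d 0.
Proof. by move=> m; rewrite mcoeff0 vcmp0. Qed.

Lemma levelM s g d d' P Q : level s g d P -> level false g d' Q ->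
  level s g (d + d') (P * Q).
Proof.
move=> lP lQ m; rewrite mcoeffM; apply: vcmp_sum => -[[m1 ?] [m2 ?]] /eqP /=.
move=> /(congr1 (@mdeg n)) E; rewrite {}E.
have -> : d + d' - g *+ mdeg (m1 + m2) = (d - g *+ mdeg m1) + (d' - g *+ mdeg m2).
  by rewrite mdegD mulrnDr opprD addrACA.
exact: vcmpM.
Qed.

Lemma levelC s g d c : vcmp s d c -> level s g d c%:MP.
Proof.
move=> dc m; rewrite mcoeffC; case: (eqVneq m 0%MM) => [->|_].
  by rewrite mulr1 mdeg0 mulr0n subr0.
by rewrite mulr0 vcmp0.
Qed.

Lemma levelX g i c : vge g c -> level false g g ('X_i + c%:MP).
Proof.
move=> gc; apply: levelD; last exact: levelC.
move=> m; rewrite mcoeffX; case: eqP => [<-|_]; last exact: vcmp0.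
by rewrite mdeg1 mulr1n subrr vge1.
Qed.

Lemma level_shift s g d e Q : (forall i, vge g (e i)) ->
  level s g d Q -> level s g d (shift e Q).
Proof.
move=> ge lQ; rewrite /shift /mmap.
apply: (big_ind (level s g d)) => [||m _]; [exact: level0|exact: levelD|].
rewrite -[d](subrK (g *+ mdeg m)); apply: levelM; first exact: levelC.
rewrite /mmap1 mdegE; elim: (index_enum _) => [|i r IHr].
  by rewrite !big_nil -mpolyC1; apply: levelC; rewrite mulr0n vge1.
rewrite !big_cons mulrnDr; apply: levelM => //.
elim: (m i) => [|j IHj]; first by rewrite mulr0n expr0 -mpolyC1; apply: levelC; exact: vge1.
by rewrite mulrS exprS; apply: levelM => //; apply: levelX.
Qed.

Lemma level_eval s g d h Q : (forall i, vge g (h i)) ->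
  level s g d Q -> vcmp s d Q.@[h].
Proof.
move=> gh lQ; rewrite -shift_coef0.
by have := level_shift gh lQ 0%MM; rewrite mdeg0 mulr0n subr0.
Qed.

Definition jet (x : K) : 'I_n -> K := fun i => iter i der x.

Lemma jetD x y : (fun i => jet x i + jet y i) =1 jet (x + y).
Proof. by move=> i; rewrite /jet iter_derD. Qed.

Lemma vcmp_jet s g x i : vcmp s g x -> vcmp s g (jet x i).
Proof. exact: vcmp_iter. Qed.

Lemma shift_jet x y Q : shift (jet x) (shift (jet y) Q) = shift (jet (x + y)) Q.
Proof. by rewrite shift_shift; apply: eq_shift; apply: jetD. Qed.

Lemma eval_shift_jet x y Q : (shift (jet x) Q).@[jet y] = Q.@[jet (y + x)].
Proof. by rewrite shift_eval; apply: meval_eq => i; rewrite jetD. Qed.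

Lemma level_recenter s g d x y Q : vge g (y - x) ->
  level s g d (shift (jet x) Q) -> level s g d (shift (jet y) Q).
Proof.
move=> gxy lQ; rewrite -[y](subrK x) -shift_jet; apply: level_shift => // i.
exact: vcmp_jet.
Qed.

Lemma level_le g g' d Q : g <= g' -> level false g d Q -> level false g' d Q.
Proof.
move=> gg' lQ m; apply: vcmp_le (lQ m).
by rewrite oag_le_add // oag_leN2 oag_leMn2.
Qed.

Lemma level_eval_close g d x y z Q : vge g (y - x) -> vgt g (z - y) ->
  level false g d (shift (jet x) Q) -> vgt d (Q.@[jet z] - Q.@[jet y]).
Proof.
move=> gyx gzy /(level_recenter gyx) lS; pose S := shift (jet y) Q.
case: (eqVneq (z - y) 0) gzy => [/eqP + _|zy0].
  by rewrite subr_eq0 => /eqP ->; rewrite subrr vcmp0.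
rewrite vgtE0 // => gg'.
(* The difference is the value at [z - y] of the Taylor polynomial at [y] without its constant term;
   the other terms gain because the radius improves from [g] to the larger valuation of [z - y]. *)
have -> : Q.@[jet z] - Q.@[jet y] = (S - (S@_0)%:MP).@[jet (z - y)].
  by rewrite mevalB mevalC shift_coef0 eval_shift_jet subrK.
apply: (@level_eval _ (af_v (z - y))) => [i|m].
  by apply: vcmp_jet; apply: vge_val.
rewrite mcoeffB mcoeffC; case: (eqVneq m 0%MM) => [->|m0].
  by rewrite mulr1 subrr vcmp0.
rewrite mulr0 subr0; apply: vge_lt (lS m).
rewrite -mdeg_eq0 in m0; case: (mdeg m) m0 => // k _.
by rewrite addrC [ltRHS]addrC oag_ltD2r ltNge oag_leN2 -ltNge oag_ltMn2.
Qed.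

End Level.

Record diff_subring (R : comNzRingType) (D : R -> R) (L : R -> Prop) : Prop := {
  ds_1 : L 1;
  ds_B : forall x y, L x -> L y -> L (x - y);
  ds_M : forall x y, L x -> L y -> L (x * y);
  ds_der : forall x, L x -> L (D x)
}.

Section DiffSubring.
Variables (R : comNzRingType) (D : R -> R) (L : R -> Prop).
Hypothesis dsL : diff_subring D L.

Lemma ds_0 : L 0.
Proof. by rewrite -(subrr 1); apply: ds_B dsL _ _ (ds_1 dsL) (ds_1 dsL). Qed.

Lemma ds_N x : L x -> L (- x).
Proof. by move=> Lx; rewrite -sub0r; apply: ds_B dsL _ _ ds_0 Lx. Qed.

Lemma ds_D x y : L x -> L y -> L (x + y).
Proof. by move=> Lx Ly; rewrite -[y]opprK; apply: ds_B dsL _ _ Lx (ds_N Ly). Qed.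

Lemma ds_sum (I : Type) (r : seq I) (P : pred I) (F : I -> R) :
  (forall i, P i -> L (F i)) -> L (\sum_(i <- r | P i) F i).
Proof. by move=> H; apply: big_ind => //; [exact: ds_0 | exact: ds_D]. Qed.

Lemma ds_Mn x n : L x -> L (x *+ n).
Proof.
move=> Lx; elim: n => [|n IHn]; first by rewrite mulr0n; apply: ds_0.
by rewrite mulrS; apply: ds_D.
Qed.

Lemma ds_iter x i : L x -> L (iter i D x).
Proof. by move=> Lx; elim: i => //= i; apply: ds_der dsL _. Qed.

Definition coefs_in n (P : {mpoly R[n]}) := forall m, L P@_m.

Lemma coefs_inD n (P Q : {mpoly R[n]}) :
  coefs_in P -> coefs_in Q -> coefs_in (P + Q).
Proof. by move=> LP LQ m; rewrite mcoeffD; apply: ds_D. Qed.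

Lemma coefs_inM n (P Q : {mpoly R[n]}) :
  coefs_in P -> coefs_in Q -> coefs_in (P * Q).
Proof.
by move=> LP LQ m; rewrite mcoeffM; apply: ds_sum => i _; apply: ds_M dsL _ _ _ _.
Qed.

Lemma coefs_inC n c : L c -> coefs_in (c%:MP : {mpoly R[n]}).
Proof.
move=> Lc m; rewrite mcoeffC; case: eqP => _; first by rewrite mulr1.
by rewrite mulr0; apply: ds_0.
Qed.

Lemma coefs_inX n m : coefs_in ('X_[m] : {mpoly R[n]}).
Proof.
move=> m'; rewrite mcoeffX; case: eqP => _; [exact: ds_1 dsL|exact: ds_0].
Qed.

Lemma coefs_in_shift n e (P : {mpoly R[n]}) :
  (forall i, L (e i)) -> coefs_in P -> coefs_in (shift e P).
Proof.
move=> Le LP; rewrite /shift /mmap.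
apply: (big_ind (@coefs_in n)) => [m|P1 P2|m _].
- by rewrite mcoeff0; apply: ds_0.
- exact: coefs_inD.
apply: coefs_inM; first exact: coefs_inC.
rewrite /mmap1; apply: (big_ind (@coefs_in n)) => [m'|P1 P2|i _].
- by rewrite mcoeff1; case: eqP => _; [exact: ds_1 dsL|exact: ds_0].
- exact: coefs_inM.
elim: (m i) => [|j IHj].
  by move=> m'; rewrite expr0 mcoeff1; case: eqP => _; [exact: ds_1 dsL|exact: ds_0].
rewrite exprS; apply: coefs_inM => //; apply: coefs_inD; first exact: coefs_inX.
exact: coefs_inC.
Qed.

End DiffSubring.

Section Newton.
Variable K : acField.

(* Differential henselianity in Newton form: when the linear part of [Q]
   dominates the terms of higher degree on the disc of radius [g], and is not
   dominated by the constant term, [Q] has a zero in that disc. *)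
Definition newtonian (L : K -> Prop) := forall n (Q : {mpoly K[n]}) (g d : af_G K),
  coefs_in L Q -> vge d Q@_0 -> (forall i, vge (d - g) Q@_U_(i)) ->
  (exists i, ~~ vgt (d - g) Q@_U_(i)) ->
  (forall m, (1 < mdeg m)%N -> vgt (d - g *+ mdeg m) Q@_m) ->
  exists y, [/\ L y, vge g y & Q.@[jet y] = 0].

Variables (n : nat) (Q : {mpoly K[n]}) (a : K).

Lemma shift_coef1 i : (shift (jet a) Q)@_U_(i) = Q^`M(i).@[jet a].
Proof.
by rewrite -[RHS]shift_coef0 shift_deriv mcoeff_deriv add0m mnm0E.
Qed.

Lemma level_linear g d i : level false g d (shift (jet a) Q) ->
  vge (d - g) Q^`M(i).@[jet a].
Proof. by move=> /(_ U_(i)%MM); rewrite shift_coef1 mdeg1 mulr1n. Qed.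

(** The Gauss norm of [Q] is attained at a monomial [m], nonconstant because [Q] is small at [a].
    Lowering [m] in a variable [i] that it contains gives a coefficient of the partial derivative
    with the same valuation, by characteristic 0. So the Gauss valuation of that derivative is at
    most [d - g], and genericity transfers the bound to its value at [a]. *)
Lemma level_linear_sharp x g d : vge g (a - x) ->
  level false g d (shift (jet x) Q) -> ~ level true g d (shift (jet x) Q) ->
  vgt d Q.@[jet a] ->
  (forall i, Q^`M(i) != 0 -> exists2 d', level false g d' (shift (jet x) Q^`M(i)) &
    ~~ vgt d' Q^`M(i).@[jet a]) ->
  exists i, ~~ vgt (d - g) Q^`M(i).@[jet a].
Proof.
move=> gax lQ nlQ Qa gen; pose S := shift (jet a) Q.
have lS : level false g d S by apply: level_recenter lQ.
have [m mS] : exists m, ~~ vgt (d - g *+ mdeg m) S@_m.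
  apply/not_existsP => H; apply: nlQ; apply: (@level_recenter _ _ _ _ _ a).
    by rewrite -vcmpN opprB.
  by move=> m; have /negP := H m; rewrite negbK.
have m0 : m != 0%MM.
  by apply: contraNneq mS => ->; rewrite mdeg0 mulr0n subr0 shift_coef0.
have [i mi] : exists i, m i != 0%N.
  apply/not_existsP => H; case/eqP: m0; apply/mnmP => i; rewrite mnm0E.
  by have /negP := H i; rewrite negbK => /eqP.
move: mi; rewrite -lep1mP => /submK; set m' := (m - _)%MM => Em.
have Ei : (shift (jet a) Q^`M(i))@_m' = S@_m *+ (m' i).+1.
  by rewrite shift_deriv mcoeff_deriv Em.
have [s0 vs] := vgtP mS (lS m).
have [c0 vc] := af_vMn (m' i) s0; rewrite -Ei vs in c0 vc.
have Qi0 : Q^`M(i) != 0.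
  by apply: contraNneq c0 => ->; rewrite -mpolyC0 shiftC mpolyC0 mcoeff0.
have [d' ld' nd'] := gen i Qi0; exists i.
have := level_recenter gax ld' m'; rewrite (vgeE _ c0) vc -Em mdegD mdeg1 mulrnDr.
rewrite mulr1n opprD addrA addrAC oag_leD2r => dd'.
by apply: contra nd'; apply: vcmp_le.
Qed.

(** One Newton step from [a]. Its length depends only on the values of [Q] and its derivatives at
    [a], so the same zero is close in every disc, of any radius [g'] and level [d'], where the
    linear part is large enough and the value small. This serves all centres at once. *)
Lemma newton_zero (L : K -> Prop) g d : diff_subring der L -> newtonian L ->
  coefs_in L Q -> L a -> level false g d (shift (jet a) Q) -> vgt d Q.@[jet a] ->
  (exists i, ~~ vgt (d - g) Q^`M(i).@[jet a]) ->
  exists b, [/\ L b, Q.@[jet b] = 0 & forall g' d',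
    (exists i, ~~ vgt (d' - g') Q^`M(i).@[jet a]) -> vgt d' Q.@[jet a] ->
    vgt g' (b - a)].
Proof.
move=> dsL newt LQ La lS Qa exi.
case: (eqVneq Q.@[jet a] 0) => [Qa0|Qa0].
  by exists a; split => // *; rewrite subrr vcmp0.
rewrite vgtE0 // in Qa; set e := af_v _ in Qa.
(* Length of the Newton step: the valuation [e] of [Q] at [a] minus the valuation [d - g] of its
   linear part. It exceeds [g], and on the smaller disc the terms of degree above 1 lose against the
   linear ones. *)
pose g1 := e - (d - g); have Dg1 : g1 = e - (d - g) by [].
have gg1 : g < g1 by rewrite oag_ltBrD addrC subrK.
have Eg1 : e - g1 = d - g by rewrite /g1 opprB addrC subrK.
clearbody g1.
have [] := newt n (shift (jet a) Q) g1 e.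
- by apply: (coefs_in_shift dsL) => // i; exact: (ds_iter dsL).
- by rewrite shift_coef0 vge_val.
- by move=> i; rewrite Eg1 shift_coef1; apply: level_linear.
- by case: exi => i ni; exists i; rewrite Eg1 shift_coef1.
- move=> m m1; apply: vge_lt (lS m); case: (mdeg m) m1 => [|[|k]] // _.
  rewrite mulrS [g *+ _]mulrS !opprD !addrA Eg1 addrC [ltRHS]addrC oag_ltD2r.
  by rewrite ltNge oag_leN2 -ltNge oag_ltMn2.
move=> y [Ly gy Qy]; exists (a + y); split.
- exact: ds_D dsL _ _ La Ly.
- by rewrite addrC -eval_shift_jet.
move=> g' d' [i ni]; rewrite vgtE0 // -/e addrC addKr => de.
apply: vge_lt gy; rewrite Dg1 oag_ltBrD.
(* All linear coefficients have valuation at least [d - g], and one of them is not above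
   [d' - g']. *)
have : d - g <= d' - g'.
  rewrite leNgt; apply: contra ni => lt.
  by apply: vge_lt lt _; apply: level_linear.
by rewrite oag_leBrD addrC => H; apply: le_lt_trans H de.
Qed.

End Newton.

(** * Partial isomorphisms as subfields of a product *)

Section Pairs.
Variables (F1 F2 : diffFieldType).
Local Notation X := (F1 * F2)%type.
Implicit Types w x y : X.

Definition derp w : X := (der w.1, der w.2).

Definition invp w : X := (w.1^-1, w.2^-1).

Definition jetp n w : 'I_n -> X := fun i => iter i derp w.

Lemma derpD x y : derp (x + y) = derp x + derp y.
Proof. by rewrite /derp !derD. Qed.

Lemma derpM x y : derp (x * y) = derp x * y + x * derp y.
Proof. by rewrite /derp !derM. Qed.

Lemma iter_derp i w : iter i derp w = (iter i der w.1, iter i der w.2).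
Proof. by elim: i => [|i /= ->] //; case: w. Qed.

Lemma pairE w : w = (w.1, w.2).
Proof. by case: w. Qed.

Lemma derp_sum (I : Type) (r : seq I) (P : pred I) (F : I -> X) :
  derp (\sum_(i <- r | P i) F i) = \sum_(i <- r | P i) derp (F i).
Proof.
elim: r => [|i r IHr]; first by rewrite !big_nil /derp !der0.
by rewrite !big_cons; case: (P i) => //; rewrite derpD IHr.
Qed.

Definition poly1 n (P : {mpoly X[n]}) : {mpoly F1[n]} := map_mpoly fst P.
Definition poly2 n (P : {mpoly X[n]}) : {mpoly F2[n]} := map_mpoly snd P.

Lemma poly1_coef n (P : {mpoly X[n]}) m : (poly1 P)@_m = (P@_m).1.
Proof. exact: mcoeff_map_mpoly. Qed.

Lemma poly2_coef n (P : {mpoly X[n]}) m : (poly2 P)@_m = (P@_m).2.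
Proof. exact: mcoeff_map_mpoly. Qed.

Lemma eval1 n (P : {mpoly X[n]}) (w : X) :
  (P.@[jetp w]).1 = (poly1 P).@[fun i => iter i der w.1].
Proof.
rewrite /poly1; elim/mpoly_alg_ind: P => [c|i|P Q IP IQ|P Q IP IQ].
- by rewrite map_mpolyC !mevalC.
- by rewrite map_mpolyX !mevalXU /jetp iter_derp.
- by rewrite (rmorphD (map_mpoly fst)) !mevalD /= IP IQ.
- by rewrite (rmorphM (map_mpoly fst)) !mevalM /= IP IQ.
Qed.

Lemma eval2 n (P : {mpoly X[n]}) (w : X) :
  (P.@[jetp w]).2 = (poly2 P).@[fun i => iter i der w.2].
Proof.
rewrite /poly2; elim/mpoly_alg_ind: P => [c|i|P Q IP IQ|P Q IP IQ].
- by rewrite map_mpolyC !mevalC.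
- by rewrite map_mpolyX !mevalXU /jetp iter_derp.
- by rewrite (rmorphD (map_mpoly snd)) !mevalD /= IP IQ.
- by rewrite (rmorphM (map_mpoly snd)) !mevalM /= IP IQ.
Qed.

Lemma shift1 n (P : {mpoly X[n]}) (w : X) :
  poly1 (shift (jetp w) P) = shift (fun i => iter i der w.1) (poly1 P).
Proof.
by rewrite /poly1 map_shift; apply: eq_shift => i; rewrite /= /jetp iter_derp.
Qed.

Lemma shift2 n (P : {mpoly X[n]}) (w : X) :
  poly2 (shift (jetp w) P) = shift (fun i => iter i der w.2) (poly2 P).
Proof.
by rewrite /poly2 map_shift; apply: eq_shift => i; rewrite /= /jetp iter_derp.
Qed.

Lemma deriv1 n (P : {mpoly X[n]}) i : poly1 P^`M(i) = (poly1 P)^`M(i).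
Proof. exact: map_deriv. Qed.

Lemma deriv2 n (P : {mpoly X[n]}) i : poly2 P^`M(i) = (poly2 P)^`M(i).
Proof. exact: map_deriv. Qed.

Definition polyder n (P : {mpoly X[n]}) : {mpoly X[n]} :=
  \sum_(m <- msupp P) derp P@_m *: 'X_[m].

Lemma polyder_coef n (P : {mpoly X[n]}) m : (polyder P)@_m = derp P@_m.
Proof.
rewrite /polyder raddf_sum /=; case: (boolP (m \in msupp P)) => [mP|mP].
  rewrite (bigD1_seq m) ?msupp_uniq //= big1 ?addr0 => [|m' /negPf m'm].
    by rewrite mcoeffZ mcoeffX eqxx mulr1.
  by rewrite mcoeffZ mcoeffX m'm mulr0.
rewrite big1_seq ?memN_msupp_eq0 // => [|m' /= m'P].
  by rewrite /derp /= !der0.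
rewrite mcoeffZ mcoeffX; case: eqP m'P mP => [-> -> //|_ _ _]; by rewrite mulr0.
Qed.

(** The chain rule. At a zero [w] of [G] it expresses the next derivative of [w] through lower ones,
    after division by the separant. *)
Lemma derp_eval n (P : {mpoly X[n]}) w : derp P.@[jetp w] =
  (polyder P).@[jetp w] + \sum_(i < n) P^`M(i).@[jetp w] * iter i.+1 derp w.
Proof.
elim/mpoly_alg_ind: P => [c|j|P Q IP IQ|P Q IP IQ].
- have -> : polyder c%:MP = (derp c)%:MP :> {mpoly X[n]}.
    apply/mpolyP => m; rewrite polyder_coef !mcoeffC.
    by case: eqP => _; rewrite ?mulr1 // !mulr0 /derp !der0.
  rewrite !mevalC big1 ?addr0 // => i _.
  by rewrite mderivC meval0 mul0r.
- have -> : polyder 'X_j = 0 :> {mpoly X[n]}.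
    apply/mpolyP => m; rewrite polyder_coef mcoeffX mcoeff0 /derp /=.
    by case: eqP => _; rewrite ?der1 ?der0.
  rewrite meval0 add0r mevalXU (bigD1 j) //= mderivXU eqxx mevalC mul1r.
  rewrite big1 ?addr0 // => i ij.
  by rewrite mderivXU eq_sym (negPf ij) mevalC mul0r.
- have -> : polyder (P + Q) = polyder P + polyder Q.
    by apply/mpolyP => m; rewrite mcoeffD !polyder_coef mcoeffD derpD.
  rewrite !mevalD derpD IP IQ addrACA -big_split /=; congr (_ + _).
  by apply: eq_bigr => i _; rewrite mderivD mevalD mulrDl.
- have -> : polyder (P * Q) = polyder P * Q + P * polyder Q.
    apply/mpolyP => m; rewrite mcoeffD polyder_coef !mcoeffM derp_sum -big_split.
    by apply: eq_bigr => i _; rewrite derpM !polyder_coef.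
  rewrite mevalD !mevalM derpM IP IQ mulrDl mulrDr addrACA; congr (_ + _).
  rewrite mulr_suml mulr_sumr -big_split; apply: eq_bigr => i _ /=.
  by rewrite mderivM mevalD !mevalM mulrDl mulrAC mulrA.
Qed.

End Pairs.

Section RVIso.
Variables (K1 K2 : acField).
Local Notation X := (K1 * K2)%type.

(** Graphs of partial isomorphisms: [rr_eq0] and [rv_le] make the relations functional and
    injective, and the closure conditions make domains and ranges substructures. *)
Record rv_iso (Rr : af_k K1 * af_k K2 -> Prop) (Rv : af_G K1 * af_G K2 -> Prop) :
    Prop := {
  rr_ring : diff_subring (@derp _ _) Rr;
  rr_inv : forall x, Rr x -> Rr (invp x);
  rr_eq0 : forall x, Rr x -> (x.1 == 0) = (x.2 == 0);
  rv_0 : Rv 0;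
  rv_B : forall g h, Rv g -> Rv h -> Rv (g - h);
  rv_le : forall g h, Rv g -> Rv h -> (g.1 <= h.1) = (g.2 <= h.2);
  rv_cmap : forall g, Rv g -> Rr (af_c g.1, af_c g.2)
}.

Variables (Rr : af_k K1 * af_k K2 -> Prop) (Rv : af_G K1 * af_G K2 -> Prop).

(** The guard is there because the valuation of 0 carries no meaning. *)
Definition rv_match (w : X) : Prop :=
  Rr (af_ac w.1, af_ac w.2) /\ (w.1 != 0 -> Rv (af_v w.1, af_v w.2)).

(** That [Rf] is functional and injective follows from matching: the difference of two pairs is
    matched, so its components vanish together. *)
Record field_iso (Rf : X -> Prop) : Prop := {
  rf_ring : diff_subring (@derp _ _) Rf;
  rf_inv : forall x, Rf x -> Rf (invp x);
  rf_match : forall x, Rf x -> rv_match x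
}.

Hypothesis iso : rv_iso Rr Rv.

Lemma rv_N g : Rv g -> Rv (- g).
Proof. by move=> Rg; rewrite -sub0r; apply: (rv_B iso) => //; apply: (rv_0 iso). Qed.

Lemma rv_D g h : Rv g -> Rv h -> Rv (g + h).
Proof. by move=> Rg Rh; rewrite -[h]opprK; apply: (rv_B iso) => //; apply: rv_N. Qed.

Lemma rv_Mn g n : Rv g -> Rv (g *+ n).
Proof.
move=> Rg; elim: n => [|n IHn]; first by rewrite mulr0n; apply: (rv_0 iso).
by rewrite mulrS; apply: rv_D.
Qed.

Lemma rv_lt g h : Rv g -> Rv h -> (g.1 < h.1) = (g.2 < h.2).
Proof. by move=> Rg Rh; rewrite !ltNge (rv_le iso). Qed.

Lemma rv_eq g h : Rv g -> Rv h -> (g.1 == h.1) = (g.2 == h.2).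
Proof. by move=> Rg Rh; rewrite !eq_le !(rv_le iso). Qed.

Lemma rv_match0 w : rv_match w -> (w.1 == 0) = (w.2 == 0).
Proof. by case=> /(rr_eq0 iso) /=; rewrite !af_ac_eq0. Qed.

Lemma rv_match_val w : rv_match w -> w.1 != 0 -> Rv (af_v w.1, af_v w.2).
Proof. by case. Qed.

Lemma rv_match_0 : rv_match 0.
Proof.
split; last by rewrite eqxx.
by rewrite !af_ac0; apply: (ds_0 (rr_ring iso)).
Qed.

Lemma rv_matchM x y : rv_match x -> rv_match y -> rv_match (x * y).
Proof.
move=> mx my; case: (eqVneq x.1 0) => [x0|x0].
  have -> : x * y = 0.
    have := rv_match0 mx; rewrite x0 eqxx => /esym /eqP x2.
    by rewrite [x]pairE [y]pairE x0 x2; congr pair; rewrite /= mul0r.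
  exact: rv_match_0.
case: (eqVneq y.1 0) => [y0|y0].
  have -> : x * y = 0.
    have := rv_match0 my; rewrite y0 eqxx => /esym /eqP y2.
    by rewrite [x]pairE [y]pairE y0 y2; congr pair; rewrite /= mulr0.
  exact: rv_match_0.
have x2 : x.2 != 0 by rewrite -(rv_match0 mx).
have y2 : y.2 != 0 by rewrite -(rv_match0 my).
case: mx my => [Rx vx] [Ry vy]; split=> [|_] /=.
  by rewrite !af_acM //; apply: (ds_M (rr_ring iso) Rx Ry).
by rewrite !af_vM //; apply: (rv_D (vx x0) (vy y0)).
Qed.

Lemma rv_matchV x : rv_match x -> rv_match (invp x).
Proof.
move=> mx; case: (eqVneq x.1 0) => [x0|x0].
  have -> : invp x = 0.
    have := rv_match0 mx; rewrite x0 eqxx => /esym /eqP x2.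
    by rewrite /invp x0 x2 !invr0.
  exact: rv_match_0.
have x2 : x.2 != 0 by rewrite -(rv_match0 mx).
case: mx => [Rx vx]; split => [|_] /=; first by rewrite !af_acV; apply: (rr_inv iso Rx).
by rewrite !af_vV //; apply: (rv_N (vx x0)).
Qed.

Lemma rv_match_div x p q : rv_match p -> rv_match q -> q.1 != 0 -> x * q = p ->
  rv_match x.
Proof.
move=> mp mq q0 E; have q2 : q.2 != 0 by rewrite -(rv_match0 mq).
have -> : x = p * invp q.
  by rewrite -E [x]pairE; congr pair; rewrite /= mulfK.
by apply: rv_matchM => //; apply: rv_matchV.
Qed.

(** Correspondence of the coefficients of t^d, which may be 0. Unlike [rv_match] this is closed
    under sums, hence suited to polynomial evaluation; it gives back a match once the valuation is
    exactly [d]. *)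
Definition graded (d : af_G K1 * af_G K2) (w : X) : Prop :=
  [/\ vge d.1 w.1, vge d.2 w.2 & Rr (coef d.1 w.1, coef d.2 w.2)].

Lemma gradedD d x y : graded d x -> graded d y -> graded d (x + y).
Proof.
move=> [x1 x2 xr] [y1 y2 yr]; split; try exact: vcmpD.
have -> : (coef d.1 (x + y).1, coef d.2 (x + y).2) =
    (coef d.1 x.1, coef d.2 x.2) + (coef d.1 y.1, coef d.2 y.2).
  by congr pair; apply: af_coefD.
exact: (ds_D (rr_ring iso) xr yr).
Qed.

Lemma gradedM d e x y : graded d x -> graded e y -> graded (d + e) (x * y).
Proof.
move=> [x1 x2 xr] [y1 y2 yr]; split; try exact: vgeM.
have -> : (coef (d + e).1 (x * y).1, coef (d + e).2 (x * y).2) =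
    (coef d.1 x.1, coef d.2 x.2) * (coef e.1 y.1, coef e.2 y.2).
  by congr pair; apply: coefM.
exact: (ds_M (rr_ring iso) xr yr).
Qed.

Lemma graded_der d x : Rv d -> graded d x -> graded d (derp x).
Proof.
move=> Rd [x1 x2 xr]; split; try exact: vcmp_der.
pose u := (coef d.1 x.1, coef d.2 x.2).
have -> : (coef d.1 (derp x).1, coef d.2 (derp x).2) =
    derp u + (af_c d.1, af_c d.2) * u.
  by congr pair; apply: af_coef_der.
apply: (ds_D (rr_ring iso)); first exact: (ds_der (rr_ring iso) xr).
exact: (ds_M (rr_ring iso) (rv_cmap iso Rd) xr).
Qed.

Lemma graded_0 d : graded d 0.
Proof.
split; try exact: vcmp0.
by rewrite /coef_at !eqxx; apply: (ds_0 (rr_ring iso)).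
Qed.

Lemma graded_1 : graded 0 1.
Proof.
split; try exact: vge1.
by rewrite /coef_at !oner_neq0 !af_v1 !eqxx /= !af_ac1; apply: (ds_1 (rr_ring iso)).
Qed.

Lemma match_graded d w : rv_match w -> Rv d -> vge d.1 w.1 -> graded d w.
Proof.
move=> mw Rd ge; have E := rv_match0 mw; case: mw => [Rw vw].
case: (eqVneq w.1 0) => [w0|w0].
  have -> : w = 0.
    by move: E; rewrite w0 eqxx => /esym /eqP w2; rewrite [w]pairE w0 w2.
  exact: graded_0.
have w2 : w.2 != 0 by rewrite -E.
move: (vw w0) => {}vw; rewrite vgeE // in ge; split.
- by rewrite vgeE.
- by rewrite vgeE // -(rv_le iso Rd vw).
rewrite /coef_at w0 w2 /= -(rv_eq vw Rd) /=.
by case: eqP => // _; apply: (ds_0 (rr_ring iso)).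
Qed.

Lemma graded_vgt d w : graded d w -> vgt d.1 w.1 = vgt d.2 w.2.
Proof.
by case=> [w1 w2 /(rr_eq0 iso) E]; rewrite !vgtE w1 w2.
Qed.

Lemma graded_match d w : Rv d -> graded d w -> ~~ vgt d.1 w.1 ->
  w.1 != 0 /\ rv_match w.
Proof.
move=> Rd gw ngt; have ngt2 : ~~ vgt d.2 w.2 by rewrite -graded_vgt.
case: gw => w1 w2 Rw; have [w10 v1] := vgtP ngt w1; have [w20 v2] := vgtP ngt2 w2.
split => //; split=> [|_]; last by rewrite v1 v2 -surjective_pairing.
by rewrite -(coef_val w10) -(coef_val w20) v1 v2.
Qed.

Lemma graded_eval n (P : {mpoly X[n]}) g d w : Rv g -> graded g w ->
  (forall m, graded (d - g *+ mdeg m) P@_m) -> graded d P.@[jetp w].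
Proof.
move=> Rg gw gP; rewrite mevalE.
apply: (big_ind (graded d)) => [||m _]; [exact: graded_0|exact: gradedD|].
rewrite -[d](subrK (g *+ mdeg m)); apply: gradedM => //.
rewrite mdegE; elim: (index_enum _) => [|i r IHr].
  by rewrite !big_nil; apply: graded_1.
rewrite !big_cons mulrnDr; apply: gradedM => //.
have gi : graded g (jetp w i).
  by rewrite /jetp; elim: (nat_of_ord i) => //= j; apply: graded_der.
elim: (m i) => [|j IHj]; first by rewrite mulr0n expr0; apply: graded_1.
by rewrite mulrS exprS; apply: gradedM.
Qed.

End RVIso.

Lemma seq_argmin (T : eqType) (G : oagType) (f : T -> G) (s : seq T) :
  s != [::] -> exists2 x, x \in s & forall y, y \in s -> f x <= f y.
Proof.
elim: s => // a s IHs _; case: (eqVneq s [::]) => [->|/IHs [x xs xmin]].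
  by exists a; rewrite ?mem_head // => y; rewrite inE => /eqP ->.
case: (leP (f a) (f x)) => ax.
  exists a; rewrite ?mem_head // => y; rewrite inE => /orP[/eqP -> //|ys].
  exact: le_trans ax (xmin y ys).
exists x; first by rewrite inE xs orbT.
by move=> y; rewrite inE => /orP[/eqP ->|/xmin //]; apply: ltW.
Qed.

Lemma fst_Mn (A B : zmodType) (g : A * B) n : (g *+ n).1 = g.1 *+ n.
Proof. by elim: n => // n IHn; rewrite !mulrS /= IHn. Qed.

Lemma snd_Mn (A B : zmodType) (g : A * B) n : (g *+ n).2 = g.2 *+ n.
Proof. by elim: n => // n IHn; rewrite !mulrS /= IHn. Qed.

Lemma nat_minimal (P : nat -> Prop) :
  (exists n, P n) -> exists2 n, P n & forall m, (m < n)%N -> ~ P m.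
Proof.
move=> exP; have exb : exists n, `[< P n >] by case: exP => n Pn; exists n; apply/asboolP.
case: (ex_minnP exb) => n /asboolP Pn nmin; exists n => // m mn Pm.
by have := nmin m (asboolT Pm); rewrite leqNgt mn.
Qed.

Section SideZero.
Variables (K : acField) (L : K -> Prop) (n : nat) (Q : {mpoly K[n]}) (a : K).
Variables (T : Type) (E0 E1 : T -> Prop) (cen : T -> K) (rad lev : T -> af_G K).
Hypotheses (dsL : diff_subring der L) (newt : newtonian L).
Hypotheses (LQ : coefs_in L Q) (La : L a).
Hypothesis E1_sub : forall e, E1 e -> E0 e.
Hypothesis E1_cofinal : forall e, E0 e -> exists2 e', E1 e' & rad e <= rad e'.
Hypothesis E1_neq0 : exists e, E1 e.
Hypothesis radE : forall e, E0 e -> vge (rad e) (a - cen e).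
Hypothesis levE : forall e, E0 e -> level false (rad e) (lev e) (shift (jet (cen e)) Q).
Hypothesis lev_sharp : forall e, E0 e ->
  ~ level true (rad e) (lev e) (shift (jet (cen e)) Q).
Hypothesis small : forall e, E0 e -> vgt (lev e) Q.@[jet a].
Hypothesis partials : forall e i, E1 e -> Q^`M(i) != 0 ->
  exists2 d, level false (rad e) d (shift (jet (cen e)) Q^`M(i)) &
    ~~ vgt d Q^`M(i).@[jet a].

(** Formulated for a single component, so that it applies to both sides. [E0] holds all centres,
    [E1] those where the partial derivatives are generic. The zero found at one centre of [E1] is
    close at every centre of [E1] by the last clause of [newton_zero], and by cofinality at all of
    [E0]. *)
Lemma side_zero : exists b, [/\ L b, Q.@[jet b] = 0 &
  forall e, E0 e -> vgt (rad e) (b - a)].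
Proof.
have sharp e : E1 e -> exists i, ~~ vgt (lev e - rad e) Q^`M(i).@[jet a].
  move=> E1e; have E0e := E1_sub E1e.
  apply: (level_linear_sharp (radE E0e) (levE E0e) (lev_sharp E0e) (small E0e)).
  by move=> i; apply: partials.
have [e E1e] := E1_neq0; have E0e := E1_sub E1e.
have [] := newton_zero dsL newt LQ La _ (small E0e) (sharp e E1e).
  exact: level_recenter (radE E0e) (levE E0e).
move=> b [Lb Qb close]; exists b; split => // e' E0e'.
have [e2 E1e2 le2] := E1_cofinal E0e'.
by apply: (vcmp_le le2); apply: close (sharp e2 E1e2) (small (E1_sub E1e2)).
Qed.

End SideZero.

(** * Adjoining one element to a partial isomorphism *)

Section Extension.
Variables (K1 K2 : acField).
Local Notation X := (K1 * K2)%type.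
Variables (Rr : af_k K1 * af_k K2 -> Prop) (Rv : af_G K1 * af_G K2 -> Prop).
Hypothesis iso : rv_iso Rr Rv.
Variable Rf : X -> Prop.
Hypothesis fiso : field_iso Rr Rv Rf.

Local Notation matched := (rv_match Rr Rv).
Local Notation dsR := (rf_ring fiso).

Lemma match_vcmp s d w : matched w -> Rv d -> vcmp s d.1 w.1 = vcmp s d.2 w.2.
Proof.
move=> mw Rd; rewrite /val_cmp -(rv_match0 iso mw).
case: eqVneq => //= w0; have Rw := rv_match_val mw w0.
by case: s; rewrite ?(rv_lt iso Rd Rw) ?(rv_le iso Rd Rw).
Qed.

Lemma level_pair s n (P : {mpoly X[n]}) g d : coefs_in Rf P -> Rv g -> Rv d ->
  level s g.1 d.1 (poly1 P) <-> level s g.2 d.2 (poly2 P).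
Proof.
move=> RP Rg Rd; have E m : vcmp s (d.1 - g.1 *+ mdeg m) (poly1 P)@_m =
    vcmp s (d.2 - g.2 *+ mdeg m) (poly2 P)@_m.
  rewrite poly1_coef poly2_coef.
  have Rdm : Rv (d - g *+ mdeg m) by apply: (rv_B iso Rd); apply: (rv_Mn iso).
  have := match_vcmp s (rf_match fiso (RP m)) Rdm.
  by rewrite /= fst_Mn snd_Mn.
by split=> l m; move: (l m); rewrite E.
Qed.

(** The Gauss valuation is a minimum over the support, so it is attained, and it lies in [Rv] as a
    combination of the radius and of the valuation of a coefficient from [Rf]. *)
Lemma exact_level n (P : {mpoly X[n]}) g : coefs_in Rf P -> P != 0 -> Rv g ->
  exists d, [/\ Rv d, level false g.1 d.1 (poly1 P) & ~ level true g.1 d.1 (poly1 P)].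
Proof.
move=> RP P0 Rg.
have [|m mP mmin] := @seq_argmin _ _ (fun m => af_v (P@_m).1 + g.1 *+ mdeg m) (msupp P).
  by rewrite msupp_eq0.
have nz m' : m' \in msupp P -> (P@_m').1 != 0.
  rewrite mcoeff_msupp; apply: contra => /eqP z.
  have := rv_match0 iso (rf_match fiso (RP m')); rewrite z eqxx => /esym /eqP z2.
  by rewrite [P@_m']pairE z z2.
exists ((af_v (P@_m).1, af_v (P@_m).2) + g *+ mdeg m); split.
- apply: (rv_D iso); last exact: (rv_Mn iso).
  exact: (rv_match_val (rf_match fiso (RP m)) (nz m mP)).
- move=> m'; rewrite poly1_coef; case: (boolP (m' \in msupp P)) => m'P; last first.
    by rewrite (memN_msupp_eq0 m'P); apply: vcmp0.
  rewrite vgeE ?nz // oag_leBlD /=.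
  by rewrite fst_Mn; apply: mmin.
move=> /(_ m); rewrite poly1_coef vgtE0 ?nz //=.
by rewrite fst_Mn addrK ltxx.
Qed.

Variables (w0 : X) (E0 : X -> Prop).
Hypothesis E0_sub : forall e, E0 e -> Rf e.
Hypothesis E0_neq0 : exists e, E0 e.
Hypothesis E0_match : forall e, E0 e -> matched (w0 - e) /\ (w0 - e).1 != 0.

Definition rad (e : X) := (af_v (w0 - e).1, af_v (w0 - e).2).

Lemma rad_in e : E0 e -> Rv (rad e).
Proof. by case/E0_match => mw nz; apply: (rv_match_val mw nz). Qed.

Lemma rad_graded e : E0 e -> graded Rr (rad e) (w0 - e).
Proof.
move=> E0e; have [mw _] := E0_match E0e.
by apply: (match_graded iso mw (rad_in E0e)); apply: vge_val.
Qed.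

(* [P] is generic at the centre [e] when its value at [w0] has the valuation
   predicted by the Gauss norm around [e]; then the leading term of that value
   is determined by the leading term of [w0 - e]. *)
Definition generic n (P : {mpoly X[n]}) (e : X) := exists d,
  [/\ Rv d, level false (rad e).1 d.1 (poly1 (shift (jetp e) P)) &
      ~~ vgt d.1 (P.@[jetp w0]).1].

Definition close (w : X) := forall e, E0 e ->
  vgt (rad e).1 (w - w0).1 /\ vgt (rad e).2 (w - w0).2.

Lemma close0 : close w0.
Proof. by move=> e _; rewrite subrr; split; apply: vcmp0. Qed.

Lemma coefs_in_shiftE n (P : {mpoly X[n]}) e :
  Rf e -> coefs_in Rf P -> coefs_in Rf (shift (jetp e) P).
Proof.
move=> Re RP; apply: (coefs_in_shift dsR) => // i; exact: (ds_iter dsR).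
Qed.

Lemma coefs_in_deriv n (P : {mpoly X[n]}) i : coefs_in Rf P -> coefs_in Rf P^`M(i).
Proof. by move=> RP m; rewrite mcoeff_deriv; apply: (ds_Mn dsR). Qed.

Lemma eval_shift_jetp n (P : {mpoly X[n]}) e w :
  (shift (jetp e) P).@[jetp (w - e)] = P.@[jetp w].
Proof.
rewrite shift_eval; apply: meval_eq => i; rewrite /jetp.
elim: (nat_of_ord i) => [|j IHj] /=; first by rewrite subrK.
by rewrite -derpD IHj.
Qed.

Lemma level_graded n (P : {mpoly X[n]}) e d : Rf e -> Rv (rad e) -> Rv d ->
  coefs_in Rf P -> level false (rad e).1 d.1 (poly1 (shift (jetp e) P)) ->
  forall m, graded Rr (d - rad e *+ mdeg m) (shift (jetp e) P)@_m.
Proof.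
move=> Re Rg Rd RP lP m; apply: (match_graded iso).
- by apply: (rf_match fiso); apply: coefs_in_shiftE.
- by apply: (rv_B iso Rd); apply: (rv_Mn iso).
have := lP m; rewrite poly1_coef /=.
by rewrite fst_Mn.
Qed.

Lemma close_graded e w : E0 e -> close w -> graded Rr (rad e) (w - e).
Proof.
move=> E0e /(_ e E0e) [c1 c2]; have [g1 g2 gr] := rad_graded E0e.
have -> : w - e = (w - w0) + (w0 - e) by rewrite addrA subrK.
have [h1 h2] := (vcmp_ge c1, vcmp_ge c2).
split; try exact: vcmpD.
have -> : (coef (rad e).1 ((w - w0) + (w0 - e)).1, coef (rad e).2 ((w - w0) + (w0 - e)).2)
   = (coef (rad e).1 (w0 - e).1, coef (rad e).2 (w0 - e).2).
  by congr pair; [rewrite (af_coefD h1 g1)|rewrite (af_coefD h2 g2)];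
     rewrite coef_lt // add0r.
by [].
Qed.

Lemma level_value n (P : {mpoly X[n]}) e d w : E0 e -> close w -> Rv d ->
  coefs_in Rf P -> level false (rad e).1 d.1 (poly1 (shift (jetp e) P)) ->
  graded Rr d P.@[jetp w].
Proof.
move=> E0e cw Rd RP lP; rewrite -(eval_shift_jetp P e w).
apply: (graded_eval iso (rad_in E0e) (close_graded E0e cw)).
by apply: level_graded => //; [apply: E0_sub | apply: rad_in].
Qed.

(** Passing from [w0] to a close [w] changes the value by more than the Gauss valuation, so a
    generic value keeps its leading term; on the two sides this term is computed from corresponding
    coefficients. *)
Lemma generic_match n (P : {mpoly X[n]}) e w : E0 e -> close w -> coefs_in Rf P ->
  generic P e -> (P.@[jetp w]).1 != 0 /\ matched P.@[jetp w].
Proof.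
move=> E0e cw RP [d [Rd lP ngt]].
apply: (graded_match iso Rd (level_value E0e cw Rd RP lP)).
apply: contra ngt => gt; have [g1 _ _] := rad_graded E0e; have [c1 _] := cw e E0e.
have lt : vgt d.1 ((poly1 P).@[jet w.1] - (poly1 P).@[jet w0.1]).
  by apply: level_eval_close g1 c1 _; rewrite shift1 in lP.
rewrite eval1 in gt; rewrite eval1.
by rewrite -(subKr ((poly1 P).@[jet w.1]) (poly1 P).@[_]); apply: vcmpB.
Qed.

(** Shrinking the disc can only raise the Gauss valuation, from [d] to some [d']; a valuation that
    does not exceed [d] does not exceed [d'] either. *)
Lemma generic_up n (P : {mpoly X[n]}) e e' : E0 e -> E0 e' -> coefs_in Rf P ->
  (rad e).1 <= (rad e').1 -> generic P e -> generic P e'.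
Proof.
move=> E0e E0e' RP le gP; have [P0 _] := generic_match E0e close0 RP gP.
case: gP => d [Rd lP ngt].
have Pn0 : shift (jetp e') P != 0.
  apply: contraNneq P0 => z; rewrite -(eval_shift_jetp P e' w0) z meval0 eqxx //.
have [|d' [Rd' ld' nd']] := exact_level _ Pn0 (rad_in E0e').
  by apply: coefs_in_shiftE => //; apply: E0_sub.
exists d'; split; [exact: Rd'|exact: ld'|].
suff : d.1 <= d'.1 by move=> dd'; apply: contra ngt; apply: vcmp_le.
rewrite leNgt; apply/negP => dd'; apply: nd' => m.
have {}lP : level false (rad e').1 d.1 (poly1 (shift (jetp e') P)).
  apply: (level_le le); rewrite shift1.
  apply: (@level_recenter _ _ _ _ _ e.1); last by rewrite -/(jet _) -shift1.
  have -> : e'.1 - e.1 = (w0 - e).1 - (w0 - e').1.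
    by rewrite /= opprB [RHS]addrC addrA subrK.
  by apply: vcmpB; [apply: vge_val|apply: vcmp_le le _; apply: vge_val].
by apply: vge_lt (lP m); rewrite oag_ltD2r.
Qed.

Lemma nongeneric_level n (P : {mpoly X[n]}) e : E0 e -> coefs_in Rf P -> P != 0 ->
  ~ generic P e -> exists d, [/\ Rv d,
    level false (rad e).1 d.1 (poly1 (shift (jetp e) P)),
    ~ level true (rad e).1 d.1 (poly1 (shift (jetp e) P)) &
    vgt d.1 (P.@[jetp w0]).1].
Proof.
move=> E0e RP P0 ngP.
have Pn0 : shift (jetp e) P != 0.
  apply: contraNneq P0 => z; rewrite -[P]shift0.
  have -> : shift (fun=> 0) P = shift (jetp (- e)) (shift (jetp e) P).
    rewrite shift_shift; apply: eq_shift => i; rewrite /jetp.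
    elim: (nat_of_ord i) => [|j IHj] /=; first by rewrite addNr.
    by rewrite -derpD -IHj /derp /= !der0.
  by rewrite z -mpolyC0 shiftC.
have [|d [Rd ld nd]] := exact_level _ Pn0 (rad_in E0e).
  by apply: coefs_in_shiftE => //; apply: E0_sub.
exists d; split; [exact: Rd|exact: ld|exact: nd|].
by apply/negPn/negP => ngt; apply: ngP; exists d.
Qed.

Definition supp_in n (R : nzRingType) (S : 'X_{1..n} -> Prop) (P : {mpoly R[n]}) :=
  forall m, P@_m != 0 -> S m.

(** Ritt's ranking of differential polynomials: order at most [r], and degree at most [d] in the
    derivative of order [r]. *)
Definition mon_le n (r d : nat) (m : 'X_{1..n}) :=
  forall i : 'I_n, ((r < i)%N -> m i = 0%N) /\ (i = r :> nat -> (m i <= d)%N).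

Lemma supp_inD n (R : nzRingType) S (P Q : {mpoly R[n]}) :
  supp_in S P -> supp_in S Q -> supp_in S (P + Q).
Proof.
move=> SP SQ m; rewrite mcoeffD; case: (eqVneq P@_m 0) => [->|/SP //].
by rewrite add0r => /SQ.
Qed.

Lemma supp_inN n (R : nzRingType) S (P : {mpoly R[n]}) :
  supp_in S P -> supp_in S (- P).
Proof. by move=> SP m; rewrite mcoeffN oppr_eq0 => /SP. Qed.

Lemma supp_in_sub n (R : nzRingType) (S S' : 'X_{1..n} -> Prop) (P : {mpoly R[n]}) :
  (forall m, S m -> S' m) -> supp_in S P -> supp_in S' P.
Proof. by move=> SS SP m /SP /SS. Qed.

Lemma supp_inM n (R : nzRingType) (S1 S2 S3 : 'X_{1..n} -> Prop) (P Q : {mpoly R[n]}) :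
  (forall m1 m2, S1 m1 -> S2 m2 -> S3 (m1 + m2)%MM) ->
  supp_in S1 P -> supp_in S2 Q -> supp_in S3 (P * Q).
Proof.
move=> SS SP SQ m; rewrite -mcoeff_msupp => /msuppM_le /allpairsP [[m1 m2] /=].
by rewrite !mcoeff_msupp => -[/SP H1 /SQ H2 ->]; apply: SS.
Qed.

Lemma supp_inCX n (R : nzRingType) (S : 'X_{1..n} -> Prop) (c : R) m :
  S m -> supp_in S (c *: 'X_[m]).
Proof.
move=> Sm m'; rewrite mcoeffZ mcoeffX; case: (eqVneq m m') => [<- //|_].
by rewrite mulr0 eqxx.
Qed.

Lemma mon_leD n r d1 d2 (m1 m2 : 'X_{1..n}) :
  mon_le r d1 m1 -> mon_le r d2 m2 -> mon_le r (d1 + d2) (m1 + m2).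
Proof.
move=> l1 l2 i; have [a1 b1] := l1 i; have [a2 b2] := l2 i.
rewrite mnmDE; split=> [ri|ir]; first by rewrite a1 // a2.
by rewrite leq_add ?b1 ?b2.
Qed.

Lemma mon_le_trans n r d1 d2 (m : 'X_{1..n}) :
  (d1 <= d2)%N -> mon_le r d1 m -> mon_le r d2 m.
Proof.
move=> dd l i; have [a b] := l i; split => // ir; exact: leq_trans (b ir) dd.
Qed.

Lemma pair_mulrn_eq0 (F1 F2 : diffFieldType) (x : F1 * F2) n :
  x *+ n.+1 = 0 -> x = 0.
Proof.
move=> E; have E1 : x.1 *+ n.+1 = 0 by rewrite -fst_Mn E.
have E2 : x.2 *+ n.+1 = 0 by rewrite -snd_Mn E.
rewrite [x]pairE; congr pair; apply/eqP.
  by move/eqP: E1; rewrite -mulr_natr mulf_eq0 (negPf (natr_neq0 _ _)) orbF.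
by move/eqP: E2; rewrite -mulr_natr mulf_eq0 (negPf (natr_neq0 _ _)) orbF.
Qed.

Lemma supp_deriv n (F1 F2 : diffFieldType) r d i (P : {mpoly (F1 * F2)%type[n]}) :
  supp_in (mon_le r d) P -> supp_in (mon_le r d) P^`M(i).
Proof.
move=> SP m; rewrite mcoeff_deriv => nz.
have {}nz : P@_(m + U_(i)) != 0 by apply: contraNneq nz => ->; rewrite mul0rn.
move=> j; have [a b] := SP _ nz j; rewrite mnmDE in a b; split=> [/a|/b].
  by move/eqP; rewrite addn_eq0 => /andP[/eqP].
by apply: leq_trans; apply: leq_addr.
Qed.

Lemma supp_deriv_main n (F1 F2 : diffFieldType) d (r : 'I_n) (P : {mpoly (F1 * F2)%type[n]}) :
  supp_in (mon_le r d.+1) P -> supp_in (mon_le r d) P^`M(r).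
Proof.
move=> SP m; rewrite mcoeff_deriv => nz.
have {}nz : P@_(m + U_(r)) != 0 by apply: contraNneq nz => ->; rewrite mul0rn.
move=> j; have [a b] := SP _ nz j; rewrite mnmDE in a b; split=> [/a|rj].
  by move/eqP; rewrite addn_eq0 => /andP[/eqP].
by move: (b rj); rewrite mnm1E -val_eqE /= rj eqxx addn1.
Qed.

Lemma msize_deriv n (R : nzRingType) i (P : {mpoly R[n]}) :
  P^`M(i) != 0 -> (msize P^`M(i) < msize P)%N.
Proof.
move=> nz; rewrite -(mlead_deg nz).
have := mlead_supp nz; rewrite mcoeff_msupp mcoeff_deriv => c0.
have : (mlead P^`M(i) + U_(i))%MM \in msupp P.
  by rewrite mcoeff_msupp; apply: contraNneq c0 => ->; rewrite mul0rn.
by move/msize_mdeg_lt; rewrite mdegD mdeg1 addn1.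
Qed.

(** Separates the initial [T] with respect to the variable [r] from the lower terms [S]; these are
    the data for pseudo-division. *)
Lemma split_top n (R : comNzRingType) (D : R -> R) (L : R -> Prop) (r : 'I_n) p
    (P : {mpoly R[n]}) : diff_subring D L -> coefs_in L P ->
  supp_in (mon_le r p.+1) P -> exists T S, [/\ P = T * 'X_r ^+ p.+1 + S,
    coefs_in L T, coefs_in L S, supp_in (mon_le r 0) T & supp_in (mon_le r p) S].
Proof.
move=> dsL LP SP.
have LCX m m' : coefs_in L (P@_m *: 'X_[m']).
  by rewrite -mul_mpolyC; apply: (coefs_inM dsL); [exact: (coefs_inC dsL)|exact: (coefs_inX dsL)].
pose T := \sum_(m <- msupp P | m r == p.+1) P@_m *: 'X_[m - U_(r) *+ p.+1].
pose S := \sum_(m <- msupp P | m r != p.+1) P@_m *: 'X_[m].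
have L0 : coefs_in L (0 : {mpoly R[n]}) by move=> m; rewrite mcoeff0; apply: (ds_0 dsL).
have S0 A : supp_in A (0 : {mpoly R[n]}) by move=> m; rewrite mcoeff0 eqxx.
exists T, S; split.
- rewrite [LHS]mpolyE (bigID (fun m : 'X_{1..n} => m r == p.+1)) /=; congr (_ + _).
  rewrite /T mulr_suml; apply: eq_bigr => m /eqP mr.
  rewrite -scalerAl mpolyXn -mpolyXD submK //; apply/mnm_lepP => i.
  by rewrite mulmnE mnm1E; case: eqP => [<-|_]; rewrite ?mul1n ?mr.
- by rewrite /T; apply: (big_ind (@coefs_in _ L n)) => // ? ?; apply: (coefs_inD dsL).
- by rewrite /S; apply: (big_ind (@coefs_in _ L n)) => // ? ?; apply: (coefs_inD dsL).
- rewrite /T big_seq_cond; apply: (big_ind (supp_in (mon_le r 0))) => //.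
    exact: supp_inD.
  move=> m /andP[]; rewrite mcoeff_msupp => /SP Sm /eqP mr; apply: supp_inCX => i.
  rewrite mnmBE mulmnE mnm1E; have [a _] := Sm i; split=> [/a -> //|ir].
  by have -> : i = r by [apply: val_inj]; rewrite eqxx mul1n mr subnn.
rewrite /S big_seq_cond; apply: (big_ind (supp_in (mon_le r p))) => //.
  exact: supp_inD.
move=> m /andP[]; rewrite mcoeff_msupp => /SP Sm mr; apply: supp_inCX => i.
have [a b] := Sm i; split => // ir; have := b ir.
by rewrite leq_eqVlt ltnS; have -> : i = r by [apply: val_inj]; rewrite (negPf mr).
Qed.

Definition is_generic n (P : {mpoly X[n]}) := exists2 e, E0 e & generic P e.

Lemma const_generic n (P : {mpoly X[n]}) : coefs_in Rf P -> P != 0 ->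
  supp_in (mon_le 0 0) P -> is_generic P.
Proof.
move=> RP P0 SP.
have EP : P = (P@_0)%:MP.
  apply/mpolyP => m; rewrite mcoeffC; case: (eqVneq m 0%MM) => [->|m0].
    by rewrite mulr1.
  rewrite mulr0; apply/eqP; rewrite -[_ == 0]negbK; apply: contra m0 => /SP Sm.
  apply/eqP/mnmP => i.
  rewrite mnm0E; have [a b] := Sm i; case: (posnP i) => [i0|/a //].
  by apply/eqP; rewrite -leqn0 b.
have mc := rf_match fiso (RP 0%MM).
move: (P@_0) EP mc => c EP mc; rewrite {}EP in P0 *.
have c0 : c.1 != 0.
  apply: contraNneq P0 => z; rewrite mpolyC_eq0 [c]pairE z.
  by have := rv_match0 iso mc; rewrite z eqxx => /esym /eqP ->.
have [e E0e] := E0_neq0; exists e => //.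
exists (af_v c.1, af_v c.2); split.
- exact: (rv_match_val mc c0).
- by rewrite shiftC /poly1 map_mpolyC; apply: levelC; apply: vge_val.
- by rewrite mevalC; apply: vgt_notge.
Qed.

(** Minimality in order and degree makes the initial, the separant and the remainders of
    pseudo-division generic when they are nonzero; minimality in size does so for the other partial
    derivatives, whose order and degree need not drop. *)
Lemma minimal_nongeneric :
  (exists n (P : {mpoly X[n]}), [/\ P != 0, coefs_in Rf P & ~ is_generic P]) ->
  exists n (r : 'I_n) d (G : {mpoly X[n]}),
    [/\ [/\ G != 0, coefs_in Rf G, ~ is_generic G, supp_in (mon_le r d.+1) G &
            ~ supp_in (mon_le r d) G],
      forall P : {mpoly X[n]}, P != 0 -> coefs_in Rf P -> supp_in (mon_le r d) P ->
        is_generic P &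
      forall P : {mpoly X[n]}, P != 0 -> coefs_in Rf P ->
        supp_in (mon_le r d.+1) P -> (msize P < msize G)%N -> is_generic P].
Proof.
move=> ex.
pose NG r d t := exists n (P : {mpoly X[n]}), [/\ P != 0, coefs_in Rf P,
  ~ is_generic P, supp_in (mon_le r d) P & (msize P <= t)%N].
have [r [d0 [t0 NG0]] rmin] : exists2 r, (exists d t, NG r d t) &
    forall r', (r' < r)%N -> ~ exists d t, NG r' d t.
  (* When [r] equals the number of variables, [mon_le] imposes no condition. *)
  apply: nat_minimal; case: ex => n [P [P0 RP nP]]; exists n, 0%N, (msize P), n, P.
  by split => // m _ i; rewrite ltnNge ltnW //=; split => // E; have := ltn_ord i; rewrite E ltnn.
have [d [t1 NG1] dmin] : exists2 d, (exists t, NG r d t) &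
    forall d', (d' < d)%N -> ~ exists t, NG r d' t.
  by apply: nat_minimal; exists d0, t0.
have [t NGt tmin] : exists2 t, NG r d t & forall t', (t' < t)%N -> ~ NG r d t'.
  by apply: nat_minimal; exists t1.
case: NGt => n [G [G0 RG nG SG Gt]].
case: d => [|d] in t1 NG1 dmin tmin SG *.
  case: r => [|r] in d0 t0 NG0 rmin NG1 dmin tmin SG *.
    by case: nG; apply: const_generic.
  (* Degree 0 in the derivative of order [r.+1] means order at most [r], so the minimal degree is
     positive. *)
  case: (rmin r (ltnSn r)); exists (msize G), (msize G), n, G; split => // m Gm i.
  have [a b] := SG m Gm i; split=> [|_].
    by rewrite leq_eqVlt => /orP[/eqP ri|/a //]; apply/eqP; rewrite -leqn0 b.
  apply: leq_trans (ltnW (msize_mdeg_lt _)); last by rewrite mcoeff_msupp; exact: Gm.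
  by rewrite mdegE (bigD1 i) //= leq_addr.
have nSG : ~ supp_in (mon_le r d) G.
  by move=> S'; case: (dmin d (ltnSn d)); exists t, n, G.
have rn : (r < n)%N.
  rewrite ltnNge; apply/negP => nr; apply: nSG => m /SG Sm i.
  have [a _] := Sm i; split => // E.
  by have := ltn_ord i; rewrite E ltnNge nr.
exists n, (Ordinal rn), d, G; split => // P P0 RP SP.
  apply/not_notP => nP; case: (dmin d (ltnSn d)); exists (msize P), n, P.
  by split.
move=> PG; apply/not_notP => nP; apply: (tmin (msize P)); first exact: leq_trans PG Gt.
by exists n, P; split.
Qed.

Section Values.
Variable w : X.

Definition mon_ord n (r : nat) (m : 'X_{1..n}) := forall i : 'I_n, (r < i)%N -> m i = 0%N.

(** Keeping the number [N] of variables apart from the order bound [r] leaves room for further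
    derivatives. *)
Definition value N r (x : X) := exists P : {mpoly X[N]},
  [/\ coefs_in Rf P, supp_in (mon_ord r) P & P.@[jetp w] = x].

Lemma valueC N r c : Rf c -> value N r c.
Proof.
move=> Rc; exists c%:MP; split; [exact: (coefs_inC dsR)| |exact: mevalC].
by move=> m; rewrite mcoeffC; case: (eqVneq m 0%MM) => [-> _ i _|_]; rewrite ?mnm0E // mulr0 eqxx.
Qed.

Lemma valueX N r i : (i <= r)%N -> (i < N)%N -> value N r (iter i (@derp _ _) w).
Proof.
move=> ir iN; exists 'X_(Ordinal iN); split; first exact: (coefs_inX dsR).
  move=> m; rewrite mcoeffX; case: (eqVneq _ m) => [<- _ j rj|_]; last by rewrite eqxx.
  rewrite mnm1E; case: eqP => // E; move: rj; rewrite -E /= ltnNge ir //.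
by rewrite mevalXU.
Qed.

Lemma valueB N r x y : value N r x -> value N r y -> value N r (x - y).
Proof.
move=> [P [RP SP <-]] [Q [RQ SQ <-]]; exists (P - Q); split; last exact: mevalB.
  by move=> m; rewrite mcoeffB; apply: (ds_B dsR).
by apply: supp_inD => //; apply: supp_inN.
Qed.

Lemma valueM N r x y : value N r x -> value N r y -> value N r (x * y).
Proof.
move=> [P [RP SP <-]] [Q [RQ SQ <-]]; exists (P * Q); split; last exact: mevalM.
  exact: (coefs_inM dsR).
by apply: supp_inM SP SQ => m1 m2 S1 S2 i ri; rewrite mnmDE S1 // S2.
Qed.

Lemma valueD N r x y : value N r x -> value N r y -> value N r (x + y).
Proof.
move=> vx vy; rewrite -[y]opprK; apply: valueB => //.
by rewrite -[- y]sub0r; apply: valueB => //; apply: valueC; apply: (ds_0 dsR).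
Qed.

Lemma value_sum N r (I : Type) (s : seq I) (A : pred I) (F : I -> X) :
  (forall i, A i -> value N r (F i)) -> value N r (\sum_(i <- s | A i) F i).
Proof.
move=> H; apply: big_ind => //; last exact: valueD.
by apply: valueC; apply: (ds_0 dsR).
Qed.

Lemma value_mono N r r' x : (r <= r')%N -> value N r x -> value N r' x.
Proof.
move=> rr [P [RP SP <-]]; exists P; split => //.
by apply: supp_in_sub SP => m Sm i ri; apply: Sm; apply: leq_ltn_trans ri.
Qed.

Lemma value_polyder N r (P : {mpoly X[N]}) : coefs_in Rf P -> supp_in (mon_ord r) P ->
  value N r (polyder P).@[jetp w].
Proof.
move=> RP SP; exists (polyder P); split => // m; rewrite polyder_coef.
  exact: (ds_der dsR).
by move=> nz; apply: SP; apply: contraNneq nz => ->; rewrite /derp /= !der0.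
Qed.

Lemma value_deriv N r i (P : {mpoly X[N]}) : coefs_in Rf P -> supp_in (mon_ord r) P ->
  value N r P^`M(i).@[jetp w].
Proof.
move=> RP SP; exists P^`M(i); split; [exact: coefs_in_deriv| |by []].
move=> m; rewrite mcoeff_deriv => nz j rj.
have {}nz : P@_(m + U_(i)) != 0 by apply: contraNneq nz => ->; rewrite mul0rn.
by have /eqP := SP _ nz j rj; rewrite mnmDE addn_eq0 => /andP[/eqP].
Qed.

Lemma deriv_free N r (i : 'I_N) (P : {mpoly X[N]}) : supp_in (mon_ord r) P ->
  (r < i)%N -> P^`M(i) = 0.
Proof.
move=> SP ri; apply/mpolyP => m; rewrite mcoeff_deriv mcoeff0.
case: (eqVneq P@_(m + U_(i)) 0) => [->|/SP /(_ i ri)]; first by rewrite mul0rn.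
by rewrite mnmDE mnm1E eqxx addn1.
Qed.

Definition ring_extension (T : X -> Prop) :=
  [/\ diff_subring (@derp _ _) T, forall x, Rf x -> T x, T w &
      forall x, T x -> matched x].

Lemma ring_extension_generic : close w ->
  (forall n (P : {mpoly X[n]}), P != 0 -> coefs_in Rf P -> is_generic P) ->
  exists T, ring_extension T.
Proof.
move=> cw gen.
(* Quantifying over all [N] above [r] lets two values share their number of variables and provides
   the extra variable that a derivative needs. *)
exists (fun x => exists r, forall N, (r < N)%N -> value N r x); split.
- split.
  + by exists 0%N => N _; apply: valueC; apply: (ds_1 dsR).
  + move=> x y [r1 H1] [r2 H2]; exists (maxn r1 r2) => N; rewrite gtn_max => /andP[N1 N2].
    by apply: valueB; [apply: value_mono (H1 N N1)|apply: value_mono (H2 N N2)];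
      rewrite ?leq_maxl ?leq_maxr.
  + move=> x y [r1 H1] [r2 H2]; exists (maxn r1 r2) => N; rewrite gtn_max => /andP[N1 N2].
    by apply: valueM; [apply: value_mono (H1 N N1)|apply: value_mono (H2 N N2)];
      rewrite ?leq_maxl ?leq_maxr.
  + move=> x [r H]; exists r.+1 => N rN; have [P [RP SP <-]] := H N (ltnW rN).
    rewrite derp_eval; apply: valueD.
      by apply: (value_mono (leqnSn r)); apply: value_polyder.
    apply: value_sum => i _; case: (leqP i r) => ir.
      apply: valueM; last by apply: valueX => //; apply: leq_ltn_trans rN.
      by apply: (value_mono (leqnSn r)); apply: value_deriv.
    by rewrite (deriv_free SP ir) meval0 mul0r; apply: valueC; apply: (ds_0 dsR).
- by move=> x Rx; exists 0%N => N _; apply: valueC.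
- by exists 0%N => N N0; apply: (@valueX N 0 0).
move=> x [r /(_ r.+1 (ltnSn r))] [P [RP _ <-]].
case: (eqVneq P 0) => [->|P0]; first by rewrite meval0; apply: (rv_match_0 iso).
by have [e E0e gP] := gen _ P P0 RP; case: (generic_match E0e cw RP gP).
Qed.

Section Algebraic.
Variables (n : nat) (r : 'I_n) (d : nat) (G : {mpoly X[n]}).
Hypotheses (RG : coefs_in Rf G) (SG : supp_in (mon_le r d.+1) G).
Hypothesis nSG : ~ supp_in (mon_le r d) G.
Hypothesis gen : forall P : {mpoly X[n]}, P != 0 -> coefs_in Rf P ->
  supp_in (mon_le r d) P -> is_generic P.
Hypothesis cw : close w.
Hypothesis Gw : G.@[jetp w] = 0.

(** The initial [U] of [G] is generic, so its value at [w] is nonzero and matched. Modulo [G], which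
    vanishes at [w], multiplication by [U] lowers the degree in the derivative of order [r] until it
    is at most [d], where all nonzero polynomials are generic. *)
Lemma value_match x : value n r x -> matched x.
Proof.
have main p (P : {mpoly X[n]}) : coefs_in Rf P -> supp_in (mon_le r p) P ->
    matched P.@[jetp w].
  elim/ltn_ind: p P => p IHp P RP SP.
  case: (eqVneq P 0) => [->|P0]; first by rewrite meval0; apply: (rv_match_0 iso).
  case: (leqP p d) => pd.
    have [|e E0e gP] := gen P0 RP _; last by case: (generic_match E0e cw RP gP).
    by apply: supp_in_sub SP => m; apply: mon_le_trans.
  case: p IHp SP pd => // p IHp SP pd.
  have [T [S [EP RT RS ST SS]]] := split_top dsR RP SP.
  have [U [V [EG RU RV SU SV]]] := split_top dsR RG SG.
  have U0 : U != 0.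
    apply/eqP => U0; apply: nSG; rewrite EG U0 mul0r add0r; exact: SV.
  have [|e E0e gU] := gen U0 RU _.
    by apply: supp_in_sub SU => m; apply: mon_le_trans.
  have [u0 mU] := generic_match E0e cw RU gU.
  (* One step of pseudo-division: the degrees are bounded by [p.+1] for [P] and [d.+1] for [G],
     whence the exponent [p - d]; the top terms cancel. *)
  pose Z := U * S - T * 'X_r ^+ (p - d) * V.
  have EZ : U * P - T * 'X_r ^+ (p - d) * G = Z.
    have -> : P = T * ('X_r ^+ (p - d) * 'X_r ^+ d.+1) + S.
      by rewrite -exprD addnS subnK.
    by rewrite /Z EG; ring.
  have XR : coefs_in Rf ('X_r ^+ (p - d) : {mpoly X[n]}).
    by rewrite mpolyXn; apply: (coefs_inX dsR).
  have XS : supp_in (mon_le r (p - d)) ('X_r ^+ (p - d) : {mpoly X[n]}).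
    rewrite mpolyXn -['X_[_]]scale1r; apply: supp_inCX => i.
    rewrite mulmnE mnm1E -val_eqE /=; split=> [|->]; last by rewrite eqxx mul1n.
    by rewrite ltn_neqAle => /andP[/negPf -> _].
  have mZ : matched Z.@[jetp w].
    apply: (IHp p) => //.
      move=> m; rewrite mcoeffB; apply: (ds_B dsR); apply: (coefs_inM dsR) => //.
      exact: (coefs_inM dsR).
    apply: supp_inD.
      by apply: supp_inM SU SS => m1 m2; rewrite -[X in mon_le _ X _]add0n; apply: mon_leD.
    apply: supp_inN; apply: (supp_inM (S1 := mon_le r (0 + (p - d))) _ _ SV).
      by move=> m1 m2 H1 H2; have dp : (d <= p)%N by []; rewrite -(subnK dp); apply: mon_leD.
    by apply: supp_inM ST XS => m1 m2; apply: mon_leD.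
  apply: (rv_match_div iso mZ mU u0); rewrite -EZ mevalB !mevalM Gw mulr0 subr0.
  by rewrite mulrC.
case=> P [RP SP <-]; apply: (main (msize P)) => // m Pm i; split; first exact: SP.
move=> _; apply: leq_trans (ltnW (msize_mdeg_lt _)); last by rewrite mcoeff_msupp; exact: Pm.
by rewrite mdegE (bigD1 i) //= leq_addr.
Qed.

(** [G] has exact degree [d.+1] in the derivative of order [r], so in characteristic 0 its separant
    is a nonzero polynomial of degree at most [d], hence generic. *)
Lemma separant_neq0 : (G^`M(r).@[jetp w]).1 != 0.
Proof.
have nz : G^`M(r) != 0.
  apply/eqP => z; apply: nSG => m Gm i; have [a b] := SG Gm i; split => // ir.
  have -> : i = r by apply: val_inj.
  case: (posnP (m r)) => [-> //|mr].
  have Er : (m - U_(r) + U_(r))%MM = m by rewrite submK // lep1mP -lt0n.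
  have := congr1 (mcoeff (m - U_(r))) z; rewrite mcoeff_deriv mcoeff0 Er.
  by move/pair_mulrn_eq0 => G0; rewrite G0 eqxx in Gm.
have [e E0e gS] := gen nz (coefs_in_deriv _ RG) (supp_deriv_main SG).
by case: (generic_match E0e cw (coefs_in_deriv r RG) gS).
Qed.

(** Fractions of values of order at most [r] already form a differential ring: differentiating the
    relation that [G] vanishes at [w] expresses the derivative of order [r.+1] as such a fraction,
    with the separant in the denominator. *)
Lemma ring_extension_algebraic : exists T, ring_extension T.
Proof.
(* The product ring is not a field, so a fraction is described by [x * q = p] with [q.1] nonzero;
   then [q.2] is nonzero as well because values match. *)
pose T x := exists p q, [/\ value n r p, value n r q, q.1 != 0 & x * q = p].
have val1 : value n r 1 by apply: valueC; apply: (ds_1 dsR).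
have valT x : value n r x -> T x.
  by move=> vx; exists x, 1; split => //; [exact: oner_neq0 | exact: mulr1].
have nz2 q : value n r q -> q.1 != 0 -> q.2 != 0.
  by move=> vq; rewrite (rv_match0 iso (value_match vq)).
have divT x q : value n r q -> q.1 != 0 -> T (x * q) -> T x.
  move=> vq q0 [p' [q' [vp' vq' q'0 E]]]; exists p', (q * q'); split => //.
  - exact: valueM.
  - exact: mulf_neq0.
  - by rewrite mulrA.
have TB x y : T x -> T y -> T (x - y).
  move=> [p [q [vp vq q0 E]]] [p' [q' [vp' vq' q'0 E']]].
  exists (p * q' - p' * q), (q * q'); split.
  - by apply: valueB; apply: valueM.
  - exact: valueM.
  - exact: mulf_neq0.
  - by rewrite -E -E' mulrBl mulrA [q * q']mulrC mulrA.
have TM x y : T x -> T y -> T (x * y).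
  move=> [p [q [vp vq q0 E]]] [p' [q' [vp' vq' q'0 E']]].
  exists (p * p'), (q * q'); split; [exact: valueM|exact: valueM|exact: mulf_neq0|].
  by rewrite -E -E' mulrACA.
have T0 : T 0 by apply: valT; apply: valueC; apply: (ds_0 dsR).
have TD x y : T x -> T y -> T (x + y).
  by move=> Tx Ty; rewrite -[y]opprK; apply: (TB) => //; rewrite -sub0r; apply: (TB).
have Tsum (s : seq 'I_n) (A : pred 'I_n) (F : 'I_n -> X) :
    (forall i, A i -> T (F i)) -> T (\sum_(i <- s | A i) F i).
  by move=> H; apply: big_ind.
have SGo : supp_in (mon_ord r) G.
  by apply: supp_in_sub SG => m Sm i ri; case: (Sm i) => a _; apply: a.
have Tlow (P : {mpoly X[n]}) i : coefs_in Rf P -> supp_in (mon_ord r) P -> i != r ->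
    T (P^`M(i).@[jetp w] * iter i.+1 (@derp _ _) w).
  move=> RP SP ir; case: (ltngtP i r) => [lt|gt|/val_inj E].
  - apply: TM; first by apply: valT; apply: value_deriv.
    by apply: valT; apply: valueX => //; apply: leq_ltn_trans (ltn_ord r).
  - by rewrite (deriv_free SP gt) meval0 mul0r.
  - by rewrite E eqxx in ir.
have Ttop : T (iter r.+1 (@derp _ _) w).
  apply: (divT _ G^`M(r).@[jetp w]).
  - exact: value_deriv.
  - exact: separant_neq0.
  have := derp_eval G w; rewrite Gw (bigD1 r) //=.
  have -> : derp 0 = 0 :> X by rewrite /derp !der0.
  rewrite addrCA => /esym /eqP; rewrite addr_eq0 mulrC => /eqP ->.
  rewrite -sub0r; apply: (TB) => //; apply: (TD); first by apply: valT; apply: value_polyder.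
  by apply: Tsum => i ir; apply: Tlow.
have Tder p : value n r p -> T (derp p).
  move=> [P [RP SP <-]]; rewrite derp_eval; apply: (TD).
    by apply: valT; apply: value_polyder.
  apply: Tsum => i _; case: (eqVneq i r) => [->|ir]; last exact: Tlow.
  by apply: (TM) => //; apply: valT; apply: value_deriv.
exists T; split.
- split => //; first exact: valT.
  move=> x [p [q [vp vq q0 E]]]; apply: (divT _ q) => //.
  have -> : derp x * q = derp p - x * derp q by rewrite -E derpM addrK.
  apply: TB; first exact: Tder.
  by apply: TM; [exists p, q|apply: Tder].
- by move=> x Rx; apply: valT; apply: valueC.
- by apply: valT; apply: (@valueX n r 0) => //; case: (n) r => [[]|].
by move=> x [p [q [vp vq q0 E]]]; apply: (rv_match_div iso (value_match vp) (value_match vq) q0 E).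
Qed.

End Algebraic.
End Values.

Section Existence.
Variables (L1 : K1 -> Prop) (L2 : K2 -> Prop).
Hypotheses (dsL1 : diff_subring der L1) (dsL2 : diff_subring der L2).
Hypotheses (newt1 : newtonian L1) (newt2 : newtonian L2).
Hypothesis RL1 : forall x, Rf x -> L1 x.1.
Hypothesis RL2 : forall x, Rf x -> L2 x.2.
Hypotheses (Lw1 : L1 w0.1) (Lw2 : L2 w0.2).

(** The radii are linearly ordered and genericity passes to smaller discs, so finitely many generic
    polynomials are generic at the smallest of their discs. *)
Lemma common_center n (G : {mpoly X[n]}) (s : seq 'I_n) e : E0 e -> coefs_in Rf G ->
  (forall i, G^`M(i) != 0 -> is_generic G^`M(i)) ->
  exists e', [/\ E0 e', (rad e).1 <= (rad e').1 &
    forall i, i \in s -> G^`M(i) != 0 -> generic G^`M(i) e'].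
Proof.
move=> E0e RG gen; elim: s => [|i s [e1 [E1 le1 g1]]]; first by exists e; rewrite lexx.
have Rd j := coefs_in_deriv j RG.
case: (eqVneq G^`M(i) 0) => [z|nz].
  exists e1; split => // j; rewrite inE => /orP[/eqP ->|/g1 //].
  by rewrite z eqxx.
have [e2 E2 g2] := gen i nz.
case: (leP (rad e1).1 (rad e2).1) => [le12|/ltW le21].
  exists e2; split; [exact: E2|exact: le_trans le1 le12|].
  move=> j; rewrite inE => /orP[/eqP -> //|js nzj].
  by apply: (generic_up E1 E2) (g1 j js nzj).
exists e1; split; [exact: E1|exact: le1|].
move=> j; rewrite inE => /orP[/eqP -> _|]; last exact: g1.
exact: (generic_up E2 E1) g2.
Qed.

(** The level of [G] at each centre is chosen as a pair in [Rv]. Facts about levels and valuations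
    are obtained in the first component and carried to the second by [level_pair], [rv_le] and
    [graded_vgt], so the two zeros lie close to [w0] in corresponding discs. *)
Lemma close_zero n (G : {mpoly X[n]}) : coefs_in Rf G -> G != 0 -> ~ is_generic G ->
  (forall i, G^`M(i) != 0 -> is_generic G^`M(i)) ->
  exists w, [/\ L1 w.1, L2 w.2, close w & G.@[jetp w] = 0].
Proof.
move=> RG G0 ngG gen.
have /choice [lev levP] e : exists d, E0 e -> [/\ Rv d,
    level false (rad e).1 d.1 (poly1 (shift (jetp e) G)),
    ~ level true (rad e).1 d.1 (poly1 (shift (jetp e) G)) &
    vgt d.1 (G.@[jetp w0]).1].
  case: (pselect (E0 e)) => E0e; last by exists 0.
  have [|d Hd] := nongeneric_level E0e RG G0; last by exists d.
  by move=> gG; apply: ngG; exists e.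
pose E1 e := E0 e /\ forall i, G^`M(i) != 0 -> generic G^`M(i) e.
have E1_ex e : E0 e -> exists2 e', E1 e' & (rad e).1 <= (rad e').1.
  move=> E0e; have [e' [E' le g]] := common_center (enum 'I_n) E0e RG gen.
  by exists e' => //; split => // i; apply: g; rewrite mem_enum.
have E1_neq0 : exists e, E1 e.
  by have [e E0e] := E0_neq0; have [e' E1e' _] := E1_ex e E0e; exists e'.
have E10 e : E1 e -> E0 e by case.
have Rsh e P : E0 e -> coefs_in Rf P -> coefs_in Rf (@shift n _ (jetp e) P).
  by move=> E0e; apply: coefs_in_shiftE; apply: E0_sub.
have Rd i := coefs_in_deriv i RG.
have [a [La Ga ca]] : exists b, [/\ L1 b, (poly1 G).@[jet b] = 0 &
    forall e, E0 e -> vgt (rad e).1 (b - w0.1)].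
  apply: (side_zero (cen := fst) (rad := fun e => (rad e).1)
    (lev := fun e => (lev e).1) dsL1 newt1 _ Lw1 E10 E1_ex E1_neq0).
  - by move=> m; rewrite poly1_coef; apply: RL1.
  - by move=> e E0e; apply: vge_val.
  - by move=> e E0e; rewrite -shift1; case: (levP e E0e).
  - by move=> e E0e; rewrite -shift1; case: (levP e E0e).
  - by move=> e E0e; rewrite -[_.@[_]]eval1; case: (levP e E0e).
  move=> e i [E0e ge]; rewrite -deriv1 => nz.
  have nz' : G^`M(i) != 0 by apply: contraNneq nz => ->; rewrite /poly1 rmorph0.
  have [d [Rvd ld nd]] := ge i nz'; exists d.1; first by rewrite -shift1.
  by rewrite -[_.@[_]]eval1.
have [b [Lb Gb cb]] : exists b, [/\ L2 b, (poly2 G).@[jet b] = 0 &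
    forall e, E0 e -> vgt (rad e).2 (b - w0.2)].
  apply: (side_zero (cen := snd) (rad := fun e => (rad e).2)
    (lev := fun e => (lev e).2) dsL2 newt2 _ Lw2 E10 _ E1_neq0).
  - by move=> m; rewrite poly2_coef; apply: RL2.
  - move=> e E0e; have [e' E1e' le] := E1_ex e E0e; exists e' => //.
    by rewrite -(rv_le iso (rad_in E0e) (rad_in (E10 _ E1e'))).
  - by move=> e E0e; apply: vge_val.
  - move=> e E0e; rewrite -shift2; have [Rvd l _ _] := levP e E0e.
    by apply/(level_pair _ (Rsh e G E0e RG) (rad_in E0e) Rvd).
  - move=> e E0e; rewrite -shift2; have [Rvd _ nl _] := levP e E0e => l2; apply: nl.
    by apply/(level_pair _ (Rsh e G E0e RG) (rad_in E0e) Rvd).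
  - move=> e E0e; rewrite -[_.@[_]]eval2; have [Rvd l _ gt] := levP e E0e.
    by rewrite -(graded_vgt iso (level_value E0e close0 Rvd RG l)).
  move=> e i [E0e ge]; rewrite -deriv2 => nz.
  have nz' : G^`M(i) != 0 by apply: contraNneq nz => ->; rewrite /poly2 rmorph0.
  have [d [Rvd ld nd]] := ge i nz'; exists d.2.
    by rewrite -shift2; apply/(level_pair _ (Rsh e _ E0e (Rd i)) (rad_in E0e) Rvd).
  rewrite -[_.@[_]]eval2.
  by rewrite -(graded_vgt iso (level_value E0e close0 Rvd (Rd i) ld)).
exists (a, b); split => //.
  by move=> e E0e; split; [apply: ca|apply: cb].
by rewrite [LHS]pairE eval1 eval2 /= Ga Gb.
Qed.

Lemma exists_ring_extension : exists w T,
  [/\ L1 w.1, L2 w.2, close w & ring_extension w T].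
Proof.
case: (pselect (forall n (P : {mpoly X[n]}), P != 0 -> coefs_in Rf P -> is_generic P)).
  move=> gen; have [T HT] := ring_extension_generic close0 gen; exists w0, T.
  by split => //; apply: close0.
move=> ngen; have [|n [r [d [G [[G0 RG nG SG nSG] gen1 gen2]]]]] := minimal_nongeneric.
  apply/not_notP => H; apply: ngen => n P P0 RP; apply/not_notP => nP.
  by apply: H; exists n, P.
have [|w [L1w L2w cw Gw]] := close_zero RG G0 nG.
  move=> i nz; apply: gen2 => //; [exact: coefs_in_deriv|exact: supp_deriv|exact: msize_deriv].
have [T HT] := ring_extension_algebraic RG SG nSG gen1 cw Gw.
by exists w, T.
Qed.

Lemma exists_field_extension : (forall x, L1 x -> L1 x^-1) -> exists Rf' w,
  [/\ field_iso Rr Rv Rf', forall x, Rf x -> Rf' x, forall x, Rf' x -> L1 x.1,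
      Rf' w & close w].
Proof.
move=> L1V; have [w [T [L1w L2w cw [dsT RT Tw mT]]]] := exists_ring_extension.
(* Fractions are restricted to first components in [L1], which keeps the extension inside the
   countable hull. *)
pose F x := L1 x.1 /\ exists p q, [/\ T p, T q, q.1 != 0 & x * q = p].
have T1 := ds_1 dsT.
have FT x : L1 x.1 -> T x -> F x.
  by move=> Lx Tx; split => //; exists x, 1; split => //; [exact: oner_neq0|exact: mulr1].
have mF x : F x -> matched x.
  by case=> _ [p [q [Tp Tq q0 E]]]; apply: (rv_match_div iso (mT p Tp) (mT q Tq) q0 E).
have nz2 q : T q -> q.1 != 0 -> q.2 != 0 by move=> /mT /(rv_match0 iso) ->.
exists F, w; split => //; last by apply: FT.
- split => //; first split.
  + by apply: FT => //; apply: (ds_1 dsL1).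
  + move=> x y [Lx [p [q [Tp Tq q0 E]]]] [Ly [p' [q' [Tp' Tq' q'0 E']]]].
    split; first exact: (ds_B dsL1 Lx Ly).
    exists (p * q' - p' * q), (q * q'); split.
    * by apply: (ds_B dsT); apply: (ds_M dsT).
    * exact: (ds_M dsT).
    * exact: mulf_neq0.
    * by rewrite -E -E' mulrBl mulrA [q * q']mulrC mulrA.
  + move=> x y [Lx [p [q [Tp Tq q0 E]]]] [Ly [p' [q' [Tp' Tq' q'0 E']]]].
    split; first exact: (ds_M dsL1 Lx Ly).
    exists (p * p'), (q * q'); split; try exact: (ds_M dsT); first exact: mulf_neq0.
    by rewrite -E -E' mulrACA.
  + move=> x [Lx [p [q [Tp Tq q0 E]]]]; split; first exact: (ds_der dsL1 Lx).
    exists (derp p * q - p * derp q), (q * q); split.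
    * by apply: (ds_B dsT); apply: (ds_M dsT) => //; apply: (ds_der dsT).
    * exact: (ds_M dsT).
    * exact: mulf_neq0.
    * by rewrite -E derpM; ring.
  + move=> x Fx; have mx := mF x Fx; case: Fx => Lx [p [q [Tp Tq q0 E]]].
    split; first exact: L1V.
    case: (eqVneq x.1 0) => [x0|x0].
      exists 0, 1; split => //; [exact: (ds_0 dsT)|exact: oner_neq0|].
      have := rv_match0 iso mx; rewrite x0 eqxx => /esym /eqP x2.
      by rewrite /invp x0 x2 !invr0 mulr1.
    have x2 : x.2 != 0 by rewrite -(rv_match0 iso mx).
    exists q, p; split => //; first by rewrite -E; apply: mulf_neq0.
    by rewrite -E [q]pairE; congr pair; rewrite /= mulKf.
- by move=> x Rx; apply: FT; [apply: RL1|apply: RT].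
- by move=> x [].
Qed.

End Existence.
End Extension.

(** * Countable hulls and the extension theorem *)

(** Encodes a polynomial by a list of monomials and a list of coefficients, so that solving an
    equation is an operation with finitely many arguments and only countably many shapes. *)
Definition poly_of n (K : comNzRingType) (ms : seq 'X_{1..n}) (cs : seq K) : {mpoly K[n]} :=
  \sum_(p <- zip ms cs) p.2 *: 'X_[p.1].

Lemma poly_ofK n (K : comNzRingType) (Q : {mpoly K[n]}) :
  poly_of (msupp Q) (map (fun m => Q@_m) (msupp Q)) = Q.
Proof.
rewrite [RHS]mpolyE /poly_of -[X in zip X _]map_id zip_map big_map.
by [].
Qed.

Record hull (K : acField) (Lf : K -> Prop) (Lr : af_k K -> Prop) (Lv : af_G K -> Prop) :
    Prop := {
  hull_f : diff_subring der Lf;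
  hull_fV : forall x, Lf x -> Lf x^-1;
  hull_newt : newtonian Lf;
  hull_r : diff_subring der Lr;
  hull_rV : forall x, Lr x -> Lr x^-1;
  hull_v0 : Lv 0;
  hull_vB : forall g h, Lv g -> Lv h -> Lv (g - h);
  hull_ac : forall x, Lf x -> Lr (af_ac x);
  hull_v : forall x, Lf x -> Lv (af_v x);
  hull_c : forall g, Lv g -> Lr (af_c g)
}.

Section Hull.
Variable K : acField.
Hypothesis newt : newtonian (fun _ : K => True).

Local Notation T := (K + (af_k K + af_G K))%type.

Definition get_f (x : T) : K := if x is inl a then a else 0.
Definition get_r (x : T) : af_k K := if x is inr (inl a) then a else 0.
Definition get_v (x : T) : af_G K := if x is inr (inr a) then a else 0.

Definition solve n (Q : {mpoly K[n]}) (g : af_G K) : K :=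
  if pselect (exists y, vge g y /\ Q.@[jet y] = 0) is left H
  then xget 0 [set y | vge g y /\ Q.@[jet y] = 0] else 0.

Lemma solveP n (Q : {mpoly K[n]}) g : (exists y, vge g y /\ Q.@[jet y] = 0) ->
  vge g (solve Q g) /\ Q.@[jet (solve Q g)] = 0.
Proof.
move=> ex; rewrite /solve; case: pselect => // -[y Hy].
by case: xgetP => [z -> //|/(_ y)].
Qed.

(** The three sorts share the type [T], and an argument of the wrong sort is read as 0. An index
    [inr] carries the monomials; its arguments are the radius followed by the coefficients. *)
Definition hull_op (i : nat + {n : nat & seq 'X_{1..n}}) (s : seq T) : T :=
  let x := nth (inl 0) s 0 in let y := nth (inl 0) s 1 in
  let f a : T := inl a in let r a : T := inr (inl a) in let v a : T := inr (inr a) in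
  match i with
  | inl 0 => f 1
  | inl 1 => f (get_f x - get_f y)
  | inl 2 => f (get_f x * get_f y)
  | inl 3 => f (der (get_f x))
  | inl 4 => f (get_f x)^-1
  | inl 5 => r (af_ac (get_f x))
  | inl 6 => v (af_v (get_f x))
  | inl 7 => r 1
  | inl 8 => r (get_r x - get_r y)
  | inl 9 => r (get_r x * get_r y)
  | inl 10 => r (der (get_r x))
  | inl 11 => r (get_r x)^-1
  | inl 12 => r (af_c (get_v x))
  | inl 13 => v 0
  | inl _ => v (get_v x - get_v y)
  | inr (existT n ms) => f (solve (poly_of ms (map get_f (behead s))) (get_v x))
  end.

Lemma countable_hull (seed : nat -> T) : exists Lf Lr Lv (er : nat -> af_k K)
  (ev : nat -> af_G K), [/\ hull Lf Lr Lv, forall x, Lr x <-> exists n, er n = x,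
    forall g, Lv g <-> exists n, ev n = g &
    forall n, match seed n with inl a => Lf a | inr (inl a) => Lr a | inr (inr g) => Lv g end].
Proof.
have [e [eseed eop]] := countable_closure hull_op seed.
pose Lf x := exists n, e n = inl x.
pose Lr x := exists n, e n = inr (inl x).
pose Lv x := exists n, e n = inr (inr x).
have op0 i : exists m, e m = hull_op (inl i) [::] by apply: eop (inl i) [::].
have op1 i n : exists m, e m = hull_op (inl i) [:: e n] by apply: eop (inl i) [:: n].
have op2 i n n' : exists m, e m = hull_op (inl i) [:: e n; e n'].
  exact: eop (inl i) [:: n; n'].
have f1 : Lf 1 by have [m Hm] := op0 0%N; exists m.
have fB x y : Lf x -> Lf y -> Lf (x - y).
  by move=> [n En] [n' En']; have [m] := op2 1%N n n'; rewrite En En' /= => Hm; exists m.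
have f0 : Lf 0 by rewrite -(subrr 1); apply: fB.
have fM x y : Lf x -> Lf y -> Lf (x * y).
  by move=> [n En] [n' En']; have [m] := op2 2%N n n'; rewrite En En' /= => Hm; exists m.
have fder x : Lf x -> Lf (der x).
  by move=> [n En]; have [m] := op1 3%N n; rewrite En /= => Hm; exists m.
have fV x : Lf x -> Lf x^-1.
  by move=> [n En]; have [m] := op1 4%N n; rewrite En /= => Hm; exists m.
have r1 : Lr 1 by have [m Hm] := op0 7%N; exists m.
have rB x y : Lr x -> Lr y -> Lr (x - y).
  by move=> [n En] [n' En']; have [m] := op2 8%N n n'; rewrite En En' /= => Hm; exists m.
have rM x y : Lr x -> Lr y -> Lr (x * y).
  by move=> [n En] [n' En']; have [m] := op2 9%N n n'; rewrite En En' /= => Hm; exists m.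
have rder x : Lr x -> Lr (der x).
  by move=> [n En]; have [m] := op1 10%N n; rewrite En /= => Hm; exists m.
have rV x : Lr x -> Lr x^-1.
  by move=> [n En]; have [m] := op1 11%N n; rewrite En /= => Hm; exists m.
have r0 : Lr 0 by rewrite -(subrr 1); apply: rB.
have v0 : Lv 0 by have [m Hm] := op0 13%N; exists m.
have vB x y : Lv x -> Lv y -> Lv (x - y).
  by move=> [n En] [n' En']; have [m] := op2 14%N n n'; rewrite En En' /= => Hm; exists m.
have fac x : Lf x -> Lr (af_ac x).
  by move=> [n En]; have [m] := op1 5%N n; rewrite En /= => Hm; exists m.
have fv x : Lf x -> Lv (af_v x).
  by move=> [n En]; have [m] := op1 6%N n; rewrite En /= => Hm; exists m.
have vc g : Lv g -> Lr (af_c g).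
  by move=> [n En]; have [m] := op1 12%N n; rewrite En /= => Hm; exists m.
have solveL n (Q : {mpoly K[n]}) g : coefs_in Lf Q -> Lv g -> Lf (solve Q g).
  move=> LQ [ng Eg]; have /choice [c Hc] := LQ.
  have [m] := eop (inr (existT _ n (msupp Q))) (ng :: map c (msupp Q)).
  have E ms : map get_f (map e (map c ms)) = map (fun m => Q@_m) ms.
    by elim: ms => //= m' ms ->; rewrite Hc.
  by rewrite /= Eg /= E poly_ofK => Hm; exists m.
have newtL : newtonian Lf.
  move=> n Q g d LQ c0 c1 [i ci] c2.
  case: (eqVneq Q@_0 0) => [z|nz].
    exists 0; split; [exact: f0|exact: vcmp0|].
    rewrite -[RHS]z -meval_at0; apply: meval_eq => j.
    by rewrite /jet; elim: (nat_of_ord j) => //= l ->; rewrite der0.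
  (* The radius [g] need not belong to the hull. It is replaced by the radius [g1], at least as
     large, which is the valuation of the constant coefficient minus that of a linear one and so
     does belong to it. *)
  rewrite vgeE // in c0; set e0 := af_v _ in c0.
  pose g1 := e0 - (d - g); have Dg1 : g1 = e0 - (d - g) by [].
  have gg1 : g <= g1 by rewrite oag_leBrD addrC subrK.
  have Eg1 : e0 - g1 = d - g by rewrite /g1 opprB addrC subrK.
  have [ni vi] := vgtP ci (c1 i).
  have Lg1 : Lv g1 by rewrite Dg1 -vi; apply: vB; apply: fv; apply: LQ.
  clearbody g1.
  have [|||||y [_ gy Qy]] := newt (n := n) (Q := Q) (g := g1) (d := e0).
  - by [].
  - exact: vge_val.
  - by rewrite Eg1.
  - by exists i; rewrite Eg1.
  - move=> m m1; apply: vcmp_le (c2 m m1); case: (mdeg m) m1 => [|[|k]] // _.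
    rewrite mulrS [g *+ _]mulrS !opprD !addrA Eg1.
    by apply: oag_leD2l; rewrite oag_leN2 oag_leMn2.
  have [|gs Qs] := @solveP n Q g1; first by exists y.
  exists (solve Q g1); split => //; first exact: solveL.
  exact: vcmp_le gs.
exists Lf, Lr, Lv, (fun n => get_r (e n)), (fun n => get_v (e n)); split.
- by split => //; split.
- move=> x; split=> [[n En]|[n <-]]; first by exists n; rewrite En.
  by case E: (e n) => [a|[a|g]] /=; [exact: r0|exists n|exact: r0].
- move=> x; split=> [[n En]|[n <-]]; first by exists n; rewrite En.
  by case E: (e n) => [a|[a|g]] /=; [exact: v0|exact: v0|exists n].
move=> n; have [m Em] := eseed n.
by case E: (seed n) => [a|[a|g]]; exists m; rewrite Em E.
Qed.

End Hull.

Definition LrvS (K : acField) : structure Lrv := Lrv_structure (@af_c K).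

Section Elementary.
Variables (K1 K2 : acField).
Implicit Types (Rr : af_k K1 * af_k K2 -> Prop) (Rv : af_G K1 * af_G K2 -> Prop).

Definition elementary Rr Rv := forall (p : formula Lrv)
  (e1 : assignment (LrvS K1)) (e2 : assignment (LrvS K2)),
  (forall n, Rr (e1 rv_r n, e2 rv_r n)) -> (forall n, Rv (e1 rv_v n, e2 rv_v n)) ->
  (sat p e1 <-> sat p e2).

Record good Rf Rr Rv : Prop := {
  good_rv : rv_iso Rr Rv;
  good_el : elementary Rr Rv;
  good_f : field_iso Rr Rv Rf
}.

Variables (e1 : assignment (LrvS K1)) (e2 : assignment (LrvS K2)).
Hypothesis EE : forall p, sat p e1 <-> sat p e2.

Definition range_r (x : af_k K1 * af_k K2) := exists n, x = (e1 rv_r n, e2 rv_r n).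
Definition range_v (x : af_G K1 * af_G K2) := exists n, x = (e1 rv_v n, e2 rv_v n).

(** Assignments with values in the ranges are reindexings of [e1] and [e2] by one common, possibly
    non-injective, renaming of variables. *)
Lemma elementary_range : elementary range_r range_v.
Proof.
move=> p f1 f2 /choice [a Ha] /choice [b Hb].
pose r (s : Lrv_sort) n := match s with rv_r => a n | rv_v => b n end.
have [q Hq] := @formula_rename Lrv p r.
have E1 : sat q e1 <-> sat p f1.
  rewrite Hq; apply: sat_agree => -[] n; rewrite /r.
    by have [-> _] := Ha n.
  by have [-> _] := Hb n.
have E2 : sat q e2 <-> sat p f2.
  rewrite Hq; apply: sat_agree => -[] n; rewrite /r.
    by have [_ ->] := Ha n.
  by have [_ ->] := Hb n.
by rewrite -E1 -E2.
Qed.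

Local Notation VR n := (@Var Lrv rv_r n).
Local Notation VV n := (@Var Lrv rv_v n).

Lemma EE_r (t u : @term Lrv rv_r) :
  eval (M := LrvS K1) e1 t = eval e1 u <-> eval (M := LrvS K2) e2 t = eval e2 u.
Proof. exact: EE (FEq t u). Qed.

Lemma EE_v (t u : @term Lrv rv_v) :
  eval (M := LrvS K1) e1 t = eval e1 u <-> eval (M := LrvS K2) e2 t = eval e2 u.
Proof. exact: EE (FEq t u). Qed.

Definition zero_r : @term Lrv rv_r := @App Lrv (rv_ring D0) (fun _ => VR 0).
Definition one_r : @term Lrv rv_r := @App Lrv (rv_ring D1) (fun _ => VR 0).
Definition sub_r (t u : @term Lrv rv_r) : @term Lrv rv_r :=
  @App Lrv (rv_ring Dadd) (fun i : 'I_2 => if i == ord0 then t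
    else @App Lrv (rv_ring Dopp) (fun _ => u)).
Definition mul_r (t u : @term Lrv rv_r) : @term Lrv rv_r :=
  @App Lrv (rv_ring Dmul) (fun i : 'I_2 => if i == ord0 then t else u).
Definition der_r (t : @term Lrv rv_r) : @term Lrv rv_r :=
  @App Lrv (rv_ring Dder) (fun _ => t).
Definition zero_v : @term Lrv rv_v := @App Lrv (rv_group G0) (fun _ => VV 0).
Definition sub_v (t u : @term Lrv rv_v) : @term Lrv rv_v :=
  @App Lrv (rv_group Gadd) (fun i : 'I_2 => if i == ord0 then t
    else @App Lrv (rv_group Gopp) (fun _ => u)).
Definition c_v (t : @term Lrv rv_v) : @term Lrv rv_r := @App Lrv rv_c (fun _ => t).

Variables (Lr : af_k K1 -> Prop) (Lv : af_G K1 -> Prop).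
Hypothesis LrE : forall x, Lr x <-> exists n, e1 rv_r n = x.
Hypothesis LvE : forall x, Lv x <-> exists n, e1 rv_v n = x.
Hypothesis dsLr : diff_subring der Lr.
Hypothesis LrV : forall x, Lr x -> Lr x^-1.
Hypothesis Lv0 : Lv 0.
Hypothesis LvB : forall g h, Lv g -> Lv h -> Lv (g - h).
Hypothesis Lc : forall g, Lv g -> Lr (af_c g).

Lemma range_r_dom x : Lr x -> exists y, range_r (x, y).
Proof. by move=> /LrE [n <-]; exists (e2 rv_r n), n. Qed.

Lemma range_v_dom x : Lv x -> exists y, range_v (x, y).
Proof. by move=> /LvE [n <-]; exists (e2 rv_v n), n. Qed.

(** When the value of a term is itself listed by a variable, the equation between the term and that
    variable transfers to the other side; this yields the closure properties of the range. *)
Lemma range_rT (t : @term Lrv rv_r) : Lr (eval (M := LrvS K1) e1 t) ->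
  range_r (eval (M := LrvS K1) e1 t, eval (M := LrvS K2) e2 t).
Proof.
move=> /LrE [n Hn]; exists n; congr pair; first by rewrite Hn.
by apply/(EE_r t (VR n)).
Qed.

Lemma range_vT (t : @term Lrv rv_v) : Lv (eval (M := LrvS K1) e1 t) ->
  range_v (eval (M := LrvS K1) e1 t, eval (M := LrvS K2) e2 t).
Proof.
move=> /LvE [n Hn]; exists n; congr pair; first by rewrite Hn.
by apply/(EE_v t (VV n)).
Qed.

Lemma rv_iso_range : rv_iso range_r range_v.
Proof.
have Lrn n : Lr (e1 rv_r n) by apply/LrE; exists n.
have Lvn n : Lv (e1 rv_v n) by apply/LvE; exists n.
have eq0 x : range_r x -> (x.1 == 0) = (x.2 == 0).
  move=> [n ->] /=; have := EE_r (VR n) zero_r => /= H.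
  by apply/eqP/eqP => /H.
split => //.
- split.
  + exact: (range_rT (t := one_r) (ds_1 dsLr)).
  + move=> x y [n ->] [m ->].
    exact: (range_rT (t := sub_r (VR n) (VR m)) (ds_B dsLr (Lrn n) (Lrn m))).
  + move=> x y [n ->] [m ->].
    exact: (range_rT (t := mul_r (VR n) (VR m)) (ds_M dsLr (Lrn n) (Lrn m))).
  + move=> x [n ->].
    exact: (range_rT (t := der_r (VR n)) (ds_der dsLr (Lrn n))).
- move=> x [n En]; have E0 : (x.1 == 0) = (x.2 == 0) by apply: eq0; exists n.
  case: (eqVneq x.1 0) => [x0|x0].
    move: E0; rewrite x0 eqxx => /esym /eqP x2; rewrite /invp x0 x2 !invr0.
    by exists n; rewrite -En [RHS]pairE x0 x2.
  have x20 : x.2 != 0 by rewrite -E0.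
  have /LrE [m Hm] : Lr x.1^-1 by apply: LrV; rewrite En; apply: Lrn.
  exists m; rewrite /invp Hm; congr pair.
  (* The language has no symbol for the inverse, which is characterized by a product equal to 1. *)
  have : e2 rv_r n * e2 rv_r m = 1.
    apply/(EE_r (mul_r (VR n) (VR m)) one_r) => /=.
    by rewrite /field_interp /= /arg2_1 /arg2_2 /= Hm En /= divff //; rewrite En in x0.
  rewrite En /= in x20 *; move=> H; apply: (mulfI x20).
  by rewrite H divff.
- exact: (range_vT (t := zero_v) Lv0).
- move=> g h [n ->] [m ->].
  exact: (range_vT (t := sub_v (VV n) (VV m)) (LvB (Lvn n) (Lvn m))).
- move=> g h [n ->] [m ->] /=.
  have := EE (@FRel Lrv Le (fun i : 'I_2 => if i == ord0 then VV n else VV m)).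
  rewrite /= /arg2_1 /arg2_2 /= => H.
  by apply/idP/idP => /H.
- move=> g [n ->].
  exact: (range_rT (t := c_v (VV n)) (Lc (Lvn n))).
Qed.

End Elementary.

(** Source of pseudo-limits on the second side. Countably many discs suffice there because they are
    indexed by the values of a countable hull. *)
Definition ball_saturated (K : acField) := forall (y : nat -> K) (g : nat -> af_G K),
  (forall N, exists x, forall j, (j <= N)%N -> vge (g j) (x - y j)) ->
  exists x, forall j, vge (g j) (x - y j).

(** Countable saturation with parameters and new elements listed by assignments: even variables
    carry the old data, odd variables the new. *)
Definition rv_saturated (K : acField) := forall (N : structure Lrv)
  (e1 e1' : assignment N) (e2 : assignment (LrvS K)),
  (forall p, sat p e1 <-> sat p e2) -> exists e2' : assignment (LrvS K),
    (forall s n, e2' s n.*2 = e2 s n) /\ (forall p, sat p (merge e1 e1') <-> sat p e2').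

Section ExtendGood.
Variables (K1 K2 : acField).
Local Notation X := (K1 * K2)%type.
Local Notation Y := (af_k K1 * af_k K2)%type.
Local Notation Z := (af_G K1 * af_G K2)%type.
Local Notation T := (X + (Y + Z))%type.

Definition pair_op (i : nat) (s : seq T) : T :=
  let x := nth (inl 0) s 0 in let y := nth (inl 0) s 1 in
  let gf (x : T) : X := if x is inl a then a else 0 in
  let gr (x : T) : Y := if x is inr (inl a) then a else 0 in
  let gv (x : T) : Z := if x is inr (inr a) then a else 0 in
  let f a : T := inl a in let r a : T := inr (inl a) in let v a : T := inr (inr a) in
  match i with
  | 0 => f 1
  | 1 => f (gf x - gf y)
  | 2 => f (gf x * gf y)
  | 3 => f (derp (gf x))
  | 4 => f (invp (gf x))
  | 5 => r (af_ac (gf x).1, af_ac (gf x).2)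
  | 6 => if (gf x).1 == 0 then v 0 else v (af_v (gf x).1, af_v (gf x).2)
  | 7 => r 1
  | 8 => r (gr x - gr y)
  | 9 => r (gr x * gr y)
  | 10 => r (derp (gr x))
  | 11 => r (invp (gr x))
  | 12 => r (af_c (gv x).1, af_c (gv x).2)
  | 13 => v 0
  | _ => v (gv x - gv y)
  end.

(** A Loewenheim-Skolem argument for partial isomorphisms: only the values of the variables under
    two given assignments have to be kept, and these are countably many. *)
Lemma countable_good Rf Rr Rv (sf : nat -> X) (sr : nat -> Y) (sv : nat -> Z) :
  good Rf Rr Rv -> (forall n, Rf (sf n)) -> (forall n, Rr (sr n)) ->
  (forall n, Rv (sv n)) ->
  exists Rf' Rr' Rv' (ef : nat -> X) (er : nat -> Y) (ev : nat -> Z),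
    [/\ good Rf' Rr' Rv', forall x, Rf' x <-> exists n, ef n = x,
      forall x, Rr' x <-> exists n, er n = x, forall x, Rv' x <-> exists n, ev n = x &
      [/\ forall n, Rf' (sf n), forall n, Rr' (sr n) & forall n, Rv' (sv n)]].
Proof.
move=> [iso el fiso] Sf Sr Sv.
have dsf := rf_ring fiso; have dsr := rr_ring iso.
pose P (x : T) := match x with inl a => Rf a | inr (inl a) => Rr a | inr (inr g) => Rv g end.
pose seed n : T := match odflt (0, 0)%N (unpickle n) with
  (0, m) => inl (sf m) | (1, m) => inr (inl (sr m)) | (_, m) => inr (inr (sv m)) end.
have [||e [Pe eseed eop]] := @countable_closure_in T nat pair_op seed P.
- by move=> n; rewrite /seed; case: (odflt _ _) => -[|[|?]] m /=.
- move=> i s Ps.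
  have Pnth j : P (nth (inl 0) s j).
    elim: s j Ps => [|x s IH] [|j] //= []; rewrite ?nth_nil; try exact: (ds_0 dsf).
    + by [].
    + by move=> _ /IH.
  have P0 := Pnth 0%N; have P1 := Pnth 1%N; rewrite /pair_op.
  move: (nth _ s 0) (nth _ s 1) P0 P1 => x y Px Py.
  set gf := fun z : T => match z with inl a => a | inr _ => 0 end.
  set gr := fun z : T => match z with inr (inl a) => a | _ => 0 end.
  set gv := fun z : T => match z with inr (inr a) => a | _ => 0 end.
  have Pf z : P z -> Rf (gf z) by case: z => [a|b] //= _; apply: (ds_0 dsf).
  have Pr z : P z -> Rr (gr z) by case: z => [a|[b|g]] //= _; apply: (ds_0 dsr).
  have Pv z : P z -> Rv (gv z) by case: z => [a|[b|g]] //= _; apply: (rv_0 iso).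
  have [Px1 Py1] := (Pf x Px, Pf y Py); have [Px2 Py2] := (Pr x Px, Pr y Py).
  have [Px3 Py3] := (Pv x Px, Pv y Py).
  case: i => [|[|[|[|[|[|[|[|[|[|[|[|[|[|i]]]]]]]]]]]]]] /=.
  + exact: (ds_1 dsf).
  + exact: (ds_B dsf).
  + exact: (ds_M dsf).
  + exact: (ds_der dsf).
  + exact: (rf_inv fiso).
  + by case: (rf_match fiso Px1).
  + case: eqP => [_|/eqP nz] /=; first exact: (rv_0 iso).
    exact: (rv_match_val (rf_match fiso Px1) nz).
  + exact: (ds_1 dsr).
  + exact: (ds_B dsr).
  + exact: (ds_M dsr).
  + exact: (ds_der dsr).
  + exact: (rr_inv iso).
  + exact: (rv_cmap iso).
  + exact: (rv_0 iso).
  + exact: (rv_B iso).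
pose Lf x := exists n, e n = inl x.
pose Lr x := exists n, e n = inr (inl x).
pose Lv x := exists n, e n = inr (inr x).
have Lf_sub x : Lf x -> Rf x by move=> [n En]; have := Pe n; rewrite En.
have Lr_sub x : Lr x -> Rr x by move=> [n En]; have := Pe n; rewrite En.
have Lv_sub x : Lv x -> Rv x by move=> [n En]; have := Pe n; rewrite En.
have op0 i : exists m, e m = pair_op i [::] by apply: eop i [::].
have op1 i n : exists m, e m = pair_op i [:: e n] by apply: eop i [:: n].
have op2 i n n' : exists m, e m = pair_op i [:: e n; e n'] by exact: eop i [:: n; n'].
have f1 : Lf 1 by have [m Hm] := op0 0%N; exists m.
have fB x y : Lf x -> Lf y -> Lf (x - y).
  by move=> [n En] [n' En']; have [m] := op2 1%N n n'; rewrite En En' /= => Hm; exists m.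
have f0 : Lf 0 by rewrite -(subrr 1); apply: fB.
have fM x y : Lf x -> Lf y -> Lf (x * y).
  by move=> [n En] [n' En']; have [m] := op2 2%N n n'; rewrite En En' /= => Hm; exists m.
have fder x : Lf x -> Lf (derp x).
  by move=> [n En]; have [m] := op1 3%N n; rewrite En /= => Hm; exists m.
have fV x : Lf x -> Lf (invp x).
  by move=> [n En]; have [m] := op1 4%N n; rewrite En /= => Hm; exists m.
have r1 : Lr 1 by have [m Hm] := op0 7%N; exists m.
have rB x y : Lr x -> Lr y -> Lr (x - y).
  by move=> [n En] [n' En']; have [m] := op2 8%N n n'; rewrite En En' /= => Hm; exists m.
have rM x y : Lr x -> Lr y -> Lr (x * y).
  by move=> [n En] [n' En']; have [m] := op2 9%N n n'; rewrite En En' /= => Hm; exists m.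
have rder x : Lr x -> Lr (derp x).
  by move=> [n En]; have [m] := op1 10%N n; rewrite En /= => Hm; exists m.
have rV x : Lr x -> Lr (invp x).
  by move=> [n En]; have [m] := op1 11%N n; rewrite En /= => Hm; exists m.
have r0 : Lr 0 by rewrite -(subrr 1); apply: rB.
have v0 : Lv 0 by have [m Hm] := op0 13%N; exists m.
have vB x y : Lv x -> Lv y -> Lv (x - y).
  by move=> [n En] [n' En']; have [m] := op2 14%N n n'; rewrite En En' /= => Hm; exists m.
have fac x : Lf x -> Lr (af_ac x.1, af_ac x.2).
  by move=> [n En]; have [m] := op1 5%N n; rewrite En /= => Hm; exists m.
have fv x : Lf x -> x.1 != 0 -> Lv (af_v x.1, af_v x.2).
  move=> [n En] /negPf nz; have [m] := op1 6%N n.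
  by rewrite En /= nz => Hm; exists m.
have vc g : Lv g -> Lr (af_c g.1, af_c g.2).
  by move=> [n En]; have [m] := op1 12%N n; rewrite En /= => Hm; exists m.
exists Lf, Lr, Lv, (fun n => if e n is inl a then a else 0),
  (fun n => if e n is inr (inl a) then a else 0),
  (fun n => if e n is inr (inr a) then a else 0); split.
- split.
  + split => //.
    * by move=> x /Lr_sub; apply: (rr_eq0 iso).
    * by move=> g h /Lv_sub Rg /Lv_sub Rh; apply: (rv_le iso).
  + move=> p e1 e2 H1 H2; apply: el => n; [exact: Lr_sub|exact: Lv_sub].
  + by split => // x Lx; split; [apply: fac|apply: fv].
- move=> x; split=> [[n En]|[n <-]]; first by exists n; rewrite En.
  by case E: (e n) => [a|b]; [exists n|exact: f0].
- move=> x; split=> [[n En]|[n <-]]; first by exists n; rewrite En.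
  by case E: (e n) => [a|[a|g]] /=; [exact: r0|exists n|exact: r0].
- move=> x; split=> [[n En]|[n <-]]; first by exists n; rewrite En.
  by case E: (e n) => [a|[a|g]] /=; [exact: v0|exact: v0|exists n].
split=> n.
- have [m Hm] := eseed (pickle (0, n)%N); exists m; rewrite Hm /seed pickleK //.
- have [m Hm] := eseed (pickle (1, n)%N); exists m; rewrite Hm /seed pickleK //.
- have [m Hm] := eseed (pickle (2, n)%N); exists m; rewrite Hm /seed pickleK //.
Qed.

Lemma good_swap Rf Rr Rv : @good K1 K2 Rf Rr Rv ->
  good (fun x : K2 * K1 => Rf (x.2, x.1)) (fun x => Rr (x.2, x.1)) (fun x => Rv (x.2, x.1)).
Proof.
move=> [iso el fiso]; have dsf := rf_ring fiso; have dsr := rr_ring iso.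
split.
- split.
  + split; first exact: (ds_1 dsr).
    * by move=> x y Rx Ry; apply: (ds_B dsr Rx Ry).
    * by move=> x y Rx Ry; apply: (ds_M dsr Rx Ry).
    * by move=> x Rx; apply: (ds_der dsr Rx).
  + by move=> x Rx; apply: (rr_inv iso Rx).
  + by move=> x /(rr_eq0 iso).
  + exact: (rv_0 iso).
  + by move=> g h Rg Rh; apply: (rv_B iso Rg Rh).
  + by move=> g h Rg Rh; rewrite -(rv_le iso Rg Rh).
  + by move=> g Rg; apply: (rv_cmap iso Rg).
- move=> p e1 e2 H1 H2; apply: iff_sym; exact: el.
- split.
  + split; first exact: (ds_1 dsf).
    * by move=> x y Rx Ry; apply: (ds_B dsf Rx Ry).
    * by move=> x y Rx Ry; apply: (ds_M dsf Rx Ry).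
    * by move=> x Rx; apply: (ds_der dsf Rx).
  + by move=> x Rx; apply: (rf_inv fiso Rx).
  + move=> x Rx; have m := rf_match fiso Rx; have E := rv_match0 iso m.
    case: m => m1 m2; split => // nz; apply: m2.
    by rewrite E.
Qed.

End ExtendGood.

(** * Extending a good system by a field element *)

Section ExtensionTheorem.
Variables (K1 K2 : acField).
Local Notation X := (K1 * K2)%type.
Hypothesis newt1 : newtonian (fun _ : K1 => True).
Hypothesis newt2 : newtonian (fun _ : K2 => True).
Hypothesis ball2 : ball_saturated K2.
Hypothesis rvsat2 : rv_saturated K2.

Lemma dsT (K : acField) : diff_subring der (fun _ : K => True).
Proof. by []. Qed.

Section Inside.
Variables (Rr : af_k K1 * af_k K2 -> Prop) (Rv : af_G K1 * af_G K2 -> Prop).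
Hypothesis iso : rv_iso Rr Rv.
Variables (Lf : K1 -> Prop) (Lr : af_k K1 -> Prop) (Lv : af_G K1 -> Prop).
Hypothesis hullL : hull Lf Lr Lv.
Variable ev : nat -> af_G K1.
Hypothesis evE : forall g, Lv g <-> exists n, ev n = g.
Hypothesis Lr_dom : forall x, Lr x -> exists y, Rr (x, y).
Hypothesis Lv_dom : forall x, Lv x -> exists y, Rv (x, y).

Local Notation inL F := (forall x : X, F x -> Lf x.1).

(** The leading term of [a] is new: any element with the corresponding coefficient and value is
    taken on the second side. With 0 as the only centre, the resulting pair has the leading term of
    [a] and thus lies outside [F]. *)
Lemma lead_neq0 (F : X -> Prop) : field_iso Rr Rv F -> inL F ->
  forall a, Lf a -> a != 0 ->
  ~ (exists2 w, F w & [/\ w.1 != 0, af_ac w.1 = af_ac a & af_v w.1 = af_v a]) ->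
  exists F', [/\ field_iso Rr Rv F', forall x, F x -> F' x, inL F' & exists2 w, F' w & ~ F w].
Proof.
move=> fiso FL a La a0 na; have dsF := rf_ring fiso.
have [d2 Rd2] := Lr_dom (hull_ac hullL La).
have [g2 Rg2] := Lv_dom (hull_v hullL La).
have d20 : d2 != 0 by have /= <- := rr_eq0 iso Rd2; rewrite af_ac_eq0.
have [b [b0 vb acb]] := af_surj g2 d20.
have mab : rv_match Rr Rv (a, b) by split => [|_] /=; rewrite ?acb ?vb.
have [||||F' [w [fiso' FF' F'L F'w cw]]] := @exists_field_extension K1 K2 Rr Rv iso F
  fiso (a, b) (fun e => e = 0) _ _ _ Lf (fun _ => True) (hull_f hullL) (@dsT K2)
  (hull_newt hullL) newt2 FL _ La I (hull_fV hullL).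
- by move=> e ->; apply: (ds_0 dsF).
- by exists 0.
- by move=> e ->; rewrite subr0.
- by [].
exists F'; split => //; exists w => // Fw; apply: na; exists w => //.
have [c _] := cw 0 erefl; move: c; rewrite /rad subr0 /= => c.
by have [? ? ?] := lead_eq a0 c.
Qed.

(** When [F] has all leading terms of the hull, no element of [F] is a best approximation of [a]:
    adding an element with the leading term of the error improves it. Hence [a] is a pseudo-limit of
    elements of [F], and a point [b] common to the corresponding discs of the second side has
    matching differences with [F]. *)
Lemma immediate (F : X -> Prop) : field_iso Rr Rv F -> inL F ->
  (forall a, Lf a -> a != 0 ->
    exists2 w, F w & [/\ w.1 != 0, af_ac w.1 = af_ac a & af_v w.1 = af_v a]) ->
  forall a, Lf a -> ~ (exists b, F (a, b)) ->
  exists F', [/\ field_iso Rr Rv F', forall x, F x -> F' x, inL F' & exists2 w, F' w & ~ F w].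
Proof.
move=> fiso FL lead a La na; have dsF := rf_ring fiso.
have ne e : F e -> a - e.1 != 0.
  move=> Fe; rewrite subr_eq0; apply/eqP => E; apply: na; exists e.2.
  by rewrite E -surjective_pairing.
have Lae e : F e -> Lf (a - e.1) by move=> Fe; apply: (ds_B (hull_f hullL) La (FL e Fe)).
have better e : F e -> exists2 e', F e' & af_v (a - e.1) < af_v (a - e'.1).
  move=> Fe; have [w Fw [w0 acw vw]] := lead _ (Lae e Fe) (ne e Fe).
  have Few : F (e + w) by apply: (ds_D dsF).
  exists (e + w) => //; rewrite -vgtE0 ?ne //.
  have -> : a - (e + w).1 = (a - e.1) - w.1 by rewrite /= opprD addrA.
  have gx := vge_val (a - e.1); have gw : vge (af_v (a - e.1)) w.1 by rewrite -vw vge_val.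
  apply: (vgt_coef (vcmpB gx gw)).
  rewrite (af_coefD gx) ?vcmpN // coefN (coef_val (ne e Fe)).
  by rewrite -[in X in _ - X]vw (coef_val w0) acw subrr.
(* [c n] is an element of [F] whose difference with [a] has valuation at least [ev n], if there is
   one, and 0 otherwise. As [ev] lists the values of the hull, these approximations are cofinal. *)
have /choice [c Hc] n : exists e, F e /\
    ((exists2 e', F e' & ev n <= af_v (a - e'.1)) -> ev n <= af_v (a - e.1)).
  case: (pselect (exists2 e', F e' & ev n <= af_v (a - e'.1))) => [[e Fe le]|nex].
    by exists e.
  by exists 0; split; first exact: (ds_0 dsF).
have Fc n : F (c n) by case: (Hc n).
have /choice [r Hr] n : exists g2, Rv (af_v (a - (c n).1), g2).
  by apply: Lv_dom; apply: (hull_v hullL); apply: Lae.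
have cof e : F e -> exists n, af_v (a - e.1) < af_v (a - (c n).1).
  move=> Fe; have [e' Fe' lt] := better e Fe.
  have /evE [n En] : Lv (af_v (a - e'.1)) by apply: (hull_v hullL); apply: Lae.
  exists n; apply: lt_le_trans lt _; rewrite -En; apply: (proj2 (Hc n)).
  by exists e' => //; rewrite En.
have ball_le i j : af_v (a - (c i).1) <= af_v (a - (c j).1) -> vge (r i) ((c j).2 - (c i).2).
  move=> le; have Fij : F (c j - c i) by apply: (ds_B dsF).
  have := match_vcmp iso false (rf_match fiso Fij) (Hr i) => /= <-.
  have -> : (c j).1 - (c i).1 = (a - (c i).1) - (a - (c j).1).
    by rewrite opprB [RHS]addrC addrA subrK.
  by apply: vcmpB; [apply: vge_val|apply: vcmp_le le _; apply: vge_val].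
have [|b Hb] := ball2 (y := fun n => (c n).2) (g := r).
  move=> N; have [|j _ jmin] := @seq_argmin _ _ (fun j => - af_v (a - (c j).1)) (iota 0 N.+1).
    by [].
  exists (c j).2 => i iN; apply: ball_le; rewrite -oag_leN2; apply: jmin.
  by rewrite mem_iota.
pose w0 : X := (a, b).
have mw e : F e -> rv_match Rr Rv (w0 - e) /\ (w0 - e).1 != 0.
  move=> Fe; split; last exact: ne.
  (* [c n] is closer to [a] than [e], so on each side [w0 - e] has the leading term of [c n - e],
     and that difference is matched as an element of [F]. *)
  have [n lt] := cof e Fe; have Fne : F (c n - e) by apply: (ds_B dsF).
  have m := rf_match fiso Fne.
  have gt1 : vgt (af_v (a - e.1)) (((c n).1 - e.1) - (a - e.1)).
    rewrite opprB addrA subrK -vcmpN opprB.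
    by apply: vge_lt lt _; apply: vge_val.
  have [z1 v1 ac1] := lead_eq (ne e Fe) gt1.
  have Rv1 := rv_match_val m z1; have m0 := rv_match0 iso m.
  have z2 : (c n).2 - e.2 != 0 by rewrite -[_ - _]/((c n - e).2) -m0.
  have gt2 : vgt (af_v ((c n).2 - e.2)) ((b - e.2) - ((c n).2 - e.2)).
    rewrite opprB addrA subrK; apply: vge_lt (Hb n).
    have /= <- := rv_lt iso Rv1 (Hr n).
    by rewrite v1.
  have [y2 v2 ac2] := lead_eq z2 gt2.
  case: m => Rac _; split=> [|_] /=.
    by rewrite ac2 -ac1.
  by rewrite v2 -v1.
have [|||F' [w [fiso' FF' F'L F'w cw]]] := @exists_field_extension K1 K2 Rr Rv iso F
  fiso w0 F _ _ mw Lf (fun _ => True) (hull_f hullL) (@dsT K2)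
  (hull_newt hullL) newt2 FL _ La I (hull_fV hullL).
- by [].
- by exists 0; apply: (ds_0 dsF).
- by [].
(* If [w] were in [F], it would be a centre, and the valuation of [w - w0] would exceed itself. *)
exists F'; split => //; exists w => // Fw; have [k _] := cw w Fw.
have [_ nz] := mw w Fw.
move: k; rewrite -vcmpN /rad /= opprB.
exact/negP/vgt_notge.
Qed.

Lemma exhaust (F0 : X -> Prop) : field_iso Rr Rv F0 -> inL F0 ->
  exists F, [/\ field_iso Rr Rv F, forall x, F0 x -> F x, inL F &
    forall a, Lf a -> exists b, F (a, b)].
Proof.
move=> fiso0 F0L; pose Q (F : set X) := field_iso Rr Rv F /\ inL F.
(* [F0] is joined to every set so that the union of the empty chain also qualifies. *)
have [|A [QA Amax]] := @Zorn_bigcup X (fun F => Q (fun x => F0 x \/ F x)).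
  move=> C CQ Ctot.
  pose B := (fun x => F0 x \/ (\bigcup_(F in C) F)%classic x).
  have two x y : B x -> B y -> exists F, [/\ Q F, F x, F y & forall z, F z -> B z].
    have one F : C F -> forall z, F0 z \/ F z -> B z.
      by move=> CF z [Fz|Fz]; [left|right; exists F].
    move=> [Fx|[F CF Fx]] [Fy|[F' CF' Fy]].
    - exists F0; split => //; by left.
    - by exists (fun z => F0 z \/ F' z); split; [exact: CQ|left|right|exact: one].
    - by exists (fun z => F0 z \/ F z); split; [exact: CQ|right|left|exact: one].
    have [FF|FF] := Ctot F F' CF CF'.
      by exists (fun z => F0 z \/ F' z); split; [exact: CQ|right; apply: FF|right|exact: one].
    by exists (fun z => F0 z \/ F z); split; [exact: CQ|right|right; apply: FF|exact: one].
  split; last by move=> x Bx; have [F [[_ FL] Fx _ _]] := two x x Bx Bx; apply: FL.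
  split.
  + split.
    * by left; apply: (ds_1 (rf_ring fiso0)).
    * move=> x y Bx By; have [F [[fF _] Fx Fy FB]] := two x y Bx By.
      by apply: FB; apply: (ds_B (rf_ring fF)).
    * move=> x y Bx By; have [F [[fF _] Fx Fy FB]] := two x y Bx By.
      by apply: FB; apply: (ds_M (rf_ring fF)).
    * move=> x Bx; have [F [[fF _] Fx _ FB]] := two x x Bx Bx.
      by apply: FB; apply: (ds_der (rf_ring fF)).
  + move=> x Bx; have [F [[fF _] Fx _ FB]] := two x x Bx Bx.
    by apply: FB; apply: (rf_inv fF).
  + move=> x Bx; have [F [[fF _] Fx _ FB]] := two x x Bx Bx.
    exact: (rf_match fF).
pose F := (fun x => F0 x \/ A x); case: QA => fF FL.
have maxF F' : field_iso Rr Rv F' -> inL F' -> (forall x, F x -> F' x) ->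
    forall w, F' w -> F w.
  move=> fF' F'L FF' w F'w; apply/not_notP => nFw.
  apply: (Amax F').
    split; first by move=> x Ax; apply: FF'; right.
    by move=> F'A; apply: nFw; right; apply: F'A.
  have -> : (fun x => F0 x \/ F' x) = F'.
    by apply/seteqP; split=> x /=; [case=> // Fx; apply: FF'; left|right].
  by split.
exists F; split => //; first by move=> x; left.
have noext F' : ~ [/\ field_iso Rr Rv F', forall x, F x -> F' x, inL F' &
    exists2 w, F' w & ~ F w].
  by move=> [fF' FF' F'L [w F'w nFw]]; apply: nFw; apply: (maxF F').
have lead a : Lf a -> a != 0 ->
    exists2 w, F w & [/\ w.1 != 0, af_ac w.1 = af_ac a & af_v w.1 = af_v a].
  move=> La a0; apply/not_notP => nex.
  by have [F' HF'] := lead_neq0 fF FL La a0 nex; apply: (noext F').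
move=> a La; apply/not_notP => nex.
by have [F' HF'] := immediate fF FL lead La nex; apply: (noext F').
Qed.

End Inside.

Theorem extend_good Rf Rr Rv (sf : nat -> X) (sr : nat -> af_k K1 * af_k K2)
    (sv : nat -> af_G K1 * af_G K2) (a : K1) : good Rf Rr Rv ->
  (forall n, Rf (sf n)) -> (forall n, Rr (sr n)) -> (forall n, Rv (sv n)) ->
  exists Rf' Rr' Rv', [/\ good Rf' Rr' Rv', forall n, Rf' (sf n), forall n, Rr' (sr n),
    forall n, Rv' (sv n) & exists b, Rf' (a, b)].
Proof.
move=> gR Sf Sr Sv.
have [F0 [Rr0 [Rv0 [ef [er0 [ev0 [g0 F0E Rr0E Rv0E [Sf0 Sr0 Sv0]]]]]]]] :=
  countable_good gR Sf Sr Sv.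
have [iso0 el0 fiso0] := g0.
pose seed n : K1 + (af_k K1 + af_G K1) := match odflt (0, 0)%N (unpickle n) with
  | (0, _) => inl a | (1, m) => inl (ef m).1 | (2, m) => inr (inl (er0 m).1)
  | (_, m) => inr (inr (ev0 m).1) end.
have [Lf [Lr [Lv [er [ev [hullL LrE LvE Lseed]]]]]] := countable_hull newt1 seed.
have La : Lf a by have := Lseed (pickle (0, 0)%N).
have Lef m : Lf (ef m).1 by have := Lseed (pickle (1, m)%N); rewrite /seed pickleK.
have Ler m : Lr (er0 m).1 by have := Lseed (pickle (2, m)%N); rewrite /seed pickleK.
have Lev m : Lv (ev0 m).1 by have := Lseed (pickle (3, m)%N); rewrite /seed pickleK.
pose e1 : assignment (LrvS K1) := fun s => match s with
  rv_r => fun n => (er0 n).1 | rv_v => fun n => (ev0 n).1 end.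
pose e2 : assignment (LrvS K2) := fun s => match s with
  rv_r => fun n => (er0 n).2 | rv_v => fun n => (ev0 n).2 end.
pose e1' : assignment (LrvS K1) := fun s => match s with
  rv_r => er | rv_v => ev end.
have EE p : sat p e1 <-> sat p e2.
  apply: el0 => n /=; [apply/Rr0E|apply/Rv0E]; exists n; exact: surjective_pairing.
have [e2' [E2' EE']] := rvsat2 e1' EE.
(* Old pairs sit at even indices and the listed elements of the hull at odd ones, so the new ranges
   contain the old relations. *)
pose E1 := merge e1 e1'.
have E1r n : E1 rv_r n = if odd n then er n./2 else (er0 n./2).1 by [].
have E1v n : E1 rv_v n = if odd n then ev n./2 else (ev0 n./2).1 by [].
have LrE1 x : Lr x <-> exists n, E1 rv_r n = x.
  split=> [/LrE [n <-]|[n <-]].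
    by exists n.*2.+1; rewrite E1r /= odd_double uphalf_double.
  by rewrite E1r; case: ifP => // _; apply/LrE; exists n./2.
have LvE1 x : Lv x <-> exists n, E1 rv_v n = x.
  split=> [/LvE [n <-]|[n <-]].
    by exists n.*2.+1; rewrite E1v /= odd_double uphalf_double.
  by rewrite E1v; case: ifP => // _; apply/LvE; exists n./2.
pose Rr' := range_r E1 e2'; pose Rv' := range_v E1 e2'.
have iso' : rv_iso Rr' Rv'.
  apply: (rv_iso_range EE' LrE1 LvE1 (hull_r hullL) (hull_rV hullL) (hull_v0 hullL)
    (hull_vB hullL) (hull_c hullL)).
have Rr_sub x : Rr0 x -> Rr' x.
  move=> /Rr0E [n <-]; exists n.*2; rewrite E1r odd_double doubleK E2' /=.
  exact: surjective_pairing.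
have Rv_sub x : Rv0 x -> Rv' x.
  move=> /Rv0E [n <-]; exists n.*2; rewrite E1v odd_double doubleK E2' /=.
  exact: surjective_pairing.
have fiso' : field_iso Rr' Rv' F0.
  case: fiso0 => H1 H2 H3; split => // x /H3 [m1 m2].
  by split; [apply: Rr_sub|move=> /m2; apply: Rv_sub].
have F0L x : F0 x -> Lf x.1 by move=> /F0E [n <-].
have [F [fF F0F FL Fdom]] := exhaust iso' hullL LvE
  (range_r_dom e2' LrE1) (range_v_dom e2' LvE1) fiso' F0L.
exists F, Rr', Rv'; split.
- by split => //; apply: elementary_range.
- by move=> n; apply: F0F.
- by move=> n; apply: Rr_sub.
- by move=> n; apply: Rv_sub.
- exact: Fdom.
Qed.

End ExtensionTheorem.

(** * Ultrapowers *)

Lemma free_ultrafilter_exists : exists U : set_system nat,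
  UltraFilter U /\ forall n, U (fun i => (n <= i)%N).
Proof.
pose F : set_system nat := fun A => exists n, forall i, (n <= i)%N -> A i.
have FF : ProperFilter F.
  apply: Build_ProperFilter_ex.
    by move=> A [n An]; exists n; apply: An.
  split.
  - by exists 0%N.
  - move=> A B [n An] [m Bm]; exists (maxn n m) => i; rewrite geq_max => /andP[ni mi].
    by split; [apply: An|apply: Bm].
  - by move=> A B AB [n An]; exists n => i /An /AB.
have [U [uU FU]] := ultraFilterLemma FF; exists U; split => // n.
by apply: FU; exists n.
Qed.

Definition ultra : set_system nat := projT1 (cid free_ultrafilter_exists).

Lemma ultraP : UltraFilter ultra.
Proof. exact: proj1 (projT2 (cid free_ultrafilter_exists)). Qed.

Lemma ultra_free n : ultra (fun i => (n <= i)%N).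
Proof. exact: proj2 (projT2 (cid free_ultrafilter_exists)) n. Qed.

Definition sequence (T : Type) := nat -> T.
HB.instance Definition _ (T : Type) := gen_eqMixin (sequence T).
HB.instance Definition _ (T : Type) := gen_choiceMixin (sequence T).

Definition ultra_eq (T : Type) (x y : sequence T) := `[< ultra (fun n => x n = y n) >].

Lemma ultra_eq_refl T : reflexive (@ultra_eq T).
Proof. by move=> x; apply/asboolP; apply: (U_true ultraP). Qed.

Lemma ultra_eq_sym T : ssrbool.symmetric (@ultra_eq T).
Proof. by move=> x y; apply/asboolP/asboolP => H; apply: (U_sub ultraP) H => n ->. Qed.

Lemma ultra_eq_trans T : transitive (@ultra_eq T).
Proof.
move=> y x z /asboolP xy /asboolP yz; apply/asboolP.
by apply: (U_sub ultraP) (U_and ultraP xy yz) => n [-> ->].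
Qed.

Canonical ultra_equiv T :=
  EquivRel (@ultra_eq T) (@ultra_eq_refl T) (@ultra_eq_sym T) (@ultra_eq_trans T).

Definition upow (T : Type) := {eq_quot (ultra_equiv T)}%qT.
HB.instance Definition _ (T : Type) := Choice.on (upow T).

Definition cls (T : Type) (x : nat -> T) : upow T := (\pi_(upow T) (x : sequence T))%qT.
Definition rep (T : Type) (a : upow T) : nat -> T := repr a.

Lemma clsP T (x y : nat -> T) : cls x = cls y <-> ultra (fun n => x n = y n).
Proof.
rewrite /cls; split; first by move/eqmodP => /asboolP.
by move=> H; apply/eqmodP/asboolP.
Qed.

Lemma repK T (a : upow T) : cls (rep a) = a.
Proof. by rewrite /cls /rep reprK. Qed.

Lemma rep_cls T (x : nat -> T) : ultra (fun n => rep (cls x) n = x n).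
Proof. by apply/clsP; rewrite repK. Qed.

HB.lock Definition umap (T1 T2 : Type) (f : T1 -> T2) (a : upow T1) : upow T2 :=
  cls (fun n => f (rep a n)).

HB.lock Definition umap2 (T1 T2 T3 : Type) (f : T1 -> T2 -> T3) (a : upow T1) (b : upow T2) :
  upow T3 := cls (fun n => f (rep a n) (rep b n)).

Lemma umapE T1 T2 (f : T1 -> T2) x : umap f (cls x) = cls (fun n => f (x n)).
Proof. by rewrite umap.unlock; apply/clsP; apply: (U_sub ultraP) (rep_cls x) => n ->. Qed.

Lemma umap2E T1 T2 T3 (f : T1 -> T2 -> T3) x y :
  umap2 f (cls x) (cls y) = cls (fun n => f (x n) (y n)).
Proof.
rewrite umap2.unlock.
apply/clsP; apply: (U_sub ultraP) (U_and ultraP (rep_cls x) (rep_cls y)) => n.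
by move=> [-> ->].
Qed.

Lemma cls_ex T (a : upow T) : exists x, a = cls x.
Proof. by exists (rep a); rewrite repK. Qed.

Lemma eq_cls T (x y : nat -> T) : (forall n, x n = y n) -> cls x = cls y.
Proof. by move=> H; apply/clsP; apply: (U_true ultraP). Qed.

Section UpowZmod.
Variable V : zmodType.

Definition upow0 : upow V := cls (fun _ => 0).
Definition upow_opp : upow V -> upow V := umap -%R.
Definition upow_add : upow V -> upow V -> upow V := umap2 +%R.

Lemma upow_addA : associative upow_add.
Proof.
move=> a b c; have [x ->] := cls_ex a; have [y ->] := cls_ex b; have [z ->] := cls_ex c.
by rewrite /upow_add !umap2E; apply: eq_cls => n; rewrite addrA.
Qed.

Lemma upow_addC : commutative upow_add.
Proof.
move=> a b; have [x ->] := cls_ex a; have [y ->] := cls_ex b.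
by rewrite /upow_add !umap2E; apply: eq_cls => n; rewrite addrC.
Qed.

Lemma upow_add0 : left_id upow0 upow_add.
Proof.
move=> a; have [x ->] := cls_ex a.
by rewrite /upow_add umap2E; apply: eq_cls => n; rewrite add0r.
Qed.

Lemma upow_addN : left_inverse upow0 upow_opp upow_add.
Proof.
move=> a; have [x ->] := cls_ex a.
by rewrite /upow_add /upow_opp umapE umap2E; apply: eq_cls => n; rewrite addNr.
Qed.

HB.instance Definition _ := GRing.isZmodule.Build (upow V)
  upow_addA upow_addC upow_add0 upow_addN.

Lemma cls0 : cls (fun _ => 0 : V) = 0. Proof. by []. Qed.
Lemma clsN (x : nat -> V) : - cls x = cls (fun n => - x n).
Proof. exact: umapE. Qed.
Lemma clsD (x y : nat -> V) : cls x + cls y = cls (fun n => x n + y n).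
Proof. exact: umap2E. Qed.
Lemma clsB (x y : nat -> V) : cls x - cls y = cls (fun n => x n - y n).
Proof. by rewrite clsN clsD. Qed.
Lemma clsMn (x : nat -> V) m : cls x *+ m = cls (fun n => x n *+ m).
Proof.
elim: m => [|m IH]; first by rewrite mulr0n -cls0.
by rewrite mulrS IH clsD; apply: eq_cls => n; rewrite mulrS.
Qed.

Lemma cls_eq0 (x : nat -> V) : (cls x == 0) = `[< ultra (fun n => x n = 0) >].
Proof. by apply/eqP/asboolP => /clsP. Qed.

Lemma cls_neq0 (x : nat -> V) : (cls x != 0) = `[< ultra (fun n => x n != 0) >].
Proof.
rewrite cls_eq0; apply/idP/asboolP.
  by move/asboolPn/(U_not ultraP); apply: (U_sub ultraP) => n /eqP.
move=> H; apply/asboolPn/(U_not ultraP); apply: (U_sub ultraP) H => n /eqP //.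
Qed.

End UpowZmod.

Section UpowField.
Variable K : diffFieldType.

Definition upow_mul : upow K -> upow K -> upow K := umap2 *%R.
Definition upow_inv : upow K -> upow K := umap GRing.inv.
Definition upow_der : upow K -> upow K := umap der.
Definition upow1 : upow K := cls (fun _ => 1).

Lemma upow_mulA : associative upow_mul.
Proof.
move=> a b c; have [x ->] := cls_ex a; have [y ->] := cls_ex b; have [z ->] := cls_ex c.
by rewrite /upow_mul !umap2E; apply: eq_cls => n; rewrite mulrA.
Qed.

Lemma upow_mulC : commutative upow_mul.
Proof.
move=> a b; have [x ->] := cls_ex a; have [y ->] := cls_ex b.
by rewrite /upow_mul !umap2E; apply: eq_cls => n; rewrite mulrC.
Qed.

Lemma upow_mul1 : left_id upow1 upow_mul.
Proof.
move=> a; have [x ->] := cls_ex a.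
by rewrite /upow_mul umap2E; apply: eq_cls => n; rewrite mul1r.
Qed.

Lemma upow_mulD : left_distributive upow_mul +%R.
Proof.
move=> a b c; have [x ->] := cls_ex a; have [y ->] := cls_ex b; have [z ->] := cls_ex c.
by rewrite /upow_mul !clsD !umap2E clsD; apply: eq_cls => n; rewrite mulrDl.
Qed.

Lemma upow_1neq0 : upow1 != 0.
Proof.
by rewrite /upow1 cls_neq0; apply/asboolP; apply: (U_true ultraP) => n; apply: oner_neq0.
Qed.

HB.instance Definition _ := GRing.Zmodule_isComNzRing.Build (upow K)
  upow_mulA upow_mulC upow_mul1 upow_mulD upow_1neq0.

Lemma upow_mulV (a : upow K) : a != 0 -> upow_inv a * a = 1.
Proof.
have [x ->] := cls_ex a; rewrite cls_neq0 => /asboolP H.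
rewrite /upow_inv umapE [LHS]umap2E; apply/clsP.
by apply: (U_sub ultraP) H => n; apply: mulVf.
Qed.

Lemma upow_inv0 : upow_inv 0 = 0.
Proof. by rewrite /upow_inv -cls0 umapE; apply: eq_cls => n; rewrite invr0. Qed.

HB.instance Definition _ := GRing.ComNzRing_isField.Build (upow K) upow_mulV upow_inv0.

Lemma cls1 : cls (fun _ => 1 : K) = 1. Proof. by []. Qed.
Lemma clsM (x y : nat -> K) : cls x * cls y = cls (fun n => x n * y n).
Proof. exact: umap2E. Qed.
Lemma clsV (x : nat -> K) : (cls x)^-1 = cls (fun n => (x n)^-1).
Proof. exact: umapE. Qed.

Lemma upow_derD (a b : upow K) : upow_der (a + b) = upow_der a + upow_der b.
Proof.
have [x ->] := cls_ex a; have [y ->] := cls_ex b.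
by rewrite clsD /upow_der !umapE clsD; apply: eq_cls => n; rewrite derD.
Qed.

Lemma upow_derM (a b : upow K) : upow_der (a * b) = upow_der a * b + a * upow_der b.
Proof.
have [x ->] := cls_ex a; have [y ->] := cls_ex b.
by rewrite clsM /upow_der !umapE !clsM clsD; apply: eq_cls => n; rewrite derM.
Qed.

Lemma cls_natr m : m%:R = cls (fun _ => m%:R : K).
Proof. by rewrite -cls1 clsMn. Qed.

Lemma upow_pchar0 : [pchar (upow K)] =i pred0.
Proof.
apply/pcharf0P => m; rewrite cls_natr cls_eq0; apply/asboolP/idP.
  move=> H; apply/not_notP => m0; apply: (U_false ultraP); apply: (U_sub ultraP) H => n.
  by case: m m0 => // m _ /eqP; apply/negP; apply: natr_neq0.
by move/eqP => ->; apply: (U_true ultraP).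
Qed.

HB.instance Definition _ := Field_isDifferential.Build (upow K)
  upow_derD upow_derM upow_pchar0.

Lemma cls_der (x : nat -> K) : der (cls x) = cls (fun n => der (x n)).
Proof. exact: umapE. Qed.

End UpowField.

Section UpowGroup.
Variable G : oagType.

Definition upow_le (a b : upow G) : bool := `[< ultra (fun n => rep a n <= rep b n) >].

Lemma upow_leE (x y : nat -> G) :
  upow_le (cls x) (cls y) = `[< ultra (fun n => x n <= y n) >].
Proof.
have H := U_and ultraP (rep_cls x) (rep_cls y).
by apply/asboolP/asboolP => H'; apply: (U_sub ultraP) (U_and ultraP H H') => n [[-> ->]].
Qed.

Lemma upow_le_refl : reflexive upow_le.
Proof. by move=> a; apply/asboolP; apply: (U_true ultraP). Qed.

Lemma upow_le_anti : antisymmetric upow_le.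
Proof.
move=> a b /andP[/asboolP ab /asboolP ba]; rewrite -(repK a) -(repK b); apply/clsP.
by apply: (U_sub ultraP) (U_and ultraP ab ba) => n [H1 H2]; apply/le_anti/andP.
Qed.

Lemma upow_le_trans : transitive upow_le.
Proof.
move=> b a c /asboolP ab /asboolP bc; apply/asboolP.
by apply: (U_sub ultraP) (U_and ultraP ab bc) => n [H1 H2]; apply: le_trans H1 H2.
Qed.

HB.instance Definition _ := Order.Le_isPOrder.Build ring_display (upow G)
  upow_le_refl upow_le_anti upow_le_trans.

Lemma cls_le (x y : nat -> G) : (cls x <= cls y) = `[< ultra (fun n => x n <= y n) >].
Proof. exact: upow_leE. Qed.

Lemma upow_leD2l (c a b : upow G) : a <= b -> c + a <= c + b.
Proof.
have [x ->] := cls_ex a; have [y ->] := cls_ex b; have [z ->] := cls_ex c.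
rewrite !clsD !cls_le => /asboolP H; apply/asboolP.
by apply: (U_sub ultraP) H => n; apply: oag_leD2l.
Qed.

Lemma upow_le_total (a b : upow G) : (a <= b) || (b <= a).
Proof.
have [x ->] := cls_ex a; have [y ->] := cls_ex b; rewrite !cls_le.
case: asboolP => //= /(U_not ultraP) H; apply/asboolP.
by apply: (U_sub ultraP) H => n /negP; rewrite -ltNge => /ltW.
Qed.

HB.instance Definition _ := POrderedZmodule_isOrderedAbGroup.Build (upow G)
  upow_leD2l upow_le_total.

Definition upow_oag : oagType := upow G.

Lemma cls_lt (x y : nat -> G) :
  ((cls x : upow_oag) < cls y) = `[< ultra (fun n => x n < y n) >].
Proof.
rewrite ltNge [_ <= _]cls_le; apply/negP/asboolP.
  move=> nH; have /(U_not ultraP) : ~ ultra (fun n => y n <= x n).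
    by move=> H; apply: nH; apply/asboolP.
  by apply: (U_sub ultraP) => n /negP; rewrite -ltNge.
move=> H /asboolP H'; apply: (U_false ultraP).
by apply: (U_sub ultraP) (U_and ultraP H H') => n []; rewrite ltNge => /negP.
Qed.

End UpowGroup.

Lemma U_or (A B : set nat) : ultra (fun n => A n \/ B n) <-> ultra A \/ ultra B.
Proof.
split=> [H|[]]; last 2 first.
- by apply: (U_sub ultraP) => n; left.
- by apply: (U_sub ultraP) => n; right.
case: (pselect (ultra A)) => [UA|/(U_not ultraP) nA]; [by left|right].
by apply: (U_sub ultraP) (U_and ultraP H nA) => n [[]].
Qed.

Section UpowModel.
Variable A : acField.
Local Notation K := (upow A : diffFieldType).
Local Notation k := (upow (af_k A) : diffFieldType).
Local Notation G := (upow_oag (af_G A)).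

Definition upow_v : K -> G := umap af_v.
Definition upow_ac : K -> k := umap af_ac.
Definition upow_c : G -> k := umap af_c.

Lemma cls_vcmp s (g : nat -> af_G A) (x : nat -> A) :
  val_cmp upow_v s (cls g : G) (cls x : K) = `[< ultra (fun n => vcmp s (g n) (x n)) >].
Proof.
rewrite /val_cmp cls_eq0 /upow_v umapE.
have -> : (if s then (cls g : G) < cls (fun n => af_v (x n))
    else (cls g : G) <= cls (fun n => af_v (x n))) =
    `[< ultra (fun n => if s then g n < af_v (x n) else g n <= af_v (x n)) >].
  by case: s; [exact: cls_lt|exact: cls_le].
apply/orP/asboolP.
  move=> H; have /U_or : ultra (fun n => x n = 0) \/
      ultra (fun n => if s then g n < af_v (x n) else g n <= af_v (x n)).
    by case: H => /asboolP; [left|right].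
  by apply: (U_sub ultraP) => n [->|->]; rewrite ?eqxx ?orbT.
move=> H; have : ultra (fun n => x n = 0 \/
    (if s then g n < af_v (x n) else g n <= af_v (x n))).
  by apply: (U_sub ultraP) H => n /orP[/eqP|]; [left|right].
by move/U_or => [?|?]; [left|right]; apply/asboolP.
Qed.

Lemma cls_coef (g : nat -> af_G A) (x : nat -> A) :
  coef_at upow_v upow_ac (cls g : G) (cls x : K) = cls (fun n => coef (g n) (x n)).
Proof.
have E : (cls x != 0 :> K) && (upow_v (cls x) == cls g) =
    `[< ultra (fun n => (x n != 0) && (af_v (x n) == g n)) >].
  rewrite cls_neq0 /upow_v umapE; apply/andP/asboolP.
    move=> [/asboolP H1 /eqP /clsP H2].
    by apply: (U_sub ultraP) (U_and ultraP H1 H2) => n [-> ->]; rewrite eqxx.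
  move=> H; split.
    by apply/asboolP; apply: (U_sub ultraP) H => n /andP[].
  by apply/eqP/clsP; apply: (U_sub ultraP) H => n /andP[_ /eqP].
rewrite /coef_at E; case: asboolP => H.
  rewrite /upow_ac umapE; apply/clsP; apply: (U_sub ultraP) H => n.
  by move=> ->.
rewrite -cls0; apply/clsP; move/(U_not ultraP): H; apply: (U_sub ultraP) => n.
by move/negP/negPf => ->.
Qed.

Lemma upow_ac_eq0 x : (upow_ac x == 0) = (x == 0).
Proof.
have [y ->] := cls_ex x; rewrite /upow_ac umapE !cls_eq0.
by apply/asboolP/asboolP; apply: (U_sub ultraP) => n /eqP; rewrite ?af_ac_eq0 => /eqP //
  => ->; rewrite af_ac0.
Qed.

Lemma upow_vM x y : x != 0 -> y != 0 -> upow_v (x * y) = upow_v x + upow_v y.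
Proof.
have [a ->] := cls_ex x; have [b ->] := cls_ex y.
rewrite !cls_neq0 => /asboolP Ha /asboolP Hb.
rewrite clsM /upow_v !umapE [RHS]clsD; apply/clsP.
by apply: (U_sub ultraP) (U_and ultraP Ha Hb) => n []; apply: af_vM.
Qed.

Lemma upow_acM x y : x != 0 -> y != 0 -> upow_ac (x * y) = upow_ac x * upow_ac y.
Proof.
have [a ->] := cls_ex x; have [b ->] := cls_ex y.
rewrite !cls_neq0 => /asboolP Ha /asboolP Hb.
rewrite clsM /upow_ac !umapE clsM; apply/clsP.
by apply: (U_sub ultraP) (U_and ultraP Ha Hb) => n []; apply: af_acM.
Qed.

Lemma upow_geD g x y : val_cmp upow_v false g x -> val_cmp upow_v false g y ->
  val_cmp upow_v false g (x + y).
Proof.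
have [h ->] := cls_ex g; have [a ->] := cls_ex x; have [b ->] := cls_ex y.
rewrite clsD !cls_vcmp => /asboolP Ha /asboolP Hb; apply/asboolP.
by apply: (U_sub ultraP) (U_and ultraP Ha Hb) => n []; apply: vcmpD.
Qed.

Lemma upow_coefD g x y : val_cmp upow_v false g x -> val_cmp upow_v false g y ->
  coef_at upow_v upow_ac g (x + y) = coef_at upow_v upow_ac g x + coef_at upow_v upow_ac g y.
Proof.
have [h ->] := cls_ex g; have [a ->] := cls_ex x; have [b ->] := cls_ex y.
rewrite clsD !cls_vcmp => /asboolP Ha /asboolP Hb.
rewrite !cls_coef clsD; apply/clsP.
by apply: (U_sub ultraP) (U_and ultraP Ha Hb) => n []; apply: af_coefD.
Qed.

Lemma upow_ge_der g x : val_cmp upow_v false g x -> val_cmp upow_v false g (der x).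
Proof.
have [h ->] := cls_ex g; have [a ->] := cls_ex x.
rewrite cls_der !cls_vcmp => /asboolP Ha; apply/asboolP.
by apply: (U_sub ultraP) Ha => n; apply: vcmp_der.
Qed.

Lemma upow_coef_der g x : val_cmp upow_v false g x ->
  coef_at upow_v upow_ac g (der x) =
  der (coef_at upow_v upow_ac g x) + upow_c g * coef_at upow_v upow_ac g x.
Proof.
have [h ->] := cls_ex g; have [a ->] := cls_ex x.
rewrite cls_der !cls_vcmp => /asboolP Ha.
rewrite !cls_coef cls_der /upow_c umapE clsM clsD; apply/clsP.
by apply: (U_sub ultraP) Ha => n; apply: af_coef_der.
Qed.

Lemma upow_surj g d : d != 0 -> exists x, [/\ x != 0, upow_v x = g & upow_ac x = d].
Proof.
have [h ->] := cls_ex g; have [a ->] := cls_ex d; rewrite cls_neq0 => /asboolP Ha.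
have /choice [x Hx] n : exists y : A, a n != 0 ->
    [/\ y != 0, af_v y = h n & af_ac y = a n].
  case: (eqVneq (a n) 0) => [->|nz]; first by exists 0.
  by have [y Hy] := af_surj (h n) nz; exists y.
exists (cls x); split.
- by rewrite cls_neq0; apply/asboolP; apply: (U_sub ultraP) Ha => n /Hx[].
- by rewrite /upow_v umapE; apply/clsP; apply: (U_sub ultraP) Ha => n /Hx[].
- by rewrite /upow_ac umapE; apply/clsP; apply: (U_sub ultraP) Ha => n /Hx[].
Qed.

Definition upow_model : acField := AcField upow_ac_eq0 upow_vM upow_acM upow_geD
  upow_coefD upow_ge_der upow_coef_der upow_surj.

Lemma cls_sum (I : Type) (r : seq I) (F : I -> nat -> A) :
  \sum_(i <- r) (cls (F i) : K) = cls (fun n => \sum_(i <- r) F i n).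
Proof.
elim: r => [|i r IH].
  by rewrite big_nil -cls0; apply: eq_cls => n; rewrite big_nil.
by rewrite big_cons IH clsD; apply: eq_cls => n; rewrite big_cons.
Qed.

Lemma clsX (x : nat -> A) m : (cls x : K) ^+ m = cls (fun n => x n ^+ m).
Proof.
elim: m => [|m IH]; first by rewrite expr0 -cls1.
by rewrite exprS IH clsM; apply: eq_cls => n; rewrite exprS.
Qed.

Lemma cls_prod (I : Type) (r : seq I) (F : I -> nat -> A) :
  \prod_(i <- r) (cls (F i) : K) = cls (fun n => \prod_(i <- r) F i n).
Proof.
elim: r => [|i r IH].
  by rewrite big_nil -cls1; apply: eq_cls => n; rewrite big_nil.
by rewrite big_cons IH clsM; apply: eq_cls => n; rewrite big_cons.
Qed.

Lemma cls_iter_der i (x : nat -> A) : iter i der (cls x : K) = cls (fun n => iter i der (x n)).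
Proof. by elim: i => //= i ->; rewrite cls_der. Qed.

(** Los's principle by hand: the number of variables and the support of [Q] are fixed, so [Q] is
    represented by polynomials [Qs i] over the same finite set of monomials, and the conditions on
    all coefficients reduce to finitely many. *)
Lemma upow_newtonian : newtonian (fun _ : A => True) -> newtonian (fun _ : upow_model => True).
Proof.
move=> newt n Q g d _ c0 c1 [i0 ci] c2.
pose Qs (i : nat) : {mpoly A[n]} := \sum_(m <- msupp Q) (rep Q@_m i) *: 'X_[m].
have QsE i m : (Qs i)@_m = if m \in msupp Q then rep Q@_m i else 0.
  rewrite raddf_sum /=; case: ifP => mQ.
    rewrite (bigD1_seq m) ?msupp_uniq //= mcoeffZ mcoeffX eqxx mulr1.
    rewrite big1 ?addr0 // => m' m'm.
    by rewrite mcoeffZ mcoeffX (negPf m'm) mulr0.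
  rewrite big1_seq // => m' /= m'Q; rewrite mcoeffZ mcoeffX.
  by case: eqP => [E|_]; rewrite ?mulr0 //; rewrite E mQ in m'Q.
have QE m : Q@_m = cls (fun i => (Qs i)@_m) :> K.
  case: (boolP (m \in msupp Q)) => mQ.
    by rewrite -[LHS]repK; apply: eq_cls => i; rewrite QsE mQ.
  by rewrite (memN_msupp_eq0 mQ) -cls0; apply: eq_cls => i; rewrite QsE (negPf mQ).
have [gs Eg] := cls_ex g; have [ds Ed] := cls_ex d.
have Edg m : d - g *+ m = cls (fun i => ds i - gs i *+ m) by rewrite Eg Ed clsMn clsB.
have Edg1 : d - g = cls (fun i => ds i - gs i) by rewrite Eg Ed clsB.
have H0 : ultra (fun i => vge (ds i) (Qs i)@_0).
  by apply/asboolP; rewrite -cls_vcmp -QE -Ed.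
have H1 : ultra (fun i => forall j, vge (ds i - gs i) (Qs i)@_U_(j)).
  apply: (U_fin ultraP) => j; apply/asboolP; rewrite -cls_vcmp -QE -Edg1; exact: c1.
have Hi : ultra (fun i => ~~ vgt (ds i - gs i) (Qs i)@_U_(i0)).
  have : ~ ultra (fun i => vgt (ds i - gs i) (Qs i)@_U_(i0)).
    by apply/asboolPn; rewrite -cls_vcmp -QE -Edg1.
  by move/(U_not ultraP); apply: (U_sub ultraP) => i /negP.
have H2 : ultra (fun i => forall m, (1 < mdeg m)%N -> vgt (ds i - gs i *+ mdeg m) (Qs i)@_m).
  have : ultra (fun i => forall m, List.In m (msupp Q) ->
      (1 < mdeg m)%N -> vgt (ds i - gs i *+ mdeg m) (Qs i)@_m).
    apply: (U_seq ultraP) => m _; case: (boolP (1 < mdeg m)%N) => m1; last first.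
      by apply: (U_true ultraP).
    have : ultra (fun i => vgt (ds i - gs i *+ mdeg m) (Qs i)@_m).
      by apply/asboolP; rewrite -cls_vcmp -QE -Edg; apply: c2.
    by apply: (U_sub ultraP).
  apply: (U_sub ultraP) => i Hm m m1; case: (boolP (m \in msupp Q)) => mQ.
    apply: Hm => //; elim: (msupp Q) mQ => //= m' s IH.
    by rewrite inE => /orP[/eqP ->|/IH]; [left|right].
  by rewrite QsE (negPf mQ) vcmp0.
have /choice [y Hy] i : exists y : A, vge (ds i) (Qs i)@_0 ->
    (forall j, vge (ds i - gs i) (Qs i)@_U_(j)) ->
    ~~ vgt (ds i - gs i) (Qs i)@_U_(i0) ->
    (forall m, (1 < mdeg m)%N -> vgt (ds i - gs i *+ mdeg m) (Qs i)@_m) ->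
    vge (gs i) y /\ (Qs i).@[jet y] = 0.
  case: (pselect (exists y, vge (gs i) y /\ (Qs i).@[jet y] = 0)) => [[y Hy]|nex].
    by exists y.
  exists 0 => a0 a1 a2 a3; case: nex.
  have [|||||y [_ gy Qy]] := newt n (Qs i) (gs i) (ds i) => //.
    by exists i0.
  by exists y.
have Hall : ultra (fun i => vge (gs i) (y i) /\ (Qs i).@[jet (y i)] = 0).
  have := U_and ultraP (U_and ultraP H0 H1) (U_and ultraP Hi H2).
  by apply: (U_sub ultraP) => i [[a0 a1] [a2 a3]]; apply: Hy.
exists (cls y); split => //.
  by rewrite Eg cls_vcmp; apply/asboolP; apply: (U_sub ultraP) Hall => i [].
rewrite mevalE; have E m : Q@_m * \prod_i jet (cls y : upow_model) i ^+ m i =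
    cls (fun i => (Qs i)@_m * \prod_j jet (y i) j ^+ m j).
  rewrite QE -[RHS]clsM; congr (_ * _); rewrite -cls_prod; apply: eq_bigr => j _.
  by rewrite /jet cls_iter_der clsX.
under eq_bigr do rewrite E; rewrite [LHS]cls_sum -cls0; apply/clsP.
apply: (U_sub ultraP) Hall => i [_ Qy]; rewrite -[RHS]Qy [in RHS]/Qs raddf_sum /=.
apply: eq_big_seq => m mQ; rewrite QsE mQ mevalZ mevalX; congr (_ * _).
Qed.

Lemma upow_ball_saturated : ball_saturated upow_model.
Proof.
move=> y g H.
have [|x Hx] := diagonal ultraP ultra_free (0 : A)
    (C := fun j i x => vge (rep (g j) i) (x - rep (y j) i)).
  move=> N; have [x Hx] := H N; have [xs Ex] := cls_ex x.
  have : ultra (fun i => forall j, List.In j (iota 0 N.+1) ->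
      vge (rep (g j) i) (xs i - rep (y j) i)).
    apply: (U_seq ultraP) => j Hj; apply/asboolP; rewrite -cls_vcmp repK -clsB repK -Ex.
    apply: Hx; have : j \in iota 0 N.+1.
      by elim: (iota 0 N.+1) Hj => //= a s IH; rewrite inE => -[->|/IH ->]; rewrite ?eqxx ?orbT.
    by rewrite mem_iota.
  apply: (U_sub ultraP) => i Hi; exists (xs i) => j jN; apply: Hi.
  have : j \in iota 0 N.+1 by rewrite mem_iota.
  by elim: (iota 0 N.+1) => //= a s IH; rewrite inE => /orP[/eqP ->|/IH]; [left|right].
exists (cls x) => j.
rewrite -[y j]repK -[g j]repK; rewrite [cls x - _]clsB [val_cmp _ _ _ _]cls_vcmp.
by apply/asboolP; apply: Hx.
Qed.

Definition rv_rep (s : Lrv_sort) : (nat -> LrvS A s) -> LrvS upow_model s -> Prop :=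
  match s with rv_r | rv_v => fun x y => y = cls x end.

Lemma rv_los p es e : @rep_assignment Lrv (LrvS A) (LrvS upow_model) rv_rep es e ->
  (sat p e <-> ultra (fun i => sat p (es i))).
Proof.
apply: (los ultraP).
- by case=> y; have [x ->] := cls_ex y; exists x.
- by case=> x; exists (cls x).
- by case=> x x' y y' -> ->; exact: clsP.
- case=> [[]|[]|] xs ys H /=; rewrite /field_interp /oag_interp /= /arg1 /arg2_1 /arg2_2.
  + by rewrite -cls0.
  + by rewrite -cls1.
  + by rewrite (H ord0) clsN.
  + by rewrite (H ord0) (H ord_max) clsD.
  + by rewrite (H ord0) (H ord_max) clsM.
  + by rewrite (H ord0) cls_der.
  + by rewrite -cls0.
  + by rewrite (H ord0) clsN.
  + by rewrite (H ord0) (H ord_max) clsD.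
  + by rewrite (H ord0) [LHS]umapE.
- case=> xs ys H /=; rewrite /arg2_1 /arg2_2 (H ord0) (H ord_max) [_ <= _]cls_le.
  by split=> /asboolP.
Qed.

Lemma countable_Lrv : exists e : nat -> formula Lrv, forall p, exists n, e n = p.
Proof.
pose cs n := if n is 0 then rv_r else rv_v.
pose ds n := match n with 0 => D0 | 1 => D1 | 2 => Dopp | 3 => Dadd | 4 => Dmul | _ => Dder end.
pose gs n := match n with 0 => G0 | 1 => Gopp | _ => Gadd end.
pose cf n := if n is 0 then rv_c else
  if odd n then rv_ring (ds n./2) else rv_group (gs n./2.-1).
apply: (@countable_formulas Lrv cs cf (fun _ => Le)).
- by case; [exists 0%N|exists 1%N].
- case=> [[]|[]|]; [exists 1%N|exists 3%N|exists 5%N|exists 7%N|exists 9%N|exists 11%N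
    |exists 2%N|exists 4%N|exists 6%N|exists 0%N] => //.
- by case; exists 0%N.
Qed.

Lemma upow_rv_saturated : rv_saturated upow_model.
Proof.
move=> N e1 e1' e2 EE; have [pe pe_surj] := countable_Lrv.
have rep_ex (s : Lrv_sort) (y : LrvS upow_model s) : exists x, @rv_rep s x y.
  by case: s y => y; have [x ->] := cls_ex y; exists x.
have rep_tot (s : Lrv_sort) (x : nat -> LrvS A s) : exists y, @rv_rep s x y.
  by case: s x => x; exists (cls x).
have rep_eq (s : Lrv_sort) (x x' : nat -> LrvS A s) y y' : @rv_rep s x y ->
    @rv_rep s x' y' -> (y = y' <-> ultra (fun n => x n = x' n)).
  by case: s x x' y y' => x x' y y' -> ->; exact: clsP.
exact: (@extend_elementary ultra ultraP ultra_free Lrv (LrvS A) (LrvS upow_model)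
  rv_rep rep_ex rep_tot rep_eq rv_los pe pe_surj N e1 e1' e2 EE).
Qed.

End UpowModel.

(** * The full three-sorted language on ultrapowers *)

Section L3Structure.
Variable A : acField.

Definition L3_carrier (s : L3ac_sort) : Type :=
  match s with s_f => A | s_r => option (af_k A) | s_v => option (af_G A) end.

(** The residue map is read off as the coefficient of t^0, so that the structure is determined by
    the [acField]. *)
Definition L3_finterp (f : L3ac_func) :
    (forall i, L3_carrier (@L3ac_dom f i)) -> L3_carrier (L3ac_cod f) :=
  match f return (forall i, L3_carrier (@L3ac_dom f i)) -> L3_carrier (L3ac_cod f) with
  | f_ring o => @field_interp A o
  | r_ring o => @fieldoo_interp (af_k A) o
  | v_group o => @oagoo_interp (af_G A) o
  | sym_pi => fun a =>
      if vge 0 (arg1 a : A) then Some (coef 0 (arg1 a : A)) else None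
  | sym_v => fun a => if arg1 a == 0 :> A then None else Some (af_v (arg1 a))
  | sym_c => fun a => omap (@af_c A) (arg1 a)
  | sym_ac => fun a => Some (af_ac (arg1 a))
  end.

Definition L3S : structure L3ac := @Structure L3ac L3_carrier L3_finterp
  (fun _ (a : 'I_2 -> option (af_G A)) => leoo (arg2_1 a) (arg2_2 a)).

End L3Structure.

Section OptionRep.

(** A sequence of options is almost everywhere [None] or almost everywhere of the form [Some]; this
    identifies the ultrapower of an option type with the option of the ultrapower. *)
Definition opt_rep (T : Type) (x : nat -> option T) (y : option (upow T)) : Prop :=
  match y with
  | None => ultra (fun n => x n = None)
  | Some b => ultra (fun n => x n = Some (rep b n))
  end.

Lemma opt_rep_some T (x : nat -> option T) (z : nat -> T) :
  ultra (fun n => x n = Some (z n)) -> opt_rep x (Some (cls z)).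
Proof.
move=> H; apply: (U_sub ultraP) (U_and ultraP H (rep_cls z)) => n [-> ->] //.
Qed.

Lemma opt_rep_ex T (y : option (upow T)) : exists x, opt_rep x y.
Proof.
case: y => [b|]; [exists (fun n => Some (rep b n))|exists (fun=> None)];
  exact: (U_true ultraP).
Qed.

Lemma opt_rep_tot T (x : nat -> option T) : exists y, opt_rep x y.
Proof.
case: (pselect (ultra (fun n => x n = None))) => [H|]; first by exists None.
move/(U_not ultraP) => H.
have /choice [z Hz] n : exists z : option T, x n = z by exists (x n).
have [t0 _] : exists t : T, True.
  apply/not_notP => nT; apply: (U_false ultraP); apply: (U_sub ultraP) H => n.
  by case: (x n) => // t _; apply: nT; exists t.
exists (Some (cls (fun n => odflt t0 (x n)))); apply: opt_rep_some.
by apply: (U_sub ultraP) H => n; case: (x n).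
Qed.

Lemma opt_rep_eq T (x x' : nat -> option T) y y' : opt_rep x y -> opt_rep x' y' ->
  (y = y' <-> ultra (fun n => x n = x' n)).
Proof.
case: y => [b|]; case: y' => [b'|] /= H H'; split=> [E|E].
- by case: E H => -> H; apply: (U_sub ultraP) (U_and ultraP H H') => n [-> ->].
- congr Some; rewrite -(repK b) -(repK b'); apply/clsP.
  by apply: (U_sub ultraP) (U_and ultraP E (U_and ultraP H H')) => n [-> [-> []]].
- by [].
- case: (U_false ultraP).
  by apply: (U_sub ultraP) (U_and ultraP E (U_and ultraP H H')) => n [-> [->]].
- by [].
- case: (U_false ultraP).
  by apply: (U_sub ultraP) (U_and ultraP E (U_and ultraP H H')) => n [-> [->]].
- by apply: (U_sub ultraP) (U_and ultraP H H') => n [-> ->].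
- by [].
Qed.

Lemma opt_rep_omap (T1 T2 : Type) (f : T1 -> T2) (F : upow T1 -> upow T2) x y :
  (forall z, F (cls z) = cls (fun n => f (z n))) ->
  opt_rep x y -> opt_rep (fun n => omap f (x n)) (omap F y).
Proof.
move=> FE; case: y => [b|] /= H; last by apply: (U_sub ultraP) H => n ->.
have -> : F b = cls (fun n => f (rep b n)) by rewrite -FE repK.
apply: opt_rep_some.
by apply: (U_sub ultraP) H => n ->.
Qed.

Lemma opt_rep_omap2 (T : Type) (f : T -> T -> T) (F : upow T -> upow T -> upow T)
    x y x' y' : (forall z z', F (cls z) (cls z') = cls (fun n => f (z n) (z' n))) ->
  opt_rep x y -> opt_rep x' y' ->
  opt_rep (fun n => omap2 f (x n) (x' n)) (omap2 F y y').
Proof.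
move=> FE; case: y => [b|]; case: y' => [b'|] /= H H'.
- have -> : F b b' = cls (fun n => f (rep b n) (rep b' n)) by rewrite -FE !repK.
  by apply: opt_rep_some; apply: (U_sub ultraP) (U_and ultraP H H') => n [-> ->].
- by apply: (U_sub ultraP) (U_and ultraP H H') => n [-> ->].
- by apply: (U_sub ultraP) (U_and ultraP H H') => n [-> _].
- by apply: (U_sub ultraP) (U_and ultraP H H') => n [-> _].
Qed.

End OptionRep.

Section L3Los.
Variable A : acField.

Definition l3_rep (s : L3ac_sort) : (nat -> L3S A s) -> L3S (upow_model A) s -> Prop :=
  match s with
  | s_f => fun x y => y = cls x
  | s_r => fun x y => opt_rep x y
  | s_v => fun x y => opt_rep x y
  end.

Lemma l3_los p es e : @rep_assignment L3ac (L3S A) (L3S (upow_model A)) l3_rep es e ->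
  (sat p e <-> ultra (fun i => sat p (es i))).
Proof.
apply: (los ultraP).
- case=> y; [have [x ->] := cls_ex y; by exists x|exact: opt_rep_ex|exact: opt_rep_ex].
- case=> x; [by exists (cls x)|exact: opt_rep_tot|exact: opt_rep_tot].
- case=> x x' y y'; [by move=> -> ->; exact: clsP|exact: opt_rep_eq|exact: opt_rep_eq].
- case=> [[]|[]|[]||||] xs ys H /=;
    rewrite /field_interp /fieldoo_interp /oagoo_interp /= /arg1 /arg2_1 /arg2_2.
  + by rewrite -cls0.
  + by rewrite -cls1.
  + by rewrite (H ord0) clsN.
  + by rewrite (H ord0) (H ord_max) clsD.
  + by rewrite (H ord0) (H ord_max) clsM.
  + by rewrite (H ord0) cls_der.
  + by rewrite -cls0; apply: opt_rep_some; apply: (U_true ultraP).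
  + by rewrite -cls1; apply: opt_rep_some; apply: (U_true ultraP).
  + by apply: opt_rep_omap (H ord0); apply: clsN.
  + by apply: opt_rep_omap2 (H ord0) (H ord_max); apply: clsD.
  + by apply: opt_rep_omap2 (H ord0) (H ord_max); apply: clsM.
  + by apply: opt_rep_omap (H ord0); apply: cls_der.
  + by rewrite -cls0; apply: opt_rep_some; apply: (U_true ultraP).
  + by apply: opt_rep_omap (H ord0); apply: clsN.
  + by apply: opt_rep_omap2 (H ord0) (H ord_max); apply: clsD.
  + have -> : ys ord0 = cls (fun n => xs n ord0) by exact: (H ord0).
    have E : vge 0 (cls (fun n => xs n ord0) : upow_model A) =
      `[< ultra (fun n => vge 0 (xs n ord0 : A)) >] by rewrite -cls0; exact: cls_vcmp.
    have Ec : coef 0 (cls (fun n => xs n ord0) : upow_model A) =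
      cls (fun n => coef 0 (xs n ord0 : A)) by rewrite -cls0; exact: cls_coef.
    rewrite E; case: asboolP => U0.
      rewrite Ec; apply: opt_rep_some.
      by apply: (U_sub ultraP) U0 => n ->.
    by move/(U_not ultraP): U0; apply: (U_sub ultraP) => n /negP/negPf ->.
  + have -> : ys ord0 = cls (fun n => xs n ord0) by exact: (H ord0).
    rewrite cls_eq0; case: asboolP => U0.
      by apply: (U_sub ultraP) U0 => n ->; rewrite eqxx.
    rewrite /upow_v umapE.
    apply: opt_rep_some.
    by move/(U_not ultraP): U0; apply: (U_sub ultraP) => n /eqP/negPf ->.
  + by apply: opt_rep_omap (H ord0) => z; exact: umapE.
  + have -> : ys ord0 = cls (fun n => xs n ord0) by exact: (H ord0).
    rewrite /upow_ac umapE.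
    by apply: (U_sub ultraP) (rep_cls (fun n => af_ac (xs n ord0 : A))) => n ->.
case=> xs ys H /=; rewrite /arg2_1 /arg2_2.
have := H ord0; have := H ord_max => /=.
case: (ys ord0) => [a|]; case: (ys ord_max) => [b|] /= Hb Ha.
- rewrite -[a]repK -[b]repK [_ <= _]cls_le; split=> [/asboolP U0|U0].
    by apply: (U_sub ultraP) (U_and ultraP U0 (U_and ultraP Ha Hb)) => n [le [-> ->]].
  apply/asboolP.
  by apply: (U_sub ultraP) (U_and ultraP U0 (U_and ultraP Ha Hb)) => n [+ [E1 E2]];
    rewrite E1 E2.
- split=> // _; by apply: (U_sub ultraP) (U_and ultraP Ha Hb) => n [-> ->].
- split=> // U0; case: (U_false ultraP).
  by apply: (U_sub ultraP) (U_and ultraP U0 (U_and ultraP Ha Hb)) => n [+ [E1 E2]];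
    rewrite E1 E2.
- split=> // _; by apply: (U_sub ultraP) (U_and ultraP Ha Hb) => n [-> ->].
Qed.

End L3Los.

(** * Models of Mo(c, ac) *)

HB.instance Definition _ (K : valuedDiffField) :=
  GRing.RMorphism.copy (@residue K) (\pi_(resfield K))%qT.

Lemma valring_valD (K : valuedDiffField) (u w : valring K) :
  valring_val (u + w) = valring_val u + valring_val w.
Proof. exact: (raddfD (\val : valring K -> K)). Qed.

Lemma valring_valM (K : valuedDiffField) (u w : valring K) :
  valring_val (u * w) = valring_val u * valring_val w.
Proof. exact: (rmorphM (\val : valring K -> K)). Qed.

Lemma residue_eq0 (K : valuedDiffField) (u : valring K) :
  (residue u == 0) = (u \in @maxideal K).
Proof.
by rewrite -[u in RHS]subr0 Quotient.idealrBE -[0 in LHS](rmorph0 (@residue K)).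
Qed.

Section Valued.
Variable K : valuedDiffField.
Implicit Types (x y : K) (g h : vdf_group K) (s : bool).
Local Notation vcmpK := (val_cmp (@vdf_v K)).

Lemma valringE x : (x \in valring_pred K) = vcmpK false 0 x.
Proof. exact: valring_predE. Qed.

Lemma maxidealE (u : valring K) : (u \in @maxideal K) = vcmpK true 0 (valring_val u).
Proof. by []. Qed.

Lemma vdf_vcmpD s g x y : vcmpK s g x -> vcmpK s g y -> vcmpK s g (x + y).
Proof.
rewrite /val_cmp; case: (eqVneq x 0) => [->|x0] /=; first by rewrite add0r.
case: (eqVneq y 0) => [->|y0] /=; first by rewrite addr0 (negPf x0).
case: (eqVneq (x + y) 0) => //= xy0; have := vdf_vD x0 y0 xy0.
by case: s => H gx gy; [apply: lt_le_trans H|apply: le_trans H];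
  rewrite ?lt_min ?le_min gx gy.
Qed.

Lemma vdf_vcmpM s g h x y : vcmpK s g x -> vcmpK false h y -> vcmpK s (g + h) (x * y).
Proof.
rewrite /val_cmp mulf_eq0; case: (eqVneq x 0) => //= x0; case: (eqVneq y 0) => //= y0.
rewrite vdf_vM //; case: s => gx hy; last exact: oag_le_add.
by rewrite addrC [ltRHS]addrC; apply: oag_lt_add.
Qed.

Lemma vdf_vV x : x != 0 -> vdf_v x^-1 = - vdf_v x.
Proof.
move=> x0; apply/eqP; rewrite -addr_eq0 -vdf_vM ?invr_eq0 //.
by rewrite mulVf // vdf_v1.
Qed.

Lemma vcmpK_div s g x t : t != 0 -> vdf_v t = g -> vcmpK s 0 (x / t) = vcmpK s g x.
Proof.
move=> t0 vt; rewrite /val_cmp mulf_eq0 invr_eq0 (negPf t0) orbF.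
case: (eqVneq x 0) => //= x0; rewrite vdf_vM ?invr_eq0 // vdf_vV // vt.
by case: s; rewrite ?oag_ltBrD ?oag_leBrD add0r.
Qed.

Lemma vcmpK_sub (g : vdf_group K) x y : vcmpK false g x -> vcmpK true g y ->
  x != 0 -> vdf_v x = g -> x + y != 0 /\ vdf_v (x + y) = g.
Proof.
move=> gx gy x0 vx.
have nt : ~~ vcmpK true g (x + y).
  apply/negP => H; have := vdf_vcmpD H (_ : vcmpK true g (- y)).
  rewrite addrK /val_cmp (negPf x0) vx ltxx /= => /(_ _)/negP; apply => //.
  have : vcmpK true (g + 0) (y * -1).
    by apply: vdf_vcmpM => //; rewrite /val_cmp vdf_vN1 lexx orbT.
  by rewrite addr0 mulrN1.
have ge : vcmpK false g (x + y).
  by apply: vdf_vcmpD => //; case/orP: gy => [/eqP ->|/ltW H]; rewrite /val_cmp ?eqxx // H orbT.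
move: nt ge; rewrite /val_cmp negb_or => /andP[xy0 nlt]; rewrite (negPf xy0) /= => le.
by split => //; apply/eqP; rewrite eq_le le andbT leNgt.
Qed.

End Valued.

Section OfMoac.
Variable M : MoacModel.
Hypothesis dh : diff_henselian M.
Local Notation K := (vdf_sort M).
Local Notation k := (mo_k M).
Local Notation G := (vdf_group M).
Local Notation vcmpM := (val_cmp (@vdf_v M)).
Local Notation ac := (@moac_ac M).
Local Notation acP := (moac_acP M).

Definition to_valring (x : K) : valring M := insubd 0 x.

Lemma to_valringK x : vcmpM false 0 x -> valring_val (to_valring x) = x.
Proof. by rewrite -valringE => Hx; rewrite /to_valring insubdK. Qed.

Lemma valring_valK (u : valring M) : to_valring (valring_val u) = u.
Proof. exact: valKd. Qed.

Lemma valring_ge (u : valring M) : vcmpM false 0 (valring_val u).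
Proof. by rewrite -valringE; apply: valring_valP. Qed.

Lemma to_valring_inj (u w : valring M) : valring_val u = valring_val w -> u = w.
Proof. exact: val_inj. Qed.

Definition pr (x : K) : k := mo_pi M (to_valring x).

Lemma prD x y : vcmpM false 0 x -> vcmpM false 0 y -> pr (x + y) = pr x + pr y.
Proof.
move=> Hx Hy; rewrite /pr -rmorphD; congr (mo_pi M _); apply: to_valring_inj.
by rewrite to_valringK ?vdf_vcmpD // valring_valD !to_valringK.
Qed.

Lemma prM x y : vcmpM false 0 x -> vcmpM false 0 y -> pr (x * y) = pr x * pr y.
Proof.
move=> Hx Hy; rewrite /pr -rmorphM; congr (mo_pi M _); apply: to_valring_inj.
rewrite to_valringK; first by rewrite valring_valM !to_valringK.
by rewrite -[0]addr0 vdf_vcmpM.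
Qed.

Lemma pr1 : pr 1 = 1.
Proof.
rewrite /pr -(rmorph1 (mo_pi M)); congr (mo_pi M _); apply: to_valring_inj.
by rewrite to_valringK // /val_cmp vdf_v1 lexx orbT.
Qed.

Lemma ge_der g x : vcmpM false g x -> vcmpM false g (der x).
Proof.
rewrite /val_cmp; case: (eqVneq x 0) => [->|x0] /=; first by rewrite der0 eqxx.
move=> gx; have := @mo_monotone M _ x0; rewrite /valoo (negPf x0).
by case: (eqVneq (der x) 0) => //= _; apply: le_trans.
Qed.

Lemma pr_der x : vcmpM false 0 x -> pr (der x) = der (pr x).
Proof.
move=> Hx; have := mo_pi_der (to_valring x); rewrite to_valringK // /ext_valring.
have Hd := ge_der Hx; rewrite -valringE in Hd.
by rewrite (insubT (mem (valring_pred M)) Hd) /= => -[<-]; congr (mo_pi M _);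
  apply: to_valring_inj; rewrite to_valringK // -valringE.
Qed.

Lemma pr0 : pr 0 = 0.
Proof.
rewrite /pr -(rmorph0 (mo_pi M)); congr (mo_pi M _); apply: to_valring_inj.
by rewrite to_valringK // /val_cmp eqxx.
Qed.

Lemma vdf_vcmpN s g x : vcmpM s g (- x) = vcmpM s g x.
Proof.
have main z : vcmpM s g z -> vcmpM s g (- z).
  rewrite -mulrN1 -[g in X in _ -> X]addr0 => Hz; apply: vdf_vcmpM => //.
  by rewrite /val_cmp vdf_vN1 lexx orbT.
by apply/idP/idP => /main; rewrite ?opprK.
Qed.

Lemma prN x : vcmpM false 0 x -> pr (- x) = - pr x.
Proof.
by move=> Hx; apply/eqP; rewrite -addr_eq0 -prD ?vdf_vcmpN // addNr pr0.
Qed.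

Lemma pr_unit x : x != 0 -> vdf_v x = 0 -> pr x != 0.
Proof.
move=> x0 vx; apply/eqP => px; have := oner_neq0 k; rewrite -pr1 -(mulfV x0).
rewrite prM ?px ?mul0r ?eqxx //; first by rewrite /val_cmp vx lexx orbT.
by rewrite /val_cmp vdf_vV // vx oppr0 lexx orbT.
Qed.

(** The definition of a model does not name the kernel of [mo_pi]. If [pr x] were nonzero, an
    element [y] whose residue is its inverse would make [1 - x * y] a unit with residue 0. *)
Lemma pr_lt x : vcmpM true 0 x -> pr x = 0.
Proof.
move=> gt; apply/eqP; apply/negPn/negP => nz.
have ge : vcmpM false 0 x.
  by case/orP: gt => [/eqP ->|/ltW H]; rewrite /val_cmp ?eqxx // H orbT.
have [u Hu] := mo_pi_surj ((pr x)^-1); pose y := valring_val u.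
have Hy : vcmpM false 0 y by apply: valring_ge.
have py : pr y = (pr x)^-1 by rewrite /pr valring_valK Hu.
have ge1 : vcmpM false 0 (1 : K) by rewrite /val_cmp vdf_v1 lexx orbT.
have gtxy : vcmpM true 0 (- (x * y)).
  by rewrite vdf_vcmpN -[0]addr0; apply: vdf_vcmpM.
have [z0 vz] := vcmpK_sub ge1 gtxy (oner_neq0 _) (vdf_v1 _).
have gexy : vcmpM false 0 (x * y) by rewrite -[0]addr0; apply: vdf_vcmpM.
have := pr_unit z0 vz; rewrite prD ?vdf_vcmpN // prN // prM // py divff //.
by rewrite pr1 subrr eqxx.
Qed.

Lemma map_X_sub1 n (R S : comNzRingType) (f : {rmorphism R -> S}) (i : 'I_n) :
  map_mpoly f ('X_i - 1) = 'X_i - 1.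
Proof.
apply/mpolyP => m; rewrite mcoeff_map_mpoly /= !mcoeffB rmorphB.
by rewrite !mcoeffX !mcoeff1 !rmorph_nat.
Qed.

(** Differential-henselianity solves [Y' = 1], whose reduction has degree 1; the residue of a
    solution has derivative 1. *)
Lemma der_nontrivial : exists2 z : k, z != 0 & der z != 0.
Proof.
pose i1 : 'I_2 := ord_max.
pose P : {mpoly (valring M)[2]} := 'X_i1 - 1.
have [|y Hy] := dh (n := 1) (P := P).
  rewrite map_X_sub1; apply/eqP; rewrite eqn_leq; apply/andP; split.
    apply: leq_trans (msizeD_le _ _) _; rewrite msizeN msize1 msizeX mdeg1 //.
  have : U_(i1)%MM \in msupp ('X_i1 - 1 : {mpoly (resfield M)[2]}).
    rewrite mcoeff_msupp mcoeffB mcoeffX eqxx mcoeff1 mnm1_eq0 subr0.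
    exact: oner_neq0.
  by move/msize_mdeg_lt; rewrite mdeg1.
have d1 : der (valring_val y) = 1.
  move: Hy; rewrite (map_X_sub1 (\val : valring M -> M)) mevalB mevalXU meval1 /=.
  by move/eqP; rewrite subr_eq0 => /eqP.
have Hp : der (pr (valring_val y)) = 1 by rewrite -pr_der ?valring_ge // d1 pr1.
exists (pr (valring_val y)); last by rewrite Hp oner_neq0.
by apply/eqP => z; move: Hp; rewrite z der0 => /esym /eqP; rewrite oner_eq0.
Qed.

Lemma logder_ge x : x != 0 -> vcmpM false 0 (logder x).
Proof.
move=> x0; rewrite /logder (vcmpK_div _ _ x0 (erefl _)).
by apply: ge_der; rewrite /val_cmp lexx orbT.
Qed.

Lemma logderM (F : diffFieldType) (x y : F) : x != 0 -> y != 0 ->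
  logder (x * y) = logder x + logder y.
Proof.
move=> x0 y0; rewrite /logder derM mulrDl; congr (_ + _).
  by rewrite invfM mulrACA divff // mulr1.
by rewrite invfM mulrACA divff // mul1r.
Qed.

Lemma ac_pr x : x != 0 -> vdf_v x = 0 -> ac x = pr x.
Proof.
move=> x0 vx; have Hx : vcmpM false 0 x by rewrite /val_cmp vx lexx orbT.
rewrite -{1}(to_valringK Hx) (ac_unit acP) //.
by rewrite to_valringK // /valoo (negPf x0) vx.
Qed.

Lemma pr_logder_unit x : x != 0 -> ~~ vcmpM true 0 (logder x) ->
  pr (logder x) = logder (ac x) + mo_c M (vdf_v x).
Proof.
move=> x0 ngt; have ge := logder_ge x0.
have [l0 vl] : logder x != 0 /\ vdf_v (logder x) = 0.
  move: ngt ge; rewrite /val_cmp negb_or => /andP[l0 nlt]; rewrite (negPf l0) /= => le.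
  by split => //; apply/eqP; rewrite eq_le le andbT leNgt.
rewrite -ac_pr // (ac_logder acP) //.
have d0 : der x != 0 by apply: contraNneq l0; rewrite /logder => ->; rewrite mul0r.
rewrite /valoo (negPf x0) (negPf d0); congr Some.
by move: vl; rewrite /logder vdf_vM ?invr_eq0 // vdf_vV // => /eqP; rewrite subr_eq0 => /eqP.
Qed.

(* When [v (x') > v x], multiply [x] by a unit whose residue is not constant. *)
Lemma pr_logder x : x != 0 -> pr (logder x) = logder (ac x) + mo_c M (vdf_v x).
Proof.
move=> x0; case: (boolP (vcmpM true 0 (logder x))) => [gt|]; last exact: pr_logder_unit.
have [z z0 dz] := der_nontrivial; have [w Hw] := mo_pi_surj z.
pose u := valring_val w; have Hu : vcmpM false 0 u by apply: valring_ge.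
have pu : pr u = z by rewrite /pr valring_valK.
have u0 : u != 0 by apply: contraNneq z0 => E; rewrite -pu E pr0.
have vu : vdf_v u = 0.
  move: Hu; rewrite /val_cmp (negPf u0) /= => le; apply/eqP; rewrite eq_le le andbT.
  rewrite leNgt; apply: contra z0 => lt; rewrite -pu pr_lt // /val_cmp lt orbT //.
have lu : pr (logder u) = logder z.
  have E : logder u * u = der u by rewrite /logder divfK.
  have := pr_der Hu; rewrite -E prM ?logder_ge // pu => H.
  by rewrite [RHS]/logder -H mulfK.
have xu0 : x * u != 0 by rewrite mulf_neq0.
have Exu : pr (logder (x * u)) = logder z.
  by rewrite logderM // prD ?logder_ge // (pr_lt gt) add0r.
have lz0 : logder z != 0 by rewrite /logder mulf_neq0 ?invr_eq0.
have nvg : ~~ vcmpM true 0 (logder (x * u)).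
  by apply: contra lz0 => /pr_lt; rewrite Exu => ->.
have := pr_logder_unit xu0 nvg; rewrite Exu (ac_mul acP) // (ac_pr u0 vu) pu.
rewrite logderM ?(ac_neq0 acP) // vdf_vM // vu addr0 addrAC => H.
by rewrite (pr_lt gt); apply: (addIr (logder z)); rewrite add0r -H.
Qed.

Section Coefficient.
Variables (g : G) (t : K).
Hypotheses (t0 : t != 0) (vt : vdf_v t = g).

(** Division by an element [t] of valuation [g] turns the coefficient at [g] into a residue, from
    which additivity and the rule for derivatives are inherited. *)
Lemma coef_pr x : vcmpM false g x -> coef_at (@vdf_v M) ac g x = ac t * pr (x / t).
Proof.
move=> gx; rewrite /coef_at; case: ifP => [/andP[x0 /eqP vx]|].
  have xt0 : x / t != 0 by rewrite mulf_neq0 ?invr_eq0.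
  have vxt : vdf_v (x / t) = 0 by rewrite vdf_vM ?invr_eq0 // vdf_vV // vx vt subrr.
  by rewrite -ac_pr // -(ac_mul acP) // mulrC divfK.
move=> nx; rewrite pr_lt ?mulr0 // (vcmpK_div _ _ t0 vt).
move: nx gx; rewrite /val_cmp; case: (eqVneq x 0) => //= x0 nv le.
by rewrite lt_neqAle eq_sym nv.
Qed.

End Coefficient.

Lemma exists_val (g : G) : exists t : K, t != 0 /\ vdf_v t = g.
Proof. by have [t t0 vt] := vdf_v_surj g; exists t. Qed.

Lemma moac_ac_eq0 (x : K) : (ac x == 0) = (x == 0).
Proof.
case: (eqVneq x 0) => [->|x0]; first by rewrite (ac_0 acP) eqxx.
exact: negPf (ac_neq0 acP x0).
Qed.

Lemma moac_coefD g (x y : K) : vcmpM false g x -> vcmpM false g y ->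
  coef_at (@vdf_v M) ac g (x + y) = coef_at (@vdf_v M) ac g x + coef_at (@vdf_v M) ac g y.
Proof.
move=> gx gy; have [t [t0 vt]] := exists_val g.
rewrite !(coef_pr t0 vt) ?vdf_vcmpD // -mulrDr mulrDl prD //.
all: by rewrite (vcmpK_div _ _ t0 vt).
Qed.

(** With [x = t * u], dividing [der x] by [t] gives [logder t * u + der u]. The residue of
    [logder t] is [logder (ac t) + c(g)], and its first summand accounts for the derivative of the
    factor [ac t] of the coefficient. *)
Lemma moac_coef_der g (x : K) : vcmpM false g x ->
  coef_at (@vdf_v M) ac g (der x) =
  der (coef_at (@vdf_v M) ac g x) + mo_c M g * coef_at (@vdf_v M) ac g x.
Proof.
move=> gx; have [t [t0 vt]] := exists_val g.
rewrite !(coef_pr t0 vt) ?ge_der // derM.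
pose u := x / t; have Ex : x = t * u by rewrite mulrC divfK.
have Hu : vcmpM false 0 u by rewrite (vcmpK_div _ _ t0 vt).
have -> : der x / t = logder t * u + der u.
  by rewrite Ex derM mulrDl [t * _ / t]mulrAC divff // mul1r /logder mulrAC.
rewrite prD; last exact: ge_der; last first.
  by rewrite -[0]addr0; apply: vdf_vcmpM; first exact: logder_ge.
rewrite prM ?logder_ge // pr_logder // vt pr_der // -/u.
have act : ac t != 0 by apply: (ac_neq0 acP).
have -> : der (ac t) = ac t * logder (ac t) by rewrite /logder mulrC divfK.
ring.
Qed.

Lemma moac_surj g (d : k) : d != 0 -> exists x : K, [/\ x != 0, vdf_v x = g & ac x = d].
Proof.
move=> d0; have [t [t0 vt]] := exists_val g.
have act : ac t != 0 by apply: (ac_neq0 acP).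
have [w Hw] := mo_pi_surj (d / ac t); pose u := valring_val w.
have Hu : vcmpM false 0 u by apply: valring_ge.
have pu : pr u = d / ac t by rewrite /pr valring_valK.
have pu0 : pr u != 0 by rewrite pu mulf_neq0 ?invr_eq0.
have u0 : u != 0 by apply: contraNneq pu0 => E; rewrite E pr0.
have vu : vdf_v u = 0.
  move: Hu; rewrite /val_cmp (negPf u0) /= => le; apply/eqP; rewrite eq_le le andbT.
  rewrite leNgt; apply: contra pu0 => lt; rewrite pr_lt // /val_cmp lt orbT //.
exists (t * u); split; first exact: mulf_neq0.
  by rewrite vdf_vM // vu addr0.
by rewrite (ac_mul acP) // (ac_pr u0 vu) pu mulrC divfK.
Qed.

Definition of_moac : acField := @AcField M (mo_k M) (vdf_group M) (@vdf_v M) ac (mo_c M)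
  moac_ac_eq0 (@vdf_vM M) (ac_mul acP) (fun g x y => @vdf_vcmpD M false g x y)
  moac_coefD ge_der moac_coef_der moac_surj.

End OfMoac.

(** * From differential-henselianity to its Newton form *)

Section Leibniz.
Variable A : acField.

(* [(t * y)^(j) = t * \sum_l leibniz t j l * y^(l)] with coefficients in the
   valuation ring, by monotonicity. *)
Fixpoint leibniz (t : A) (j l : nat) : A :=
  match j with
  | 0 => (l == 0)%:R
  | j'.+1 => logder t * leibniz t j' l + der (leibniz t j' l) +
      (if l is l'.+1 then leibniz t j' l' else 0)
  end.

Lemma vge_logder (x : A) : x != 0 -> vge 0 (logder x).
Proof.
move=> x0; rewrite -(subrr (af_v x)) -af_vV //.
by apply: vgeM; [apply: vcmp_der; apply: vge_val|apply: vge_val].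
Qed.

Lemma leibniz_ge t j l : t != 0 -> vge 0 (leibniz t j l).
Proof.
move=> t0; elim: j l => [|j IH] l /=.
  by case: (l == 0); [apply: (@vge1 A)|apply: (@vcmp0 A)].
apply: vcmpD; last by case: l => [|l]; [apply: vcmp0|apply: IH].
apply: vcmpD; last exact: vcmp_der.
rewrite -[0]addr0; apply: vgeM => //; exact: vge_logder.
Qed.

Lemma leibniz_gt t j l : (j < l)%N -> leibniz t j l = 0.
Proof.
elim: j l => [|j IH] [|l] //=; rewrite ltnS => jl.
by rewrite !IH ?der0 ?mulr0 ?addr0 // ltnW.
Qed.

Lemma leibniz_diag t j : leibniz t j j = 1.
Proof. by elim: j => //= j ->; rewrite leibniz_gt // der0 mulr0 !add0r. Qed.

Lemma leibnizE t y N j : t != 0 -> (j <= N)%N ->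
  iter j der (t * y) = t * \sum_(l < N.+1) leibniz t j l * iter l der y.
Proof.
move=> t0; elim: j => [_|j IH jN].
  rewrite big_ord_recl /= mul1r big1 ?addr0 // => i _.
  by rewrite mul0r.
rewrite iterS IH; last exact: ltnW.
have derS (F : 'I_N.+1 -> A) : der (\sum_l F l) = \sum_l der (F l).
  by apply: (big_morph (der : A -> A) (@derD A) (der0 A)).
rewrite derM derS; have -> : der t = t * logder t by rewrite /logder mulrC divfK.
rewrite -mulrA -mulrDr; congr (t * _).
under [X in _ + X = _]eq_bigr do rewrite derM.
rewrite big_split /= mulr_sumr addrA -big_split /=.
under [RHS]eq_bigr do rewrite mulrDl.
rewrite [RHS]big_split /=; congr (_ + _).
  by apply: eq_bigr => l _; rewrite mulrDl mulrA.
rewrite big_ord_recr /= leibniz_gt // mul0r addr0.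
rewrite [RHS]big_ord_recl /= mul0r add0r.
by apply: eq_bigr => l _.
Qed.

End Leibniz.

Lemma split_degree n (K : comNzRingType) (Q : {mpoly K[n]}) : Q = (Q@_0)%:MP +
  \sum_(j < n) Q@_U_(j) *: 'X_j +
  \sum_(m <- msupp Q | (1 < mdeg m)%N) Q@_m *: 'X_[m].
Proof.
apply/mpolyP => m; rewrite !mcoeffD mcoeffC !raddf_sum /=.
have high : \sum_(i <- msupp Q | (1 < mdeg i)%N) (Q@_i *: 'X_[i])@_m =
    if (1 < mdeg m)%N then Q@_m else 0.
  rewrite big_mkcond /=; case: (boolP (m \in msupp Q)) => mQ.
    rewrite (bigD1_seq m) ?msupp_uniq //= big1 ?addr0 => [|m' m'm].
      by case: ifP => // _; rewrite mcoeffZ mcoeffX eqxx mulr1.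
    by case: ifP => // _; rewrite mcoeffZ mcoeffX (negPf m'm) mulr0.
  rewrite (memN_msupp_eq0 mQ) if_same big1_seq // => m' /= m'Q; case: ifP => // _.
  by rewrite mcoeffZ mcoeffX; case: eqP => [E|_]; rewrite ?mulr0 //; rewrite -E m'Q in mQ.
rewrite {}high; case: (eqVneq m 0%MM) => [->|m0].
  rewrite mdeg0 /= mulr1 addr0 big1 ?addr0 // => j _.
  by rewrite mcoeffZ mcoeffX mnm1_eq0 mulr0.
rewrite mulr0 add0r; case: (eqVneq (mdeg m) 1%N) => [/eqP m1|m1].
  have /mdeg1P [i /eqP Ei] := m1; rewrite Ei mdeg1 /= addr0 (bigD1 i) //= big1 ?addr0.
    by rewrite mcoeffZ mcoeffX eqxx mulr1.
  by move=> j ji; rewrite mcoeffZ mcoeffX eq_mnm1 (negPf ji) mulr0.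
rewrite big1 ?add0r => [|j _].
  have : mdeg m != 0%N by rewrite mdeg_eq0.
  by case: (mdeg m) m1 => [|[|?]].
rewrite mcoeffZ mcoeffX; case: eqP => [E|_]; last by rewrite mulr0.
by move: m1; rewrite -E mdeg1 eqxx.
Qed.

Section Newtonian.
Variables (A : acField) (O F : comNzRingType).
Variables (val : {rmorphism O -> A}) (res : {rmorphism O -> F}) (tov : A -> O).
Hypothesis valge : forall u, vge 0 (val u).
Hypothesis tovK : forall x, vge 0 x -> val (tov x) = x.
Hypothesis res0 : forall x, vge 0 x -> (res (tov x) == 0) = vgt 0 x.
Hypothesis res1 : res (tov 1) = 1.
Hypothesis dh : forall n (P : {mpoly O[n.+1]}), msize (map_mpoly res P) = 2%N ->
  exists y : O, (map_mpoly val P).@[fun i : 'I_n.+1 => iter i der (val y)] = 0.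

Lemma res_tov0 : res (tov 0) = 0.
Proof. by apply/eqP; rewrite res0 vcmp0. Qed.

Definition ev n (y : A) (P : {mpoly O[n]}) : A :=
  (map_mpoly val P).@[fun i : 'I_n => iter i der y].

Lemma evC n y c : ev y (c%:MP : {mpoly O[n]}) = val c.
Proof. by rewrite /ev map_mpolyC mevalC. Qed.

Lemma evX n y (i : 'I_n) : ev y ('X_i : {mpoly O[n]}) = iter i der y.
Proof. by rewrite /ev map_mpolyX mevalXU. Qed.

Lemma evZ n y c (P : {mpoly O[n]}) : ev y (c *: P) = val c * ev y P.
Proof. by rewrite /ev map_mpolyZ mevalZ. Qed.

Lemma evD n y (P Q : {mpoly O[n]}) : ev y (P + Q) = ev y P + ev y Q.
Proof. by rewrite /ev (raddfD (map_mpoly val)) mevalD. Qed.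

Lemma evM n y (P Q : {mpoly O[n]}) : ev y (P * Q) = ev y P * ev y Q.
Proof. by rewrite /ev (rmorphM (map_mpoly val)) mevalM. Qed.

Lemma ev0 n y : ev y (0 : {mpoly O[n]}) = 0.
Proof. by rewrite -mpolyC0 evC rmorph0. Qed.

Lemma ev1 n y : ev y (1 : {mpoly O[n]}) = 1.
Proof. by rewrite -mpolyC1 evC rmorph1. Qed.

Lemma evXn n y (P : {mpoly O[n]}) m : ev y (P ^+ m) = ev y P ^+ m.
Proof. by elim: m => [|m IH]; rewrite ?expr0 ?ev1 // !exprS evM IH. Qed.

Definition ev_sum n y := big_morph (ev y) (@evD n y) (@ev0 n y).
Definition ev_prod n y := big_morph (ev y) (@evM n y) (@ev1 n y).

(** Rescaling: with [t] of valuation [g] and [s] of valuation [d], the polynomial Q(tY)/s has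
    coefficients in the valuation ring, and in its reduction all terms of degree above 1 vanish. *)
Lemma henselian_newtonian : newtonian (fun _ : A => True).
Proof.
move=> [|n] Q g d _ c0 c1 [i0 ci] c2; first by case: (i0) => m; rewrite ltn0.
have [t [t0 vt _]] := af_surj g (oner_neq0 (af_k A)).
have [s [s0 vs _]] := af_surj d (oner_neq0 (af_k A)).
pose q m : A := Q@_m * t ^+ mdeg m / s.
have ge_div b (x : A) : vcmp b d x -> vcmp b 0 (x / s).
  by move=> H; rewrite -(subrr d) -{2}vs -af_vV //; apply: vcmpM H (vge_val _).
have div_ge b (x : A) : vcmp b 0 (x / s) -> vcmp b d x.
  by move=> H; rewrite -(divfK s0 x) -[d]add0r -vs; apply: vcmpM H (vge_val _).
have gt : vge g (t : A) by rewrite -vt vge_val.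
have qge b m : vcmp b (d - g *+ mdeg m) Q@_m -> vcmp b 0 (q m).
  move=> H; apply: ge_div; rewrite -[d](subrK (g *+ mdeg m)).
  by apply: vcmpM => //; apply: vgeX.
have q0 : vge 0 (q 0%MM) by apply: qge; rewrite mdeg0 mulr0n subr0.
have q1 j : vge 0 (q U_(j)%MM) by apply: qge; rewrite mdeg1 mulr1n.
have q2 m : (1 < mdeg m)%N -> vgt 0 (q m) by move=> m1; apply: qge; apply: c2.
have qn : ~~ vgt 0 (q U_(i0)%MM).
  apply: contra ci => /div_ge; rewrite mdeg1 expr1 => H.
  have := vcmpM H (_ : vge (- g) (t^-1 : A)); rewrite mulfK //; apply.
  by rewrite -vt -af_vV // vge_val.
(* [N j] stands for the derivative of order [j] of [t * Y], divided by [t]: a linear form over the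
   valuation ring. *)
pose N (j : 'I_n.+1) : {mpoly O[n.+1]} := \sum_(l < n.+1) tov (leibniz t j l) *: 'X_l.
pose P : {mpoly O[n.+1]} := (tov (q 0%MM))%:MP +
  \sum_(j < n.+1) tov (q U_(j)%MM) *: N j +
  \sum_(m <- msupp Q | (1 < mdeg m)%N) tov (q m) *: \prod_(j < n.+1) N j ^+ m j.
have NE (y : A) (j : 'I_n.+1) : ev y (N j) = iter j der (t * y) / t.
  have jn : (j <= n)%N by rewrite -ltnS.
  have {jn}E := leibnizE y t0 jn.
  rewrite [in RHS]E {E} [RHS]mulrAC divff // mul1r /N ev_sum.
  by apply: eq_bigr => l _; rewrite evZ evX tovK // leibniz_ge.
have fracE (a b c : A) : c != 0 -> a * c / s * (b / c) = a * b / s.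
  by move=> nz; field; rewrite nz s0.
have PE (y : A) : ev y P = Q.@[jet (t * y)] / s.
  rewrite [in RHS](split_degree Q) /P !evD !mevalD !mulrDl; congr (_ + _ + _).
  - by rewrite evC mevalC tovK // /q mdeg0 expr0 mulr1.
  - rewrite ev_sum (raddf_sum (meval _)) /= mulr_suml; apply: eq_bigr => j _.
    rewrite evZ mevalZ mevalXU NE tovK // /q mdeg1 expr1 /jet.
    exact: fracE.
  rewrite ev_sum (raddf_sum (meval _)) /= mulr_suml; apply: eq_bigr => m m1.
  rewrite evZ mevalZ tovK; last by apply: vgtW; apply: q2.
  rewrite ev_prod mevalX /q.
  have -> : \prod_(j < n.+1) ev y (N j ^+ m j) =
      (\prod_(j < n.+1) jet (t * y) j ^+ m j) / t ^+ mdeg m.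
    rewrite mdegE -prodrXr -prodf_div; apply: eq_bigr => j _.
    by rewrite evXn NE expr_div_n.
  by rewrite fracE // expf_neq0.
have [|y Hy] := dh (P := P); last first.
  rewrite -/(ev (val y) P) in Hy; exists (t * val y); split => //.
    by rewrite -[g]addr0; apply: vgeM.
  move: Hy; rewrite PE => /eqP; rewrite mulf_eq0 invr_eq0 (negPf s0) orbF.
  by move/eqP.
pose r (x : A) : F := res (tov x).
have resP : map_mpoly res P = (r (q 0%MM))%:MP +
    \sum_(j < n.+1) r (q U_(j)%MM) *: \sum_(l < n.+1) r (leibniz t j l) *: 'X_l.
  have high : map_mpoly res (\sum_(m <- msupp Q | (1 < mdeg m)%N)
      tov (q m) *: \prod_(j < n.+1) N j ^+ m j) = 0.
    rewrite (raddf_sum (map_mpoly res)) /= big1 // => m m1.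
    have /eqP r0 : res (tov (q m)) == 0 by rewrite res0 ?q2 //; apply: vgtW; apply: q2.
    by rewrite map_mpolyZ r0 scale0r.
  rewrite /P (raddfD (map_mpoly res)) /= high addr0 (raddfD (map_mpoly res)) /= map_mpolyC.
  congr (_ + _); rewrite (raddf_sum (map_mpoly res)) /=; apply: eq_bigr => j _.
  rewrite map_mpolyZ /N (raddf_sum (map_mpoly res)) /=; congr (_ *: _).
  by apply: eq_bigr => l _; rewrite map_mpolyZ map_mpolyX.
have coefL m : (map_mpoly res P)@_m = r (q 0%MM) * (m == 0%MM)%:R +
    \sum_(j < n.+1) r (q U_(j)%MM) * \sum_(l < n.+1) r (leibniz t j l) * (U_(l)%MM == m)%:R.
  rewrite resP mcoeffD mcoeffC eq_sym raddf_sum /=; congr (_ + _).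
  apply: eq_bigr => j _; rewrite mcoeffZ raddf_sum /=; congr (_ * _).
  by apply: eq_bigr => l _; rewrite mcoeffZ mcoeffX.
apply/eqP; rewrite eqn_leq; apply/andP; split.
  rewrite msizeE; apply/bigmax_leqP_seq => m mP _; rewrite ltnS leqNgt.
  apply: contraL mP => m1; rewrite -mcoeff_eq0 coefL; apply/eqP.
  have /negPf -> : m != 0%MM by rewrite -mdeg_eq0; case: (mdeg m) m1.
  rewrite mulr0 add0r big1 // => j _; rewrite big1 ?mulr0 // => l _.
  case: eqP => [E|_]; last by rewrite mulr0.
  by move: m1; rewrite -E mdeg1.
have rn : r (q U_(i0)%MM) != 0 by rewrite res0.
(* The reduction has degree exactly 1. For the largest [j] with a surviving coefficient, earlier
   forms [N i] do not contain the variable [j], later ones have vanishing coefficients, and [N j]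
   contains it with coefficient 1. *)
have [j rj jmax] := @arg_maxnP _ i0 (fun j => r (q U_(j)%MM) != 0) (fun j => j : nat) rn.
suff : U_(j)%MM \in msupp (map_mpoly res P) by move/msize_mdeg_lt; rewrite mdeg1.
rewrite mcoeff_msupp coefL mnm1_eq0 mulr0 add0r (bigD1 j) //= [X in _ + X]big1 ?addr0 => [|i ij].
  rewrite (bigD1 j) //= big1 ?addr0 => [|l lj].
    by rewrite leibniz_diag eqxx mulr1 /r res1 mulr1.
  by rewrite eq_mnm1 (negPf lj) mulr0.
rewrite (bigD1 j) //= big1 ?addr0 => [|l lj]; last by rewrite eq_mnm1 (negPf lj) mulr0.
case: (ltngtP i j) => [lt|gt'|E].
- by rewrite leibniz_gt // /r res_tov0 mul0r mulr0.
- case: (eqVneq (r (q U_(i)%MM)) 0) => [->|/jmax]; first by rewrite mul0r.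
  by rewrite /= leqNgt gt'.
- by move: ij; rewrite -(inj_eq val_inj) /= E eqxx.
Qed.

End Newtonian.

Lemma newtonian_of_moac (M : MoacModel) (dh : diff_henselian M) :
  newtonian (fun _ : of_moac dh => True).
Proof.
apply: (@henselian_newtonian (of_moac dh) (valring M) (resfield M)
  (\val : valring M -> M) (@residue M) (@to_valring M)).
- exact: valring_ge.
- exact: to_valringK.
- by move=> x ge; rewrite residue_eq0 maxidealE to_valringK.
- rewrite -[RHS](rmorph1 (@residue M)); congr residue; apply: val_inj.
  by rewrite /= to_valringK //; apply: (@vge1 (of_moac dh)).
- by move=> n P /dh.
Qed.

(** * Back-and-forth *)

Section BackAndForth.

Definition opt_rel (T1 T2 : Type) (R : T1 * T2 -> Prop) (x : option T1) (y : option T2) :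
    Prop :=
  match x, y with
  | Some a, Some b => R (a, b)
  | None, None => True
  | _, _ => False
  end.

Definition l3_rel (A1 A2 : acField) (Rf : A1 * A2 -> Prop) (Rr : af_k A1 * af_k A2 -> Prop)
    (Rv : af_G A1 * af_G A2 -> Prop) (s : L3ac_sort) : L3S A1 s -> L3S A2 s -> Prop :=
  match s with s_f => fun x y => Rf (x, y) | s_r => opt_rel Rr | s_v => opt_rel Rv end.

Lemma variant_ex (L : signature) (M : structure L) (e : assignment M) s n (y : M s) :
  exists e', variant s n e e' /\ e' s n = y.
Proof.
pose y' : forall s', M s' := fun s' => match pselect (s = s') with
  | left E => eq_rect s (carrier M) y s' E | right _ => e s' n end.
have y'E : y' s = y.
  by rewrite /y'; case: pselect => // E; rewrite (Prop_irrelevance E (erefl s)).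
exists (mix (fun s' m => (s', m) = (s, n)) (fun s' _ => y' s') e).
split=> [s' m nE|]; first exact: mixF.
by rewrite mixT.
Qed.

Section Relation.
Variables (A1 A2 : acField).
Implicit Types (Rf : A1 * A2 -> Prop) (Rr : af_k A1 * af_k A2 -> Prop).
Implicit Types (Rv : af_G A1 * af_G A2 -> Prop).

Lemma rv_match_vge Rr Rv (iso : rv_iso Rr Rv) w d : rv_match Rr Rv w -> Rv d ->
  vge d.1 w.1 = vge d.2 w.2.
Proof.
move=> mw Rd; have E := rv_match0 iso mw; case: mw => _ vw.
case: (eqVneq w.1 0) => w1.
  by move: E; rewrite w1 eqxx => /esym/eqP ->; rewrite !vcmp0.
have w2 : w.2 != 0 by rewrite -E.
by rewrite !vgeE // (rv_le iso Rd (vw w1)).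
Qed.

Lemma opt_rel_omap (T1 T2 U1 U2 : Type) (R : T1 * T2 -> Prop) (S : U1 * U2 -> Prop)
    (f1 : T1 -> U1) (f2 : T2 -> U2) x y :
  (forall a b, R (a, b) -> S (f1 a, f2 b)) ->
  opt_rel R x y -> opt_rel S (omap f1 x) (omap f2 y).
Proof. by move=> H; case: x => [a|]; case: y => [b|] //=; apply: H. Qed.

Lemma opt_rel_omap2 (T1 T2 : Type) (R : T1 * T2 -> Prop)
    (f1 : T1 -> T1 -> T1) (f2 : T2 -> T2 -> T2) x y x' y' :
  (forall a b a' b', R (a, b) -> R (a', b') -> R (f1 a a', f2 b b')) ->
  opt_rel R x y -> opt_rel R x' y' -> opt_rel R (omap2 f1 x x') (omap2 f2 y y').
Proof.
move=> H; case: x => [a|]; case: y => [b|] //=; case: x' => [a'|]; case: y' => [b'|] //=.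
exact: H.
Qed.

Lemma l3_rel_eval Rf Rr Rv (e1 : assignment (L3S A1)) (e2 : assignment (L3S A2)) :
  good Rf Rr Rv -> (forall s n, l3_rel Rf Rr Rv (e1 s n) (e2 s n)) ->
  forall s (t : term s), l3_rel Rf Rr Rv (eval e1 t) (eval e2 t).
Proof.
move=> [iso _ fiso] He s; elim=> {s} [s n|f ts IH]; first exact: He.
have dsr := rr_ring iso; have dsf := rf_ring fiso.
case: f ts IH => [[]|[]|[]||||] ts IH /=;
  rewrite /field_interp /fieldoo_interp /oagoo_interp /= /arg1 /arg2_1 /arg2_2.
- exact: (ds_0 dsf).
- exact: (ds_1 dsf).
- exact: (ds_N dsf (IH ord0)).
- exact: (ds_D dsf (IH ord0) (IH ord_max)).
- exact: (ds_M dsf (IH ord0) (IH ord_max)).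
- exact: (ds_der dsf (IH ord0)).
- exact: (ds_0 dsr).
- exact: (ds_1 dsr).
- by apply: opt_rel_omap (IH ord0) => a b; apply: (ds_N dsr).
- by apply: opt_rel_omap2 (IH ord0) (IH ord_max) => a b a' b'; apply: (ds_D dsr).
- by apply: opt_rel_omap2 (IH ord0) (IH ord_max) => a b a' b'; apply: (ds_M dsr).
- by apply: opt_rel_omap (IH ord0) => a b; apply: (ds_der dsr).
- exact: (rv_0 iso).
- by apply: opt_rel_omap (IH ord0) => a b; apply: (rv_N iso).
- by apply: opt_rel_omap2 (IH ord0) (IH ord_max) => a b a' b'; apply: (rv_D iso).
- have mw := rf_match fiso (IH ord0 : Rf _); have R0 := rv_0 iso.
  have := rv_match_vge iso mw R0; rewrite /= => E; rewrite -E.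
  by case: ifP => // ge; case: (match_graded iso mw R0 ge).
- have mw := rf_match fiso (IH ord0 : Rf _).
  have := rv_match0 iso mw; rewrite /= => <-.
  by case: eqP => //= /eqP; case: mw => _; apply.
- by apply: opt_rel_omap (IH ord0) => a b; apply: (rv_cmap iso).
- by case: (rf_match fiso (IH ord0 : Rf _)).
Qed.

Lemma l3_rel_eq Rf Rr Rv : good Rf Rr Rv -> forall s x y x' y',
  @l3_rel A1 A2 Rf Rr Rv s x y -> @l3_rel A1 A2 Rf Rr Rv s x' y' -> x = x' -> y = y'.
Proof.
move=> [iso _ fiso] [] x y x' y' /=.
- move=> Rx Rx' E; have R := ds_B (rf_ring fiso) Rx Rx'.
  have /= := rv_match0 iso (rf_match fiso R).
  by rewrite E subrr eqxx => /esym; rewrite subr_eq0 => /eqP.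
- case: x y x' y' => [a|] [b|] [a'|] [b'|] //= Ra Ra' [E].
  have /= := rr_eq0 iso (ds_B (rr_ring iso) Ra Ra').
  by rewrite E subrr eqxx => /esym; rewrite subr_eq0 => /eqP ->.
- case: x y x' y' => [a|] [b|] [a'|] [b'|] //= Ra Ra' [E].
  by have /= := rv_eq iso Ra Ra'; rewrite E eqxx => /esym/eqP ->.
Qed.

Hypothesis newt1 : newtonian (fun _ : A1 => True).
Hypothesis newt2 : newtonian (fun _ : A2 => True).
Hypotheses (ball2 : ball_saturated A2) (rvsat2 : rv_saturated A2).

(** Only field elements have to be adjoined: a nonzero element of k, or any element of Gamma, is the
    angular component or the valuation of a nonzero field element, and its partner is read off from
    the new pair. In [sr] and [sv] the value 0 stands in for [None]. *)
Lemma l3_extend Rf Rr Rv (e1 : assignment (L3S A1)) (e2 : assignment (L3S A2)) :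
  good Rf Rr Rv -> (forall s n, l3_rel Rf Rr Rv (e1 s n) (e2 s n)) ->
  forall s (x : L3S A1 s), exists Rf' Rr' Rv', [/\ good Rf' Rr' Rv',
    forall s n, l3_rel Rf' Rr' Rv' (e1 s n) (e2 s n) & exists y, l3_rel Rf' Rr' Rv' x y].
Proof.
move=> gR He.
pose sr n := (odflt 0 (e1 s_r n), odflt 0 (e2 s_r n)).
pose sv n := (odflt 0 (e1 s_v n), odflt 0 (e2 s_v n)).
have Rsr n : Rr (sr n).
  rewrite /sr; have /= := He s_r n; case: (e1 s_r n) (e2 s_r n) => [a|] [b|] //= _.
  exact: (ds_0 (rr_ring (good_rv gR))).
have Rsv n : Rv (sv n).
  rewrite /sv; have /= := He s_v n; case: (e1 s_v n) (e2 s_v n) => [a|] [b|] //= _.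
  exact: (rv_0 (good_rv gR)).
have ext (a : A1) : exists Rf' Rr' Rv', [/\ good Rf' Rr' Rv',
    forall s n, l3_rel Rf' Rr' Rv' (e1 s n) (e2 s n) & exists b, Rf' (a, b)].
  have [Rf' [Rr' [Rv' [g' Sf Sr Sv Hb]]]] :=
    extend_good newt1 newt2 ball2 rvsat2 a gR (He s_f) Rsr Rsv.
  exists Rf', Rr', Rv'; split => // -[] n; first exact: Sf.
    have /= := He s_r n; have := Sr n; rewrite /sr.
    by case: (e1 s_r n) (e2 s_r n) => [?|] [?|].
  have /= := He s_v n; have := Sv n; rewrite /sv.
  by case: (e1 s_v n) (e2 s_v n) => [?|] [?|].
case=> [a|[d|]|[g|]]; [exact: ext| |by exists Rf, Rr, Rv; split => //; exists None| |
  by exists Rf, Rr, Rv; split => //; exists None].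
  case: (eqVneq d 0) => [->|d0].
    exists Rf, Rr, Rv; split => //; exists (Some 0).
    exact: (ds_0 (rr_ring (good_rv gR))).
  have [a [a0 _ ad]] := af_surj 0 d0.
  have [Rf' [Rr' [Rv' [g' He' [b Rb]]]]] := ext a; exists Rf', Rr', Rv'; split => //.
  by exists (Some (af_ac b)); rewrite -ad; case: (rf_match (good_f g') Rb).
have [a [a0 ag _]] := af_surj g (oner_neq0 (af_k A1)).
have [Rf' [Rr' [Rv' [g' He' [b Rb]]]]] := ext a; exists Rf', Rr', Rv'; split => //.
by exists (Some (af_v b)); rewrite -ag; case: (rf_match (good_f g') Rb) => _; apply.
Qed.

End Relation.

Lemma l3_rel_swap (A1 A2 : acField) Rf Rr Rv s x y : @l3_rel A1 A2 Rf Rr Rv s x y ->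
  l3_rel (fun z => Rf (z.2, z.1)) (fun z => Rr (z.2, z.1)) (fun z => Rv (z.2, z.1)) y x.
Proof. by case: s x y => [x y|[x|] [y|]|[x|] [y|]]. Qed.

Definition saturated (A : acField) : Prop :=
  [/\ newtonian (fun _ : A => True), ball_saturated A & rv_saturated A].

(** A single implication, for all pairs of saturated models at once: the premise of an implication
    and the choice of a quantified element go in the opposite direction, which [good_swap]
    provides. *)
Lemma back_and_forth p : forall (A1 A2 : acField), saturated A1 -> saturated A2 ->
  forall Rf Rr Rv, good Rf Rr Rv ->
  forall (e1 : assignment (L3S A1)) (e2 : assignment (L3S A2)),
  (forall s n, l3_rel Rf Rr Rv (e1 s n) (e2 s n)) -> sat p e1 -> sat p e2.
Proof.
elim: p => [|s t u|r ts|p IHp q IHq|s n p IHp] A1 A2 S1 S2 Rf Rr Rv gR e1 e2 He //=.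
- exact: (l3_rel_eq gR (l3_rel_eval gR He t) (l3_rel_eval gR He u)).
- case: r ts => ts; have := l3_rel_eval gR He (ts ord0).
  have := l3_rel_eval gR He (ts ord_max); rewrite /= /arg2_1 /arg2_2.
  case: (eval e1 (ts ord_max)) (eval e2 (ts ord_max)) => [a|] [b|] //= Rb;
    case: (eval e1 (ts ord0)) (eval e2 (ts ord0)) => [a'|] [b'|] //= Ra.
  by rewrite (rv_le (good_rv gR) Ra Rb).
- move=> H p2; apply: (IHq _ _ S1 S2 _ _ _ gR _ _ He); apply: H.
  by apply: (IHp _ _ S2 S1 _ _ _ (good_swap gR) e2) => // s n; apply: l3_rel_swap.
move=> H e2' ve2'; have [newt1 ball1 rvsat1] := S1; have [newt2 _ _] := S2.
have He' s' m := l3_rel_swap (He s' m).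
have [Rf' [Rr' [Rv' [g' He2 [y Ry]]]]] :=
  l3_extend newt2 newt1 ball1 rvsat1 (good_swap gR) He' (e2' s n).
have [e1' [ve1' E1]] := variant_ex e1 n y.
apply: (IHp _ _ S1 S2 _ _ _ (good_swap g') e1'); last exact: H.
move=> s' m; apply: l3_rel_swap; case: (pselect ((s', m) = (s, n))) => [E|nE].
  by case: E => E' ->; subst s'; rewrite E1.
by rewrite ve1' // ve2'.
Qed.

End BackAndForth.

Lemma saturated_upow (M : MoacModel) (dh : diff_henselian M) :
  saturated (upow_model (of_moac dh)).
Proof.
split; [|exact: upow_ball_saturated|exact: upow_rv_saturated].
by apply: upow_newtonian; apply: newtonian_of_moac.
Qed.

Lemma sat_finterp (L : signature) (C : sort L -> Type)
    (F F' : forall f : func L, (forall i, C (@fdom L f i)) -> C (fcod f))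
    (R : forall r : rel L, (forall i, C (@rdom L r i)) -> Prop) p (e : forall s, nat -> C s) :
  F = F' -> @sat L (Structure F R) p e <-> @sat L (Structure F' R) p e.
Proof. by move=> ->. Qed.

Lemma ext_valringE (M : MoacModel) (dh : diff_henselian M) (x : of_moac dh) :
  ext_valring (mo_pi M) x = if vge 0 x then Some (coef 0 x) else None.
Proof.
rewrite /ext_valring; case: ifP => Hx.
  have Vx : x \in valring_pred M by rewrite valringE.
  rewrite (insubT (mem (valring_pred M)) Vx) /=; congr Some.
  rewrite (coef_pr (oner_neq0 M) (vdf_v1 M) Hx) divr1.
  rewrite (ac_pr (oner_neq0 M) (vdf_v1 M)) pr1 mul1r /pr; congr (mo_pi M _).
  by apply: val_inj; rewrite /= to_valringK.
rewrite insubF //; rewrite -valringE in Hx; exact: Hx.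
Qed.

Lemma sat_of_moac (M : MoacModel) (dh : diff_henselian M) p
    (e : assignment (L3ac_structure M)) : sat p e <-> @sat L3ac (L3S (of_moac dh)) p e.
Proof.
apply: (@sat_finterp L3ac (@L3ac_carrier M) (@L3ac_finterp M) (@L3_finterp (of_moac dh))).
apply: functional_extensionality_dep => f; apply: functional_extensionality_dep => a.
by case: f a => [o|o|o||||] a //; exact: (@ext_valringE M dh (arg1 a)).
Qed.

(** * Transferring the good map to the ultrapowers *)

Lemma ultra_const (P : Prop) : ultra (fun _ => P) <-> P.
Proof.
split=> [H|p]; last exact: (U_true ultraP).
by apply/not_notP => nP; apply: (U_false ultraP); apply: (U_sub ultraP) H.
Qed.

Definition const (T : Type) (x : T) : upow T := cls (fun _ => x).

Lemma const_inj T (x y : T) : const x = const y -> x = y.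
Proof. by move/clsP/ultra_const. Qed.

Lemma const_eq0 (V : zmodType) (x : V) : (const x == 0) = (x == 0).
Proof. by apply/eqP/eqP => [|->] //; rewrite -cls0; apply: const_inj. Qed.

Definition const_graph (T1 T2 : Type) (E : {pred T1}) (f : T1 -> T2)
    (z : upow T1 * upow T2) : Prop :=
  exists2 x, x \in E & z = (const x, const (f x)).

Section ConstField.
Variables (K1 K2 : diffFieldType) (E1 : {pred K1}) (E2 : {pred K2}) (f : K1 -> K2).
Hypothesis sE : diff_subfield E1.
Hypothesis iso : diff_field_iso E1 E2 f.

Lemma subfield_1 : 1 \in E1. Proof. by case: sE => [[]]. Qed.
Lemma subfield_B x y : x \in E1 -> y \in E1 -> x - y \in E1.
Proof. by case: sE => [[_ H _] _]; apply: H. Qed.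
Lemma subfield_div x y : x \in E1 -> y \in E1 -> x / y \in E1.
Proof. by case: sE => [[_ _ H] _]; apply: H. Qed.
Lemma subfield_0 : 0 \in E1.
Proof. by rewrite -(subrr 1) subfield_B ?subfield_1. Qed.
Lemma subfield_V x : x \in E1 -> x^-1 \in E1.
Proof. by move=> Ex; rewrite -[x^-1]mul1r subfield_div ?subfield_1. Qed.
Lemma subfield_M x y : x \in E1 -> y \in E1 -> x * y \in E1.
Proof. by move=> Ex Ey; rewrite -[y]invrK subfield_div ?subfield_V. Qed.

Lemma iso_0 : f 0 = 0.
Proof. by apply: (addrI (f 0)); rewrite -(dfi_D iso) ?subfield_0 // !addr0. Qed.

Lemma iso_B x y : x \in E1 -> y \in E1 -> f (x - y) = f x - f y.
Proof.
move=> Ex Ey; apply: (addIr (f y)); rewrite -(dfi_D iso) ?subfield_B //.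
by rewrite !subrK.
Qed.

Lemma iso_eq0 x : x \in E1 -> (f x == 0) = (x == 0).
Proof.
move=> Ex; apply/eqP/eqP => [E|->]; last exact: iso_0.
by apply: (dfi_inj iso) => //; rewrite ?subfield_0 // iso_0.
Qed.

Lemma iso_V x : x \in E1 -> f x^-1 = (f x)^-1.
Proof.
move=> Ex; case: (eqVneq x 0) => [->|x0]; first by rewrite invr0 iso_0 invr0.
have fx0 : f x != 0 by rewrite iso_eq0.
by apply: (mulfI fx0); rewrite -(dfi_M iso) ?subfield_V // !divff // (dfi_1 iso).
Qed.

Local Notation R := (const_graph E1 f).

Lemma const_diff_subring : diff_subring (@derp (upow K1) (upow K2)) R.
Proof.
split.
- by exists 1; rewrite ?subfield_1 // (dfi_1 iso).
- move=> _ _ [x Ex ->] [y Ey ->]; exists (x - y); first exact: subfield_B.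
  by rewrite iso_B //; congr pair; rewrite /= /const -clsB.
- move=> _ _ [x Ex ->] [y Ey ->]; exists (x * y); first exact: subfield_M.
  by rewrite (dfi_M iso) //; congr pair; rewrite /= /const -clsM.
- move=> _ [x Ex ->]; exists (der x); first by case: sE => _; apply.
  by rewrite (dfi_der iso) //; congr pair; rewrite /= /const -cls_der.
Qed.

Lemma const_invp z : R z -> R (invp z).
Proof.
move=> [x Ex ->]; exists x^-1; first exact: subfield_V.
by rewrite iso_V //; congr pair; rewrite /= /const -clsV.
Qed.

Lemma const_graph_eq0 z : R z -> (z.1 == 0) = (z.2 == 0).
Proof. by move=> [x Ex ->]; rewrite /= !const_eq0 iso_eq0. Qed.

End ConstField.

Section Lift.
Variables (M : MoacModel) (dh : diff_henselian M).
Local Notation U := (upow_model (of_moac dh)).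

Definition l3_const (s : L3ac_sort) : L3ac_carrier M s -> L3S U s :=
  match s with
  | s_f => fun x => const x
  | s_r => omap (@const (mo_k M))
  | s_v => omap (@const (vdf_group M))
  end.

(** Los's theorem for constant sequences: the diagonal embedding is elementary. *)
Lemma sat_const p (e : assignment (L3ac_structure M)) :
  sat p e <-> @sat L3ac (L3S U) p (fun s n => l3_const (e s n)).
Proof.
apply: iff_trans (sat_of_moac dh p e) _; apply: iff_trans (iff_sym (ultra_const _)) _.
apply: iff_sym.
apply: (@l3_los (of_moac dh) p (fun _ => e)); case=> n /=; first by [].
  by case: (e s_r n) => [a|] /=; [apply: (opt_rep_some (z := fun _ => a))|];
    apply: (U_true ultraP).
by case: (e s_v n) => [a|] /=; [apply: (opt_rep_some (z := fun _ => a))|];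
  apply: (U_true ultraP).
Qed.

End Lift.

Section GoodMap.
Variables (K1 K2 : MoacModel) (dh1 : diff_henselian K1) (dh2 : diff_henselian K2).
Variables (E1 : good_substructure K1) (E2 : good_substructure K2).
Variables (f : K1 -> K2) (fr : mo_k K1 -> mo_k K2) (fv : vdf_group K1 -> vdf_group K2).
Hypothesis fgood : good_map E1 E2 f fr fv.
Local Notation U1 := (upow_model (of_moac dh1)).
Local Notation U2 := (upow_model (of_moac dh2)).

Definition graph_f : U1 * U2 -> Prop := const_graph (gs_E E1) f.
Definition graph_r : af_k U1 * af_k U2 -> Prop := const_graph (gs_k E1) fr.
Definition graph_v : af_G U1 * af_G U2 -> Prop := const_graph (gs_G E1) fv.

(** Compatibility with [c] is contained in elementarity: it is the preservation of an equation
    between an element of k and [c] of an element of Gamma. *)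
Lemma good_map_c g : g \in gs_G E1 -> fr (mo_c K1 g) = mo_c K2 (fv g).
Proof.
move=> Eg; pose e : assignment (Lrv_structure (mo_c K1)) :=
  fun s => match s with rv_r => fun _ => mo_c K1 g | rv_v => fun _ => g end.
pose t : @term Lrv rv_r := @App Lrv rv_c (fun _ => @Var Lrv rv_v 0).
have [|H _] := gm_elementary fgood (FEq (@Var Lrv rv_r 0) t) (e := e).
  by case=> n //=; apply: gs_c.
exact: (H erefl).
Qed.

Lemma elementary_graph : elementary graph_r graph_v.
Proof.
move=> p e1 e2 Hr Hv.
have /choice [a Ha] n : exists a, a \in gs_k E1 /\
    (e1 rv_r n, e2 rv_r n) = (const a, const (fr a)) by have [a] := Hr n; exists a.
have /choice [b Hb] n : exists b, b \in gs_G E1 /\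
    (e1 rv_v n, e2 rv_v n) = (const b, const (fv b)) by have [b] := Hv n; exists b.
pose e : assignment (Lrv_structure (mo_c K1)) :=
  fun s => match s with rv_r => a | rv_v => b end.
have H1 : sat p e1 <-> ultra (fun _ => sat p e).
  apply: (@rv_los (of_moac dh1) p (fun _ => e)); case=> n /=.
    by case: (Ha n) => _ [].
  by case: (Hb n) => _ [].
have H2 : sat p e2 <-> ultra (fun _ => sat p
    ((fun s n => Lrv_map fr fv (e s n)) : assignment (Lrv_structure (mo_c K2)))).
  apply: (@rv_los (of_moac dh2) p
    (fun _ => (fun s n => Lrv_map fr fv (e s n)))); case=> n /=.
    by case: (Ha n) => _ [].
  by case: (Hb n) => _ [].
have H3 := gm_elementary fgood p (e := e).
rewrite H1 H2 !ultra_const; apply: H3.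
by case=> n /=; [case: (Ha n)|case: (Hb n)].
Qed.

Lemma rv_iso_graph : rv_iso graph_r graph_v.
Proof.
have kE := gs_k_subfield E1; have isor := gm_fr fgood; have isov := gm_fv fgood.
have [G0 GB] := gs_G_subgroup E1.
have fv0 : fv 0 = 0 by apply: (addrI (fv 0)); rewrite -(ogi_D isov) // !addr0.
split.
- exact: (const_diff_subring kE isor).
- exact: (const_invp kE isor).
- exact: (const_graph_eq0 kE isor).
- by exists 0; rewrite ?fv0.
- move=> _ _ [g Eg ->] [h Eh ->]; exists (g - h); first exact: GB.
  have -> : fv (g - h) = fv g - fv h.
    by apply: (addIr (fv h)); rewrite -(ogi_D isov) ?GB // !subrK.
  by congr pair; rewrite /= /const -clsB.
- move=> _ _ [g Eg ->] [h Eh ->] /=.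
  rewrite [LHS]cls_le [RHS]cls_le -(ogi_le isov Eg Eh).
  by apply/asboolP/asboolP.
- move=> _ [g Eg ->]; exists (mo_c K1 g); first exact: gs_c.
  by rewrite (good_map_c Eg); congr pair; apply: umapE.
Qed.

Lemma good_graph : good graph_f graph_r graph_v.
Proof.
have sE := gs_E_subfield E1; have isof := gm_f fgood.
split; [exact: rv_iso_graph|exact: elementary_graph|split].
- exact: (const_diff_subring sE isof).
- exact: (const_invp sE isof).
move=> _ [x Ex ->]; split.
  exists (moac_ac x); first exact: gs_ac.
  by rewrite (gm_ac fgood Ex); congr pair; apply: umapE.
rewrite /= const_eq0 => x0; exists (vdf_v x); first exact: gs_v.
by rewrite (gm_v fgood Ex x0); congr pair; apply: umapE.
Qed.

End GoodMap.

Theorem theorem4p1 (K1 K2 : MoacModel)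
    (dh1 : diff_henselian K1) (dh2 : diff_henselian K2)
    (E1 : good_substructure K1) (E2 : good_substructure K2)
    (f : K1 -> K2) (fr : mo_k K1 -> mo_k K2)
    (fv : vdf_group K1 -> vdf_group K2)
    (fgood : good_map E1 E2 f fr fv) :
  @partial_elementary L3ac (L3ac_structure K1) (L3ac_structure K2)
    (L3ac_dom_of E1) (L3ac_map f fr fv).
Proof.
move=> p e He.
apply: iff_trans (sat_const dh1 p e) _; apply: iff_trans _ (iff_sym (sat_const dh2 p _)).
have gR := good_graph dh1 dh2 fgood.
have S1 := saturated_upow dh1; have S2 := saturated_upow dh2.
have Rel s n : l3_rel (@graph_f _ _ dh1 dh2 E1 f) (@graph_r _ _ dh1 dh2 E1 fr)
    (@graph_v _ _ dh1 dh2 E1 fv) (l3_const dh1 (e s n))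
    (l3_const dh2 (L3ac_map f fr fv (e s n))).
  case: s (e s n) (He s n) => [x Ex|[a Ea|]|[g Eg|]] //=;
    by [exists x|exists a|exists g].
split; first exact: (back_and_forth S1 S2 gR Rel).
by apply: (back_and_forth S2 S1 (good_swap gR)) => s n; apply: l3_rel_swap.
Qed.
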